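(* Consider the unknown-scale model with softplus-reparametrized scale described in the context. Suppose $k_n\sim n^a$ for some $a\in(0,1/2)$, and that for some $0\le\delta<1-a$: (A1) for each $n$ there is $\theta_{0n}=(\theta_{10n},\dots,\theta_{K(n)0n})$ with $\|f_{\theta_{0n}}-f_0\|_2=o(n^{-\delta})$; (A2) $\sum_{i=1}^{K(n)}\theta_{i0n}^2=o(n^{1-\delta})$. Then for every $\varepsilon>0$, $\pi^*(\mathcal V_\varepsilon^c)=o_{P_0^n}(n^{-\delta})$.
   Context: Data: i.i.d. pairs $(y_i,\mathbf x_i)$, $i=1,\dots,n$, with $\mathbf x_i\sim\mathrm{Uniform}[0,1]^p$ ($p$ fixed), $y_i=f_0(\mathbf x_i)+\xi_i$, $\xi_i\sim N(0,\sigma_0^2)$ independent of $\mathbf x_i$, $f_0$ square integrable, $\sigma_0>0$ unknown. $P_0^n$ is the true data law; $Z_n=o_{P_0^n}(r_n)$ means $Z_n/r_n\to0$ in $P_0^n$-probability; $\|\cdot\|_2$ is the $L_2([0,1]^p)$ norm. $\psi(u)=1/(1+e^{-u})$, $f_{\theta_n}(\mathbf x)=\beta_0+\sum_{j=1}^{k_n}\beta_j\psi(\gamma_{j0}+\sum_{h=1}^p\gamma_{jh}x_h)$, $\theta_n=(\theta_{1n},\dots,\theta_{K(n)n})$ all parameters, $K(n)$ their number. Parameter $\omega_n=(\theta_n,\rho)$ with $\sigma_\rho=\log(1+e^\rho)$; model density $l_{\omega_n}(y,\mathbf x)=(2\pi\sigma_\rho^2)^{-1/2}\exp(-(y-f_{\theta_n}(\mathbf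 x))^2/(2\sigma_\rho^2))$; $l_0$ the same with $f_0,\sigma_0$; $L(\omega_n)=\prod_{i=1}^nl_{\omega_n}(y_i,\mathbf x_i)$. Prior $p(\omega_n)=(2\pi\eta^2)^{-1/2}e^{-\rho^2/(2\eta^2)}\prod_{i=1}^{K(n)}(2\pi\zeta^2)^{-1/2}e^{-\theta_{in}^2/(2\zeta^2)}$ with fixed $\eta,\zeta>0$. Posterior $\pi(\omega_n|\mathbf y_n,\mathbf X_n)\propto L(\omega_n)p(\omega_n)$. $d_{KL}(q,p)=\int q\log(q/p)$. Variational family $\mathcal Q_n$: product densities $N(\rho;\tilde m_{0n},\tilde s_{0n}^2)\prod_{i=1}^{K(n)}N(\theta_{in};\tilde m_{in},\tilde s_{in}^2)$; $\pi^*=\arg\min_{q\in\mathcal Q_n}d_{KL}(q,\pi(\cdot|\mathbf y_n,\mathbf X_n))$. $d_H(l_0,l_{\omega_n})=\int\int(\sqrt{l_{\omega_n}}-\sqrt{l_0})^2dy\,d\mathbf x$, $\mathcal V_\varepsilon=\{\omega_n:d_H(l_0,l_{\omega_n})<\varepsilon\}$. *)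

(* Defs.v *)
From Stdlib Require List.
From HB Require Import structures.
From mathcomp Require Import all_boot all_order all_algebra.
From mathcomp Require Import all_classical all_reals all_analysis.
Set Implicit Arguments. Unset Strict Implicit. Unset Printing Implicit Defensive.
Import Order.TTheory GRing.Theory Num.Theory.
Import numFieldNormedType.Exports.
Local Open Scope classical_set_scope.
Local Open Scope ring_scope.

Section Defs.
Variable R : realType.

Definition consR (d : nat) (t : R) (x : 'I_d -> R) : 'I_d.+1 -> R :=
  fun i => match unlift ord0 i with Some j => x j | None => t end.

Fixpoint iint (d : nat) : (('I_d -> R) -> \bar R) -> \bar R :=
  match d as d0 return (('I_d0 -> R) -> \bar R) -> \bar R with
  | 0 => fun f => f (fun _ => 0)
  | d'.+1 => fun f =>
      (\int[@lebesgue_measure R]_(t in [set: R]) iint (fun x => f (consR t x)))%E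
  end.

Definition cube (p : nat) : set ('I_p -> R) := [set x | forall i, 0 <= x i <= 1].

Definition Rp_measurable (p : nat) : set (set ('I_p -> R)) :=
  <<s [set A | exists (i : 'I_p) (B : set R), measurable B /\ A = [set x | B (x i)]] >>.

Definition gdens (m v y : R) : R :=
  (Num.sqrt (2 * pi * v))^-1 * expR (- (y - m) ^+ 2 / (2 * v)).

Definition sigmoid (u : R) : R := (1 + expR (- u))^-1.
Definition softplus (rho : R) : R := ln (1 + expR rho).

(* number of network parameters: beta_0, beta_1..beta_k, gamma_{jh} (j=1..k, h=0..p) *)
Definition Kdim (k p : nat) : nat := (k * (p + 2)).+1.

(* flat parameter access; indices < Kdim k p *)
Definition par (k p : nat) (th : 'I_(Kdim k p) -> R) (m : nat) : R := th (inord m).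
(* beta_0 = par 0; beta_j = par j (j = 1..k);
   gamma_{j h} = par (k + (j-1)(p+1) + h + 1) (j = 1..k, h = 0..p) *)
Definition fnet (k p : nat) (th : 'I_(Kdim k p) -> R) (x : 'I_p -> R) : R :=
  par th 0 + \sum_(j < k) par th j.+1 *
     sigmoid (par th (k.+1 + j * p.+1)
              + \sum_(h < p) par th (k.+1 + j * p.+1 + h.+1) * x h).

Definition lmod (k p : nat) (th : 'I_(Kdim k p) -> R) (rho : R) (y : R) (x : 'I_p -> R) : R :=
  gdens (fnet th x) (softplus rho ^+ 2) y.
Definition ltrue (p : nat) (f0 : ('I_p -> R) -> R) (s0 : R) (y : R) (x : 'I_p -> R) : R :=
  gdens (f0 x) (s0 ^+ 2) y.

Definition hell (k p : nat) (f0 : ('I_p -> R) -> R) (s0 : R)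
  (th : 'I_(Kdim k p) -> R) (rho : R) : \bar R :=
  iint (fun x => (\1_(@cube p) x)%:E *
    \int[@lebesgue_measure R]_(y in [set: R])
       ((Num.sqrt (lmod th rho y x) - Num.sqrt (ltrue f0 s0 y x)) ^+ 2)%:E)%E.

Definition l2dist (p : nat) (f g : ('I_p -> R) -> R) : R :=
  Num.sqrt (fine (iint (fun x => (\1_(@cube p) x * (f x - g x) ^+ 2)%:E))).

Definition likelihood (n k p : nat) (xs : 'I_n -> 'I_p -> R) (ys : 'I_n -> R)
  (th : 'I_(Kdim k p) -> R) (rho : R) : R :=
  \prod_(i < n) lmod th rho (ys i) (xs i).

Definition prior (K : nat) (eta zeta : R) (th : 'I_K -> R) (rho : R) : R :=
  gdens 0 (eta ^+ 2) rho * \prod_(i < K) gdens 0 (zeta ^+ 2) (th i).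

Definition pint (K : nat) (F : ('I_K -> R) -> R -> \bar R) : \bar R :=
  (\int[@lebesgue_measure R]_(rho in [set: R]) iint (fun th => F th rho))%E.

Definition posterior (n k p : nat) (eta zeta : R) (xs : 'I_n -> 'I_p -> R) (ys : 'I_n -> R)
  (th : 'I_(Kdim k p) -> R) (rho : R) : R :=
  likelihood xs ys th rho * prior eta zeta th rho /
  fine (@pint (Kdim k p) (fun th' rho' => (likelihood (k:=k) xs ys th' rho' * prior eta zeta th' rho')%:E)).

(* variational parameters (m0, s0, m, s): density
   N(rho; m0, s0^2) * prod_i N(theta_i; m_i, s_i^2) *)
Definition vpar (K : nat) : Type := (R * R * ('I_K -> R) * ('I_K -> R))%type.

Definition vfamily (K : nat) (v : vpar K) : Prop :=
  0 < v.1.1.2 /\ forall i, 0 < v.2 i.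

Definition vdens (K : nat) (v : vpar K) (th : 'I_K -> R) (rho : R) : R :=
  gdens v.1.1.1 (v.1.1.2 ^+ 2) rho * \prod_(i < K) gdens (v.1.2 i) (v.2 i ^+ 2) (th i).

Definition KL (K : nat) (q pst : ('I_K -> R) -> R -> R) : \bar R :=
  pint (fun th rho => (q th rho * ln (q th rho / pst th rho))%:E).

Definition vmass_out (k p : nat) (f0 : ('I_p -> R) -> R) (s0 : R)
  (q : ('I_(Kdim k p) -> R) -> R -> R) (eps : R) : \bar R :=
  pint (fun th rho => (q th rho * \1_[set w | ~ (hell f0 s0 w.1 w.2 < eps%:E)%E] (th, rho))%:E).

End Defs.
Arguments cube {R} p.
Arguments Rp_measurable {R} p.
Arguments posterior {R n} k {p}.

Definition mutually_independent {R : realType} {d : measure_display} {Omega : measurableType d}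
  (P : probability Omega R) {I : Type} (Z : I -> Omega -> R) : Prop :=
  forall (s : seq I) (B : I -> set R), (forall i, measurable (B i)) ->
    Stdlib.Lists.List.NoDup s ->
    fine (P (\bigcap_(i in [set i | Stdlib.Lists.List.In i s]) (Z i @^-1` B i))) =
    \prod_(i <- s) fine (P (Z i @^-1` B i)).

(* Z_n = o_P(r_n): Z_n / r_n -> 0 in (outer) probability *)
Definition small_o_P {R : realType} {d : measure_display} {Omega : measurableType d}
  (P : probability Omega R) (Z : nat -> Omega -> R) (r : nat -> R) : Prop :=
  forall c eta : R, 0 < c -> 0 < eta ->
    \forall n \near \oo, exists A : set Omega, measurable A /\
       [set w | c < `|Z n w / r n| ] `<=` A /\ (P A < eta%:E)%E.

(* Main.v *)
(* Write [q] for the variational posterior, [V] for the set of parameters at Hellinger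
   distance at least [eps] from the truth, and [t = n eps / 4]. Gibbs' variational
   inequality applied to [t \1_V] gives [t q(V) <= ln (Z' / Z) + KL(q0, posterior)] for
   every mean-field Gaussian [q0], where [Z] is the evidence and [Z'] the same integral
   weighted by [exp(t \1_V)]. The [ln Z] in the divergence cancels, and it remains to
   bound [ln R] and the divergence relative to the true likelihood [L0], [R = Z' / L0].
   Outside an event of small probability [R] is bounded. By Tonelli the prior integral
   of the likelihood ratio has mean at most one; the part outside the box
   [|theta_i|, |rho| <= M sqrt n] has a Gaussian-small prior mass; inside the box and in
   [V], brackets over a grid of side [exp(-2 M sqrt n)] and Markov's inequality for the
   square root of the bracketed likelihood ratio (a Hellinger affinity) make the ratio
   at most [exp(-t)]. There are [exp(O(n^(a + 1/2)))] cells, which is where [a < 1/2]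
   enters.
   Finally [q0] is centred at [(theta_0n, rho_0)] with standard deviation [n^-3]. Its
   divergence is [O(K ln n + |theta_0n|^2 + n |f_theta_0n - f_0|_2) = o(n^(1 - delta))];
   polynomials and exponentials of [|rho - rho_0|] are integrated against a Gaussian by
   absorbing them in a Gaussian of twice the variance. *)

Require Import Defs.
From HB Require Import structures.
From mathcomp Require Import all_boot all_order all_algebra.
From mathcomp Require Import all_classical all_reals all_analysis.
From mathcomp Require Import measurable_realfun.
From mathcomp Require Import ring lra.
Set Implicit Arguments.
Unset Strict Implicit.
Import Order.TTheory GRing.Theory Num.Theory.
Import numFieldNormedType.Exports.
Local Open Scope classical_set_scope.
Local Open Scope ring_scope.

(** * Lebesgue measure on R^d and iterated integrals *)

(** [KL] is a bare iterated integral of an integrand that changes sign and is not known to be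
    integrable. Linearity is never applied to it: lower bounds come from
    [int f - int g <= int (f - g)] for nonnegative measurable [f] and [g], upper bounds from
    pointwise domination by Gaussian products whose iterated integrals are explicit. The minimiser
    [qstar] is an arbitrary function of the data, with no measurability. The exceptional event is
    therefore built from the evidence and the data alone, and off it the bound holds for every
    minimiser. The unknown scale shapes the sieve. On the box it can be as small as a multiple of
    [exp(- M sqrt n)], so a squared error in the mean is multiplied by a precision of order
    [exp(2 M sqrt n)]. The side [exp(- 2 M sqrt n)], once squared, beats this, at the price of a
    log-cardinality of order [sqrt n] per coordinate. The rate [t = n eps / 4] is what an affinity
    [1 - eps / 2] leaves: half of [eps / 2] is spent on bracketing, half of the remaining exponent
    on Markov's inequality, and squaring the root of the ratio doubles it back. *)

Definition cylinders (R : realType) (I : Type) : set (set (I -> R)) :=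
  [set A | exists (i : I) (B : set R), measurable B /\ A = [set x | B (x i)]].

(** The generators are those of [Rp_measurable], so the hypothesis on [f0] is measurability on
    [RI R 'I_p] by conversion. The index type is arbitrary because [option 'I_p] and
    ['I_n * option 'I_p] also index the data. *)
Notation RI R I := (g_sigma_algebraType (@cylinders R I)).

Definition lam (R : realType) : {sigma_finite_measure set (measurableTypeR R) -> \bar R} :=
  @lebesgue_measure R.

Definition push {d1 d2} {T1 : measurableType d1} {T2 : measurableType d2}
    (R : realType) (m : {measure set T1 -> \bar R}) (f : T1 -> T2)
    (mf : measurable_fun [set: T1] f) : {measure set T2 -> \bar R} :=
  measure_function_pushforward__canonical__measure_function_Measure m mf.

Section coordinates.
Context {R : realType}.

Lemma measurable_coord (I : Type) (i : I) :
  measurable_fun [set: RI R I] (fun x : RI R I => x i).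
Proof.
move=> _ B mB; rewrite setTI; apply: sub_sigma_algebra.
by exists i, B.
Qed.

Lemma measurable_to_RI {d} {T : measurableType d} (I : Type) (f : T -> RI R I) :
  (forall i, measurable_fun [set: T] (fun t => f t i)) ->
  measurable_fun [set: T] f.
Proof.
move=> mf; apply: (@measurability _ _ _ _ _ _ (@cylinders R I : set (set (RI R I)))) => //.
move=> _ [_ [i [B [mB ->]] <-]].
exact: (mf i measurableT B mB).
Qed.

Lemma measurable_consR n :
  measurable_fun [set: measurableTypeR R * RI R 'I_n]
    (fun z => consR z.1 z.2 : RI R 'I_n.+1).
Proof.
apply: measurable_to_RI => i; rewrite /consR.
case: (unliftP ord0 i) => [j|] _; last exact: measurable_fst.
exact: (measurableT_comp (measurable_coord j) measurable_snd).
Qed.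

Definition unconsR n (x : RI R 'I_n.+1) : measurableTypeR R * RI R 'I_n :=
  (x ord0, fun i => x (lift ord0 i)).

Lemma measurable_unconsR n : measurable_fun [set: RI R 'I_n.+1] (@unconsR n).
Proof.
apply/measurable_fun_pairP; split; first exact: measurable_coord.
by apply: measurable_to_RI => i; exact: measurable_coord.
Qed.

Lemma consRK n (z : measurableTypeR R * RI R 'I_n) : unconsR (consR z.1 z.2) = z.
Proof.
case: z => t x; rewrite /unconsR /consR /= unlift_none; congr pair.
by apply/funext => i; rewrite liftK.
Qed.

End coordinates.

Section product_sigma_finite.
Local Open Scope ereal_scope.
Context d1 d2 (T1 : measurableType d1) (T2 : measurableType d2) (R : realType).
Variable m1 : {sigma_finite_measure set T1 -> \bar R}.
Variable m2 : {sigma_finite_measure set T2 -> \bar R}.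

(** A name of its own lets the product measure carry the sigma-finite structure that iterating the
    product requires. *)
Definition sprod : set (T1 * T2) -> \bar R := m1 \x m2.

HB.instance Definition _ := Measure.on sprod.

Let sprod_sigma_finite : sigma_finite setT sprod.
Proof.
have /sigma_finiteP[F [TF ndF Foo]] := sigma_finiteT m1.
have /sigma_finiteP[G [TG ndG Goo]] := sigma_finiteT m2.
exists (fun n => F n `*` G n).
  rewrite -setXTT TF TG predeqE => -[x y]; split.
    move=> [/= [n _ Fnx] [k _ Gky]]; exists (maxn n k) => //; split.
    - by move: x Fnx; exact/subsetPset/ndF/leq_maxl.
    - by move: y Gky; exact/subsetPset/ndG/leq_maxr.
  by move=> [n _ []/= ? ?]; split; exists n.
move=> k; have [? ?] := Foo k; have [? ?] := Goo k.
split; first exact: measurableX.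
by rewrite /sprod product_measure1E// lte_mul_pinfty// ge0_fin_numE.
Qed.

HB.instance Definition _ := Measure_isSigmaFinite.Build _ _ _ sprod
  sprod_sigma_finite.

End product_sigma_finite.

Section cons_measure.
Context {R : realType} {n : nat}.
Variable m : {sigma_finite_measure set (RI R 'I_n) -> \bar R}.

Definition cons_measure : set (RI R 'I_n.+1) -> \bar R :=
  pushforward (sprod (lam R) m)%E
    (fun z : measurableTypeR R * RI R 'I_n => consR z.1 z.2 : RI R 'I_n.+1).

Let cons_measure0 : cons_measure set0 = 0%E.
Proof. by rewrite /cons_measure /pushforward preimage_set0 measure0. Qed.

Let cons_measure_ge0 A : (0 <= cons_measure A)%E.
Proof. exact: (measure_ge0 (sprod (lam R) m)). Qed.

Let cons_measure_sigma_additive : semi_sigma_additive cons_measure.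
Proof.
exact: (@measure_semi_sigma_additive _ _ _ (push _ (@measurable_consR R n))).
Qed.

HB.instance Definition _ := isMeasure.Build _ _ _ cons_measure
  cons_measure0 cons_measure_ge0 cons_measure_sigma_additive.

Let cons_measure_sigma_finite : sigma_finite [set: RI R 'I_n.+1] cons_measure.
Proof.
have [F FT Foo] := sigma_finiteT (sprod (lam R) m)%E.
exists (fun k => @unconsR R n @^-1` F k).
  by rewrite -preimage_bigcup -FT preimage_setT.
move=> k; have [mF Fk] := Foo k; split.
  by rewrite -[X in measurable X]setTI; exact: measurable_unconsR.
rewrite /cons_measure /pushforward -comp_preimage.
rewrite (_ : _ \o _ = id) //; apply/funext => z; exact: consRK.
Qed.

HB.instance Definition _ := Measure_isSigmaFinite.Build _ _ _
  cons_measure cons_measure_sigma_finite.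

End cons_measure.

(** Dimension zero is the Dirac mass at the zero function, the point at which [iint] evaluates; each
    further coordinate is added in front, as [iint] does. *)
Fixpoint leb {R : realType} (n : nat) : {sigma_finite_measure set (RI R 'I_n) -> \bar R} :=
  match n with
  | 0 => dirac ((fun _ => 0) : RI R 'I_0)
  | n'.+1 => cons_measure (leb n')
  end.

Section iint.
Context {R : realType}.

Lemma iintE n (f : RI R 'I_n -> \bar R) :
  measurable_fun [set: RI R 'I_n] f -> (forall x, 0 <= f x)%E ->
  iint f = (\int[leb n]_x f x)%E.
Proof.
elim: n f => [|n IH] f mf f0.
  by rewrite integral_dirac //= diracT mul1e.
have mfc := measurableT_comp mf (@measurable_consR R n).
transitivity (\int[sprod (lam R) (leb n)]_z f (consR z.1 z.2))%E; last first.
  apply/esym.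
  exact: (ge0_integral_pushforward (@measurable_consR R n) (sprod (lam R) (leb n)) measurableT mf (fun x _ => f0 x)).
rewrite /sprod fubini_tonelli1 //.
transitivity (\int[lam R]_t iint (fun x => f (consR t x)))%E; first by [].
apply: eq_integral => t _; rewrite IH //.
exact: (measurableT_comp mfc (@pair1_measurable _ _ (measurableTypeR R) (RI R 'I_n) t)).
Qed.

(* The library integral is [int f^+ - int f^-] with [+oo - +oo = -oo], a
   monotone convention, so no measurability is needed. *)
Lemma le_integralT {d} {T : measurableType d} (m : {measure set T -> \bar R})
    (f g : T -> \bar R) :
  (forall x, f x <= g x)%E -> (\int[m]_x f x <= \int[m]_x g x)%E.
Proof.
move=> fg.
have H (u v : T -> \bar R) : (forall x, 0 <= u x)%E -> (forall x, u x <= v x)%E ->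
    (\int[m]_x u x <= \int[m]_x v x)%E.
  move=> u0 uv.
  rewrite !ge0_integralTE //; last by move=> x; exact: le_trans (u0 x) (uv x).
  apply: ge_ereal_sup => _ [h hu <-]; apply: ereal_sup_ubound.
  by exists h => // x; exact: le_trans (hu x) (uv x).
rewrite [leLHS]integralE [leRHS]integralE; apply: leeB; apply: H => x //.
- by rewrite !funeposE ge_max !le_max fg /= lexx orbT.
- by rewrite !funenegE ge_max !le_max leeN2 fg /= lexx orbT.
Qed.

Lemma le_iint n (f g : ('I_n -> R) -> \bar R) :
  (forall x, f x <= g x)%E -> (iint f <= iint g)%E.
Proof.
elim: n f g => [|n IH] f g fg //=.
by apply: le_integralT => t; apply: IH => x.
Qed.

Lemma le_pint n (f g : ('I_n -> R) -> R -> \bar R) :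
  (forall th rho, f th rho <= g th rho)%E -> (pint f <= pint g)%E.
Proof. by move=> fg; apply: le_integralT => rho; exact: le_iint. Qed.

(** This half of linearity survives without integrability of [f]. If [g] has infinite integral the
    left side is [-oo]. Otherwise the negative part of [h = f - g] is below [g], hence integrable,
    and it remains to integrate [f + h^- <= h^+ + g], where everything is nonnegative. *)
Lemma integralB_le {d} {T : measurableType d} (m : {measure set T -> \bar R})
    (f g : T -> \bar R) :
  measurable_fun setT f -> measurable_fun setT g ->
  (forall x, 0 <= f x)%E -> (forall x, 0 <= g x)%E ->
  (\int[m]_x f x - \int[m]_x g x <= \int[m]_x (f x - g x))%E.
Proof.
move=> mf mg f0 g0.
have [goo|goo] := leP +oo%E (\int[m]_x g x)%E.
  move: goo; rewrite leye_eq => /eqP ->; rewrite addeNy; exact: leNye.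
pose h x := (f x - g x)%E.
have mh : measurable_fun setT h by exact: emeasurable_funB.
rewrite [leRHS](integralE _ _ h).
have hng : (\int[m]_x h^\- x <= \int[m]_x g x)%E.
  apply: le_integralT => x; rewrite funenegE ge_max g0 andbT /h.
  by move: (f x) (g x) (f0 x) (g0 x) => [a| |] [b| |] a0 b0 //=;
    rewrite -?EFinB -?EFinN ?lee_fin ?leey ?leNye // in a0 b0 *; lra.
have hnoo : (\int[m]_x h^\- x < +oo)%E by exact: le_lt_trans goo.
have hn0 : (0 <= \int[m]_x h^\- x)%E by apply: integral_ge0.
have gg0 : (0 <= \int[m]_x g x)%E by apply: integral_ge0.
have : (\int[m]_x f x + \int[m]_x h^\- x <= \int[m]_x h^\+ x + \int[m]_x g x)%E.
  rewrite -!ge0_integralD //; [|exact: measurable_funepos|exact: measurable_funeneg].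
  apply: le_integralT => x; rewrite funenegE funeposE /h.
  move: (f x) (g x) (f0 x) (g0 x) => [a| |] [b| |] a0 b0 //=;
    rewrite -?EFinB -?EFinN -?EFin_max ?lee_fin // in a0 b0 *.
  - by rewrite !maxElt; case: ltP => ?; case: ltP => ?; lra.
  - by rewrite addeNy maxye max_r ?leNye // addey // leey.
  - have -> : (+oo + (- b)%:E)%E = +oo%E :> \bar R by [].
    by rewrite maxye [leRHS]addye // leey.
  - by rewrite maxye addeNy max_r ?leNye // addey // leey.
move=> fg; rewrite leeBlDr ?ge0_fin_numE //.
by rewrite addeAC -[X in (_ <= X)%E]/(_ - _)%E leeBrDr ?ge0_fin_numE.
Qed.

Lemma measurable_slice n (f : RI R 'I_n.+1 -> \bar R) (t : R) :
  measurable_fun [set: RI R 'I_n.+1] f ->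
  measurable_fun [set: RI R 'I_n] (fun x => f (consR t x)).
Proof.
move=> mf; have mfc := measurableT_comp mf (@measurable_consR R n).
exact: (measurableT_comp mfc (@pair1_measurable _ _ (measurableTypeR R) (RI R 'I_n) t)).
Qed.

Lemma measurable_iint_slice n (f : RI R 'I_n.+1 -> \bar R) :
  measurable_fun [set: RI R 'I_n.+1] f -> (forall x, 0 <= f x)%E ->
  measurable_fun [set: measurableTypeR R] (fun t => iint (fun x => f (consR t x))).
Proof.
move=> mf f0; have mfc := measurableT_comp mf (@measurable_consR R n).
apply: (eq_measurable_fun (fubini_F (leb n) (fun z => f (consR z.1 z.2)))).
  by move=> t _; rewrite iintE //; exact: measurable_slice.
exact: measurable_fun_fubini_tonelli_F.
Qed.

Lemma iint_ge0 n (f : ('I_n -> R) -> \bar R) :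
  (forall x, 0 <= f x)%E -> (0 <= iint f)%E.
Proof.
elim: n f => [|n IH] f f0 //=.
by apply: integral_ge0 => t _; exact: IH.
Qed.

Lemma iintB_le n (f g : RI R 'I_n -> \bar R) :
  measurable_fun setT f -> measurable_fun setT g ->
  (forall x, 0 <= f x)%E -> (forall x, 0 <= g x)%E ->
  (iint f - iint g <= iint (fun x => f x - g x))%E.
Proof.
elim: n f g => [|n IH] f g mf mg f0 g0 //=.
apply: le_trans.
  apply: integralB_le; [exact: measurable_iint_slice|exact: measurable_iint_slice| |];
    by move=> t; exact: iint_ge0.
apply: le_integralT => t.
by apply: (IH (fun x => f (consR t x)) (fun x => g (consR t x))) => //; exact: measurable_slice.
Qed.

(** The coefficients may be negative, so Tonelli does not apply; integrability of the factors makes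
    each one-dimensional integral linear. In the induction the factor of the first coordinate is
    absorbed into the coefficient. *)
Lemma iint_sum_prod n (J : Type) (s : seq J) (c : J -> R) (phi : J -> 'I_n -> R -> R) :
  (forall j i, (@lebesgue_measure R).-integrable setT (EFin \o phi j i)) ->
  (forall j i, \int[@lebesgue_measure R]_t (phi j i t)%:E = 1)%E ->
  iint (fun x => (\sum_(j <- s) c j * \prod_(i < n) phi j i (x i))%:E) =
  (\sum_(j <- s) c j)%:E.
Proof.
elim: n c phi => [|n IH] c phi iphi phi1 /=.
  by congr EFin; apply: eq_bigr => j _; rewrite big_ord0 mulr1.
under eq_integral => t _.
  under eq_fun => x.
    under eq_bigr => j _.
      rewrite big_ord_recl /= mulrA {1}/consR unlift_none.
      under eq_bigr => i _ do rewrite /consR liftK.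
      over.
    over.
  rewrite (IH (fun j => c j * phi j ord0 t) (fun j i => phi j (lift ord0 i))) //.
  rewrite -sumEFin; under eq_bigr => j _ do rewrite EFinM.
  over.
rewrite integral_sum //; last by move=> j; apply: integrableZl => //; exact: iphi.
rewrite -sumEFin; apply: eq_bigr => j _.
by rewrite integralZl //; [rewrite phi1 mule1|exact: iphi].
Qed.

End iint.

Section pint.
Context {R : realType} {K : nat}.
Local Notation Om := (measurableTypeR R * RI R 'I_K)%type.

Definition pleb : {sigma_finite_measure set Om -> \bar R} := sprod (lam R) (leb K).

Lemma measurable_fun_slice2 (F : Om -> \bar R) (r : R) :
  measurable_fun setT F -> measurable_fun [set: RI R 'I_K] (fun th => F (r, th)).
Proof.
move=> mF.
exact: (measurableT_comp mF (@pair1_measurable _ _ (measurableTypeR R) (RI R 'I_K) r)).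
Qed.

Lemma pintE (F : ('I_K -> R) -> R -> \bar R) :
  measurable_fun [set: Om] (fun w => F w.2 w.1) ->
  (forall th rho, 0 <= F th rho)%E ->
  pint F = (\int[pleb]_w F w.2 w.1)%E.
Proof.
move=> mF F0; rewrite /pleb /sprod fubini_tonelli1 //.
apply: eq_integral => r _; rewrite iintE //.
exact: (@measurable_fun_slice2 (fun w => F w.2 w.1)).
Qed.

Lemma measurable_iint_slice2 (F : Om -> \bar R) :
  measurable_fun setT F -> (forall w, 0 <= F w)%E ->
  measurable_fun [set: measurableTypeR R] (fun r => iint (fun th => F (r, th))).
Proof.
move=> mF F0; apply: (eq_measurable_fun (fubini_F (leb K) F)).
  by move=> t _; rewrite iintE //; exact: measurable_fun_slice2.
exact: measurable_fun_fubini_tonelli_F.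
Qed.

Lemma pintB_le (F G : ('I_K -> R) -> R -> \bar R) :
  measurable_fun [set: Om] (fun w => F w.2 w.1) ->
  measurable_fun [set: Om] (fun w => G w.2 w.1) ->
  (forall th rho, 0 <= F th rho)%E -> (forall th rho, 0 <= G th rho)%E ->
  (pint F - pint G <= pint (fun th rho => F th rho - G th rho))%E.
Proof.
move=> mF mG F0 G0; apply: le_trans.
  apply: integralB_le; [exact: (measurable_iint_slice2 mF)|exact: (measurable_iint_slice2 mG)| |];
    by move=> t; exact: iint_ge0.
apply: le_integralT => t.
by apply: iintB_le => //; [exact: (measurable_fun_slice2 _ mF)|exact: (measurable_fun_slice2 _ mG)].
Qed.

Lemma pint_sum_prod (J : Type) (s : seq J) (c : J -> R) (g : J -> R -> R)
    (phi : J -> 'I_K -> R -> R) :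
  (forall j, (@lebesgue_measure R).-integrable setT (EFin \o g j)) ->
  (forall j, \int[@lebesgue_measure R]_t (g j t)%:E = 1)%E ->
  (forall j i, (@lebesgue_measure R).-integrable setT (EFin \o phi j i)) ->
  (forall j i, \int[@lebesgue_measure R]_t (phi j i t)%:E = 1)%E ->
  pint (fun th rho => (\sum_(j <- s) c j * (g j rho * \prod_(i < K) phi j i (th i)))%:E) =
  (\sum_(j <- s) c j)%:E.
Proof.
move=> ig g1 iphi phi1; rewrite /pint.
under eq_integral => r _.
  under eq_fun => x do under eq_bigr => j _ do rewrite mulrA.
  rewrite (iint_sum_prod _ (fun j => c j * g j r)) //.
  rewrite -sumEFin; under eq_bigr => j _ do rewrite EFinM.
  over.
rewrite integral_sum //; last by move=> j; apply: integrableZl => //; exact: ig.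
rewrite -sumEFin; apply: eq_bigr => j _.
by rewrite integralZl //; [rewrite g1 mule1|exact: ig].
Qed.

End pint.

(** * Gaussian densities and the softplus scale *)

Section measurability.
Context d (T : measurableType d) (R : realType).
Implicit Types f g : T -> R.

Lemma measurable_sqrt_ge0 f : (forall t, 0 <= f t) ->
  measurable_fun setT f -> measurable_fun setT (fun t => Num.sqrt (f t)).
Proof.
move=> f0 mf; apply: (eq_measurable_fun (fun t => f t `^ (2^-1))).
  by move=> t _; rewrite powR12_sqrt.
exact: (measurableT_comp (measurable_powR _) mf).
Qed.

Lemma measurable_inv_gt0 f : (forall t, 0 < f t) ->
  measurable_fun setT f -> measurable_fun setT (fun t => (f t)^-1).
Proof.
move=> f0 mf; apply: (eq_measurable_fun (fun t => f t `^ (-1))).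
  by move=> t _; rewrite powR_inv1 // ltW.
exact: (measurableT_comp (measurable_powR _) mf).
Qed.

Lemma measurable_gdens (m v y : T -> R) : (forall t, 0 < v t) ->
  measurable_fun setT m -> measurable_fun setT v -> measurable_fun setT y ->
  measurable_fun setT (fun t => gdens (m t) (v t) (y t) : R).
Proof.
move=> v0 mm mv my; rewrite /gdens.
have m2v (c : R) : measurable_fun setT (fun t => c * v t) by exact: measurable_funM.
apply: measurable_funM.
  apply: measurable_inv_gt0; first by move=> t; rewrite sqrtr_gt0 !mulr_gt0 // pi_gt0.
  by apply: measurable_sqrt_ge0 => // t; rewrite ltW // !mulr_gt0 // pi_gt0.
suff me : measurable_fun setT (fun t => - (y t - m t) ^+ 2 / (2 * v t)).
  exact: (measurableT_comp (@measurable_expR R) me).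
apply: measurable_funM.
  by apply: measurableT_comp => //; apply: measurable_funX; exact: measurable_funB.
by apply: measurable_inv_gt0 => // t; rewrite mulr_gt0.
Qed.

End measurability.

Lemma expR_ge1 (R : realType) (x : R) : 0 <= x -> 1 <= expR x.
Proof. by move=> x0; rewrite -[leLHS]expR0 ler_expR. Qed.

Section gaussian.
Context {R : realType}.
Implicit Types m v x c : R.

Lemma gdens_gt0 m v x : 0 < v -> 0 < gdens m v x.
Proof.
by move=> v0; rewrite mulr_gt0 ?expR_gt0 // invr_gt0 sqrtr_gt0 !mulr_gt0 // pi_gt0.
Qed.

Lemma gdens_pdf m (s : R) x : 0 < s -> gdens m (s ^+ 2) x = normal_pdf m s x.
Proof.
move=> s0; rewrite normal_pdfE ?gt_eqF // /gdens /normal_peak /normal_fun.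
congr (_^-1 * expR (_ / _)); last by rewrite mulr_natl.
by congr Num.sqrt; rewrite -mulr_natl; ring.
Qed.

Lemma gdens_pdf_sqrt m v x : 0 < v -> gdens m v x = normal_pdf m (Num.sqrt v) x.
Proof. by move=> v0; rewrite -gdens_pdf ?sqrtr_gt0 // sqr_sqrtr // ltW. Qed.

Lemma integral_gdens m v : 0 < v ->
  (\int[@lebesgue_measure R]_t (gdens m v t)%:E = 1)%E.
Proof.
move=> v0; under eq_integral do rewrite gdens_pdf_sqrt //.
exact: integral_normal_pdf.
Qed.

Lemma integrable_gdens m v : 0 < v ->
  (@lebesgue_measure R).-integrable setT (EFin \o gdens m v).
Proof.
move=> v0; rewrite (_ : gdens m v = normal_pdf m (Num.sqrt v)); last first.
  by apply/funext => x; exact: gdens_pdf_sqrt.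
exact: integrable_normal_pdf.
Qed.

Lemma gdens_shift m a v x : gdens (m + a) v (x + a) = gdens m v x.
Proof. by rewrite /gdens opprD addrACA subrr addr0. Qed.

Lemma ln_gdens m v x : 0 < v ->
  ln (gdens m v x) = - (ln (2 * pi * v) / 2) - (x - m) ^+ 2 / (2 * v).
Proof.
move=> v0; have p0 : 0 < 2 * pi * v :> R by rewrite !mulr_gt0 // pi_gt0.
have s0 : 0 < Num.sqrt (2 * pi * v) by rewrite sqrtr_gt0.
rewrite /gdens [in LHS]lnM ?posrE ?invr_gt0 ?expR_gt0 // expRK mulNr; congr (_ + _).
by rewrite lnV ?posrE // -powR12_sqrt ?ltW // ln_powR mulrC.
Qed.

(** The weight cancels half of the exponent, which leaves that of variance [2 v]; [sqrt 2] is the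
    ratio of the normalising constants. *)
Lemma gdens_inflate m v x : 0 < v ->
  gdens m v x * expR ((x - m) ^+ 2 / (4 * v)) = Num.sqrt 2 * gdens m (2 * v) x.
Proof.
move=> v0; rewrite /gdens.
rewrite (_ : 2 * pi * (2 * v) = 2 * (2 * pi * v)); last by ring.
have s2 : Num.sqrt 2 != 0 :> R by rewrite gt_eqF // sqrtr_gt0.
have B0 : Num.sqrt (2 * pi * v) != 0 by rewrite gt_eqF // sqrtr_gt0 !mulr_gt0 // pi_gt0.
rewrite (@sqrtrM _ 2) // -[LHS]mulrA -expRD.
have -> : - (x - m) ^+ 2 / (2 * v) + (x - m) ^+ 2 / (4 * v) = - (x - m) ^+ 2 / (2 * (2 * v)).
  by field; rewrite gt_eqF.
move: (Num.sqrt 2) s2 (Num.sqrt _) B0 (expR _) => A A0 B B0 E.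
by field; rewrite A0 B0.
Qed.

Lemma gdens_inflate_le m v x c h : 0 < v -> h <= c * expR ((x - m) ^+ 2 / (4 * v)) ->
  gdens m v x * h <= c * Num.sqrt 2 * gdens m (2 * v) x.
Proof.
move=> v0 hc; rewrite -mulrA -gdens_inflate // mulrCA.
by rewrite ler_pM2l ?gdens_gt0.
Qed.

Lemma sqr_le_inflate v (e : R) : 0 < v -> e ^+ 2 <= 4 * v * expR (e ^+ 2 / (4 * v)).
Proof.
move=> v0; have := expR_ge1Dx (e ^+ 2 / (4 * v)).
rewrite -(@ler_pM2l _ (4 * v)) ?mulr_gt0 //; apply: le_trans.
rewrite mulrDr mulr1 [X in _ + X]mulrC divfK ?gt_eqF ?mulr_gt0 //; lra.
Qed.

Lemma norm_le_inflate (t e : R) : 0 < t ->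
  `|e| <= 2 * t * expR (e ^+ 2 / (4 * t ^+ 2)).
Proof.
move=> t0; have t20 : 0 < t ^+ 2 by rewrite exprn_gt0.
have := expR_ge1Dx (e ^+ 2 / (4 * t ^+ 2)).
rewrite -(@ler_pM2l _ (2 * t)) ?mulr_gt0 //; apply: le_trans.
rewrite (_ : 2 * t * _ = 2 * t + e ^+ 2 / (2 * t)); last by field; rewrite gt_eqF.
have t2 : 0 < 2 * t by rewrite mulr_gt0.
rewrite -(ler_pM2r t2) (_ : (2 * t + e ^+ 2 / (2 * t)) * (2 * t) = 4 * t ^+ 2 + e ^+ 2); last first.
  by field; rewrite gt_eqF.
have := sqr_ge0 (`|e| - t); rewrite sqrrB -[e ^+ 2]real_normK ?num_real //.
by have := sqr_ge0 t; nra.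
Qed.

Lemma expR_norm_inflate (v e : R) : 0 < v ->
  expR (2 * `|e|) <= expR (4 * v) * expR (e ^+ 2 / (4 * v)).
Proof.
move=> v0; rewrite -expRD ler_expR.
have v4 : 0 < 4 * v by rewrite mulr_gt0.
rewrite -(ler_pM2r v4) (_ : (4 * v + e ^+ 2 / (4 * v)) * (4 * v) = (4 * v) ^+ 2 + e ^+ 2); last first.
  by field; rewrite gt_eqF.
have := sqr_ge0 (`|e| - 4 * v); rewrite -[e ^+ 2]real_normK ?num_real //; nra.
Qed.

(** The bound has to vanish with [t], because the factor is later multiplied by a sum of [n] squared
    noises. Hence [exp x - 1 <= x exp x], where [x] and [exp x] each use one half of the available
    exponent, that is, the previous bounds at variance [2 t^2]. *)
Lemma expR_norm_sub1_inflate (t e : R) : 0 < t ->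
  expR (2 * `|e|) - 1 <= 8 * t * expR (8 * t ^+ 2) * expR (e ^+ 2 / (4 * t ^+ 2)).
Proof.
move=> t0; have t20 : 0 < t ^+ 2 by rewrite exprn_gt0.
have h1 : expR (2 * `|e|) - 1 <= 2 * `|e| * expR (2 * `|e|).
  have := expR_ge1Dx (- (2 * `|e|)).
  rewrite -(ler_pM2r (expR_gt0 (2 * `|e|))) -expRD addNr expR0; lra.
apply: (le_trans h1).
have h2 := @expR_norm_inflate (2 * t ^+ 2) e ltac:(by rewrite mulr_gt0).
have h3 : 2 * `|e| <= 8 * t * expR (e ^+ 2 / (4 * (2 * t ^+ 2))).
  have := @norm_le_inflate (Num.sqrt 2 * t) e ltac:(by rewrite mulr_gt0 ?sqrtr_gt0).
  rewrite exprMn sqr_sqrtr // => /le_trans; move=> /(_ (4 * t * expR (e ^+ 2 / (4 * (2 * t ^+ 2))))).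
  have s2 : Num.sqrt 2 <= 2 :> R.
    by rewrite -(@ler_pXn2r _ 2) ?nnegrE ?sqrtr_ge0 // sqr_sqrtr // expr2; lra.
  have -> : 8 * t * expR (e ^+ 2 / (4 * (2 * t ^+ 2))) = 2 * (4 * t * expR (e ^+ 2 / (4 * (2 * t ^+ 2)))) by ring.
  rewrite ler_pM2l //; apply.
  by rewrite ler_pM2r ?expR_gt0 // mulrA ler_pM2r //; lra.
apply: (le_trans (ler_pM _ _ h3 h2)); rewrite ?mulr_ge0 ?expR_ge0 //.
rewrite le_eqVlt; apply/orP; left; apply/eqP.
rewrite (_ : 4 * (2 * t ^+ 2) = 8 * t ^+ 2); last by ring.
rewrite -!mulrA; congr (_ * (_ * _)); rewrite mulrCA; congr (_ * _).
by rewrite -expRD; congr expR; field; rewrite gt_eqF.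
Qed.

End gaussian.

Section softplus.
Context {R : realType}.

Lemma softplus_gt0 (r : R) : 0 < softplus r.
Proof. by rewrite ln_gt0 // ltrDl expR_gt0. Qed.

(** Convexity of the exponential: [u] is the average of [a u] and [0] with weights [1 / a] and
    [1 - 1 / a]. Both values are compared with the tangent at [u]. *)
Lemma expR_mulr_le (a u : R) : 1 <= a -> expR u <= 1 + (expR (a * u) - 1) / a.
Proof.
move=> a1; have a0 : 0 < a by rewrite (lt_le_trans _ a1).
have h w : expR u * (w - u + 1) <= expR w.
  have := expR_ge1Dx (w - u); rewrite -(ler_pM2l (expR_gt0 u)) -expRD (addrC u) subrK.
  by rewrite (addrC 1).
have h1 : expR u * (a * u - u + 1) <= expR (a * u) by exact: h.
have h0 : expR u * (0 - u + 1) <= 1 by rewrite -[leRHS]expR0; exact: h.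
rewrite -(ler_pM2r a0) mulrDl divfK ?gt_eqF //.
have h2 : expR u * (0 - u + 1) * (a - 1) <= 1 * (a - 1) by rewrite ler_wpM2r // subr_ge0.
lra.
Qed.

(* Bernoulli: [ln (1 + a t) <= a ln (1 + t)] for [a >= 1], with [t = expR r'] and
   [a = expR (r - r')]. *)
Lemma softplus_le (r r' : R) : softplus r <= softplus r' * expR `|r - r'|.
Proof.
have [rr|rr] := leP r r'.
  apply: (@le_trans _ _ (softplus r')).
    by rewrite /softplus ler_ln ?posrE ?ltr_pwDl ?expR_ge0 // lerD2l ler_expR.
  by rewrite ler_peMr ?(ltW (softplus_gt0 _)) // expR_ge1.
rewrite gtr0_norm ?subr_gt0 //.
set a := expR (r - r').
have a1 : 1 <= a by rewrite expR_ge1 // subr_ge0 ltW.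
have a0 : 0 < a by exact: expR_gt0.
have er : expR r = a * expR r' by rewrite -expRD subrK.
rewrite -ler_pdivrMr // /softplus -[leLHS]expRK ler_ln ?posrE ?expR_gt0 //.
apply: (le_trans (@expR_mulr_le a _ a1)).
have -> : a * (ln (1 + expR r) / a) = ln (1 + expR r) by rewrite mulrC divfK // gt_eqF.
have r1 : 0 < 1 + expR r by rewrite ltr_pwDl ?expR_ge0.
rewrite lnK ?posrE // lerD2l er; rewrite (_ : 1 + _ - 1 = a * expR r'); last by ring.
by rewrite mulrC mulKf ?gt_eqF.
Qed.

Lemma softplus_surj (s : R) : 0 < s -> exists r, softplus r = s.
Proof.
move=> s0; exists (ln (expR s - 1)).
have e1 : 0 < expR s - 1 by rewrite subr_gt0 expR_gt1.
by rewrite /softplus lnK ?posrE // addrC subrK expRK.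
Qed.

Lemma measurable_softplus : measurable_fun setT (@softplus R).
Proof.
have me : measurable_fun setT (fun r : R => 1 + expR r).
  by apply: measurable_funD => //; exact: measurable_expR.
exact: (measurableT_comp (@measurable_ln R) me).
Qed.

End softplus.

(** * Densities, boxes and independence *)

Section density.
Context d (T : measurableType d) (R : realType).
Variables (mu nu : {measure set T -> \bar R}) (g : T -> R).
Hypotheses (mg : measurable_fun [set: T] g) (g0 : forall x, 0 <= g x).
Hypothesis nuE : forall A, measurable A -> nu A = (\int[mu]_(x in A) (g x)%:E)%E.

Import HBNNSimple.

Let integral_density_nnsfun (h : {nnsfun T >-> R}) :
  (\int[nu]_x (h x)%:E = \int[mu]_x ((h x)%:E * (g x)%:E))%E.
Proof.
have mh r : measurable (h @^-1` [set r]) by [].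
rewrite integralT_nnsfun sintegralE.
transitivity (\sum_(r \in range h) (\int[mu]_x (r * \1_(h @^-1` [set r]) x * g x)%:E))%E; last first.
  rewrite -ge0_integral_fsum //.
  - apply: eq_integral => x _; rewrite fsumEFin // -EFinM; congr EFin.
    by rewrite [in RHS]fimfunE mulr_fsuml.
  - move=> r; apply/measurable_EFinP; apply: measurable_funM => //.
    exact: measurable_funM.
  - by move=> r x _; rewrite lee_fin mulr_ge0 // -lee_fin nnfun_muleindic_ge0.
apply: eq_fsbigr => r; rewrite inE => -[x0 _ hx0].
have r0 : 0 <= r by rewrite -hx0.
under eq_integral do rewrite -mulrA EFinM.
rewrite ge0_integralZl_EFin //; last first.
- by apply/measurable_EFinP; exact: measurable_funM.
- by move=> x _; rewrite lee_fin mulr_ge0.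
congr (_ * _)%E; rewrite nuE // integral_mkcond; apply: eq_integral => x _.
by rewrite patchE indicE; case: ifPn => xA; rewrite ?mul1r ?mul0r.
Qed.

Lemma ge0_integral_density (f : T -> \bar R) :
  measurable_fun [set: T] f -> (forall x, 0 <= f x)%E ->
  (\int[nu]_x f x = \int[mu]_x (f x * (g x)%:E))%E.
Proof.
move=> mf f0; pose f_ := nnsfun_approx measurableT mf.

transitivity (limn (fun n => \int[nu]_x (f_ n x)%:E))%E.
  rewrite -monotone_convergence //.
  - by apply: eq_integral => x _; apply/esym/cvg_lim => //; exact: cvg_nnsfun_approx.
  - by move=> n; exact/measurable_EFinP.
  - by move=> n x _; rewrite lee_fin.
  - by move=> x _ m n mn; rewrite lee_fin; exact/lefP/nd_nnsfun_approx.
under eq_fun do rewrite integral_density_nnsfun.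
rewrite -monotone_convergence //.
- apply: eq_integral => x _; apply/cvg_lim => //.
  by apply: cvgeZr => //; exact: cvg_nnsfun_approx.
- by move=> n; apply: emeasurable_funM; exact/measurable_EFinP.
- by move=> n x _; rewrite mule_ge0 // lee_fin.
- move=> x _ m n mn; rewrite lee_wpmul2r ?lee_fin //.
  exact/lefP/nd_nnsfun_approx.
Qed.

End density.

Definition mkmfun {d1 d2} {T1 : measurableType d1} {T2 : measurableType d2}
    (f : T1 -> T2) (mf : measurable_fun [set: T1] f) : {mfun T1 >-> T2} :=
  HB.pack f (isMeasurableFun.Build _ _ _ _ f mf).

Section boxes.
Context {R : realType} {S : finType}.

Definition box (B : S -> set R) : set (RI R S) := [set x | forall s, B s (x s)].

Lemma boxE (B : S -> set R) : box B = \bigcap_(s in [set: S]) [set x : RI R S | B s (x s)].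
Proof. by apply/seteqP; split=> [x Bx s _|x Bx s]; exact: Bx. Qed.

Lemma measurable_box (B : S -> set R) :
  (forall s, measurable (B s)) -> measurable (box B).
Proof.
move=> mB; rewrite boxE; apply: fin_bigcap_measurable => [|s _]; first exact: finite_finset.
by apply: sub_sigma_algebra; exists s, (B s).
Qed.

Definition boxes : set (set (RI R S)) :=
  [set A | exists B, (forall s, measurable (B s)) /\ A = box B].

Lemma measurable_RIE : @measurable _ (RI R S) = <<s boxes >>.
Proof.
apply/seteqP; split; apply: smallest_sub.
- exact: smallest_sigma_algebra.
- move=> _ [i [B [mB ->]]]; apply: sub_sigma_algebra.
  exists (fun s => if s == i then B else setT); split; first by move=> s; case: eqP.
  apply/seteqP; split=> [x Bx s|x /(_ i)]; last by rewrite eqxx.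
  by case: eqP => // ->.
- exact: sigma_algebra_measurable.
- by move=> _ [B [mB ->]]; exact: measurable_box.
Qed.

(** Boxes form a pi-system that generates the sigma-algebra because [S] is finite, and the whole
    space is a box of finite mass. *)
Lemma box_unique (m1 m2 : {measure set (RI R S) -> \bar R}) :
  (m1 setT < +oo)%E ->
  (forall B, (forall s, measurable (B s)) -> m1 (box B) = m2 (box B)) ->
  forall A, measurable A -> m1 A = m2 A.
Proof.
move=> m1oo m12 A mA; apply: (measure_unique boxes (fun _ => setT)) => //.
- exact: measurable_RIE.
- move=> _ _ [B [mB ->]] [C [mC ->]]; exists (fun s => B s `&` C s); split.
    by move=> s; exact: measurableI.
  apply/seteqP; split=> [x [Bx Cx] s|x BCx]; first by split.
  by split=> s; have [] := BCx s.
- move=> _; exists (fun=> setT); split=> //.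
  by apply/seteqP; split.
- by rewrite bigcup_const //; exists 0%N.
- by move=> _ [B [mB ->]]; exact: m12.
Qed.

End boxes.

Section leb_box.
Context {R : realType}.

Lemma leb_box n (B : 'I_n -> set R) : (forall i, measurable (B i)) ->
  leb n (box B) = (\prod_(i < n) lam R (B i))%E.
Proof.
elim: n B => [|n IH] B mB.
  rewrite big_ord0 (_ : box B = setT); first exact: diracT.
  by apply/seteqP; split => // x _ [].
rewrite big_ord_recl -IH // -product_measure1E //; last first.
- by apply: measurable_box.
- exact: mB.
change ((lam R \x leb n)%E ((fun z => consR z.1 z.2) @^-1` box B) = (lam R \x leb n)%E (B ord0 `*` box (fun i => B (lift ord0 i)))).
suff -> : (fun z => consR z.1 z.2) @^-1` box B = B ord0 `*` box (fun i => B (lift ord0 i)) by [].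
apply/seteqP; split=> -[t x] /=.
- move=> Bx; split; first by have := Bx ord0; rewrite /consR unlift_none.
  by move=> i; have := Bx (lift ord0 i); rewrite /consR liftK.
- move=> [Bt Bx] i; rewrite /consR; case: (unliftP ord0 i) => [j ->|-> //].
  exact: Bx.
Qed.

Lemma cube_box n : cube n = box (fun=> [set t : R | 0 <= t <= 1]) :> set (RI R 'I_n).
Proof. by []. Qed.

Lemma measurable_unit : measurable [set t : R | 0 <= t <= 1].
Proof.
by rewrite (_ : [set t : R | _] = `[0%R, 1%R]%classic).
Qed.

Lemma measurable_cube n : measurable (cube n : set (RI R 'I_n)).
Proof. by rewrite cube_box; apply: measurable_box => i; exact: measurable_unit. Qed.

Lemma leb_cube n : leb n (cube n : set (RI R 'I_n)) = 1%E.
Proof.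
rewrite cube_box leb_box; last by move=> i; exact: measurable_unit.
rewrite big1 // => i _; rewrite (_ : [set t : R | _] = `[0%R, 1%R]%classic); last first.
  by apply/seteqP; split=> t /=; rewrite in_itv.
by rewrite /lam /= lebesgue_measure_itv /= lte01 oppr0 adde0.
Qed.

Lemma ge0_integral_translate (f : R -> \bar R) (c : R) :
  measurable_fun [set: R] f -> (forall x, 0 <= f x)%E ->
  (\int[@lebesgue_measure R]_t f (t + c)%R = \int[@lebesgue_measure R]_t f t)%E.
Proof.
move=> mf f0.
have ms : measurable_fun [set: measurableTypeR R] (fun t => t + c : measurableTypeR R).
  by apply: measurable_funD.
rewrite -(ge0_integral_pushforward ms (lam R) measurableT mf (fun x _ => f0 x)).
apply: eq_measure_integral => A mA _; apply/esym.
have := @lebesgue_measure_unique R (push (lam R) ms).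
move=> H; apply: H => // _ [[a b] _ <-] /=.
rewrite /pushforward (_ : _ @^-1` _ = `]a - c, b - c]%classic); last first.
  by apply/seteqP; split=> t /=; rewrite !in_itv /= lerBrDr ltrBlDr.
rewrite /lam /= !lebesgue_measure_itv /= !lte_fin ltrD2r.
by case: ifP => // _; rewrite -!EFinB; congr EFin; ring.
Qed.

End leb_box.

Section independence.
Context {R : realType} {d : measure_display} {Omega : measurableType d}.
Variable P : probability Omega R.

Section two_vectors.
Context {S T : finType}.
Variables (U : Omega -> RI R S) (V : Omega -> RI R T).
Hypotheses (mU : measurable_fun [set: Omega] U) (mV : measurable_fun [set: Omega] V).
Hypothesis UV : forall B C, (forall s, measurable (B s)) -> (forall t, measurable (C t)) ->
  P (U @^-1` box B `&` V @^-1` box C) = (P (U @^-1` box B) * P (V @^-1` box C))%E.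

Let mpre {d'} {T' : measurableType d'} (W : Omega -> T') A :
  measurable_fun [set: Omega] W -> measurable A -> measurable (W @^-1` A).
Proof. by move=> mW mA; rewrite -[X in measurable X]setTI; exact: mW. Qed.

(** The product formula is extended one argument at a time: with the other event fixed, a
    restriction of [P] and a multiple of [P] are pushed forward to two finite measures that agree on
    boxes. *)
Lemma indep_sigma A D : measurable A -> measurable D ->
  P (U @^-1` A `&` V @^-1` D) = (P (U @^-1` A) * P (V @^-1` D))%E.
Proof.
have fP (E : set Omega) : measurable E -> exists2 r : {nonneg R}, P E = (r%:num)%:E & True.
  move=> mE; have PE0 : 0 <= fine (P E) by rewrite fine_ge0.
  by exists (NngNum PE0) => //=; rewrite fineK // fin_num_measure.
have step1 C : (forall t, measurable (C t)) -> forall A, measurable A ->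
    P (U @^-1` A `&` V @^-1` box C) = (P (U @^-1` A) * P (V @^-1` box C))%E.
  move=> mC; have mVC : measurable (V @^-1` box C) by apply: mpre => //; exact: measurable_box.
  have [r rE _] := fP _ mVC.
  pose m1 : {measure set (RI R S) -> \bar R} := push (mrestr P mVC) mU.
  pose m2 : {measure set (RI R S) -> \bar R} := mscale r (push P mU).
  move=> A' mA'; rewrite [RHS]muleC rE; apply: (@box_unique _ _ m1 m2) => //.
    by rewrite /m1 /= /pushforward /mrestr preimage_setT setTI (le_lt_trans (probability_le1 P mVC)) // ltry.
  move=> B mB; rewrite /m1 /m2 /= /pushforward /mrestr /mscale /= UV // muleC; congr (_ * _)%E.
  exact: rE.
move=> mA mD; have mUA := mpre mU mA.
have [r rE _] := fP _ mUA.
pose m1 : {measure set (RI R T) -> \bar R} := push (mrestr P mUA) mV.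
pose m2 : {measure set (RI R T) -> \bar R} := mscale r (push P mV).
rewrite setIC rE; apply: (@box_unique _ _ m1 m2) => //.
  by rewrite /m1 /= /pushforward /mrestr preimage_setT setTI (le_lt_trans (probability_le1 P mUA)) // ltry.
move=> C mC; rewrite /m1 /m2 /= /pushforward /mrestr /mscale /= setIC step1 //.
by congr (_ * _)%E.
Qed.

Lemma indep_integral (F : RI R S -> \bar R) (G : RI R T -> \bar R) :
  measurable_fun setT F -> measurable_fun setT G ->
  (forall x, 0 <= F x)%E -> (forall x, 0 <= G x)%E ->
  (\int[P]_w (F (U w) * G (V w)) = \int[P]_w F (U w) * \int[P]_w G (V w))%E.
Proof.
move=> mF mG F0 G0.
pose X := mkmfun mU; pose Y := mkmfun mV.
have mUV : measurable_fun [set: Omega] (fun w => (U w, V w)).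
  by apply/measurable_fun_pairP; split.
pose XY := mkmfun mUV.
have E (W : set (RI R S * RI R T)) : measurable W ->
    (distribution P X \x distribution P Y)%E W = distribution P XY W.
  apply: product_measure_unique => A D mA mD.
  by rewrite /distribution /pushforward /= -indep_sigma.
have mFG : measurable_fun setT (fun z : RI R S * RI R T => F z.1 * G z.2)%E.
  by apply: emeasurable_funM; [exact: (measurableT_comp mF measurable_fst)|exact: (measurableT_comp mG measurable_snd)].
have FG0 z : (0 <= F z.1 * G z.2)%E by rewrite mule_ge0.
rewrite -(@ge0_integral_distribution _ _ _ _ _ _ X F) // -(@ge0_integral_distribution _ _ _ _ _ _ Y G) //.
rewrite -[LHS](@ge0_integral_distribution _ _ _ _ _ _ XY (fun z => F z.1 * G z.2)%E) //.
transitivity (\int[(distribution P X \x distribution P Y)%E]_z (F z.1 * G z.2))%E.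
  by apply: eq_measure_integral => A mA _; apply/esym; exact: E.
rewrite fubini_tonelli1 //.
under eq_integral => x _ do rewrite /fubini_F /= ge0_integralZl //.
rewrite ge0_integralZr //.
by apply: integral_ge0.
Qed.

End two_vectors.

End independence.

Lemma NoDup_uniq (I : eqType) (s : seq I) : uniq s -> List.NoDup s.
Proof.
elim: s => [_|i s IH /= /andP[is0 us]]; first exact: List.NoDup_nil.
apply: List.NoDup_cons; last exact: IH.
move=> H; move/negP: is0; apply; elim: s H {IH us} => //= j s IH [->|/IH].
  by rewrite inE eqxx.
by rewrite inE => ->; rewrite orbT.
Qed.

Lemma List_InP (I : eqType) (s : seq I) (i : I) : List.In i s <-> i \in s.
Proof.
elim: s => //= j s IH; rewrite inE; split.
  by move=> [->|/IH ->]; rewrite ?eqxx ?orbT.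
by move=> /orP[/eqP->|/IH]; [left|right].
Qed.

Section mutual_independence.
Context {R : realType} {d : measure_display} {Omega : measurableType d}.
Variable P : probability Omega R.
Context {I : eqType}.
Variable Z : I -> Omega -> R.
Hypothesis mZ : forall i, measurable_fun [set: Omega] (Z i).
Hypothesis indZ : mutually_independent P Z.

Lemma mutual_independence_box (S : finType) (e : S -> I) (B : S -> set R) :
  injective e -> (forall s, measurable (B s)) ->
  P ((fun w s => Z (e s) w) @^-1` box B) = (\prod_(s : S) fine (P (Z (e s) @^-1` B s)))%:E.
Proof.
move=> ie mB.
(* The definition of independence wants a set for every index of [I]. Injectivity of [e] makes [Bg]
   unambiguous on its range; elsewhere any measurable set would do. *)
pose Bg i := if [pick s | e s == i] is Some s then B s else setT.
have BgE s : Bg (e s) = B s.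
  rewrite /Bg; case: pickP => [s' /eqP /ie -> //|/(_ s)].
  by rewrite eqxx.
have mBg i : measurable (Bg i) by rewrite /Bg; case: pickP.
have mpre i : measurable (Z i @^-1` Bg i).
  by rewrite -[X in measurable X]setTI; exact: mZ.
pose s := [seq e x | x <- enum S].
have us : uniq s by rewrite map_inj_uniq ?enum_uniq.
have sE : (fun w s => Z (e s) w) @^-1` box B =
    \bigcap_(i in [set i | List.In i s]) (Z i @^-1` Bg i).
  apply/seteqP; split=> w /= Hw.
    by move=> i /= /List_InP /mapP[x _ ->]; rewrite BgE; exact: Hw.
  move=> x; rewrite -BgE; apply: (Hw (e x)); apply/List_InP.
  by apply: map_f; rewrite mem_enum.
have mcap : measurable (\bigcap_(i in [set i | List.In i s]) (Z i @^-1` Bg i)).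
  rewrite -sE -[X in measurable X]setTI; apply: measurable_to_RI => //.
  exact: measurable_box.
rewrite sE -[LHS]fineK ?fin_num_measure // indZ //; last exact: NoDup_uniq.
congr EFin; rewrite big_map -big_enum /=; apply: eq_bigr => x _.
by rewrite BgE.
Qed.

Lemma measurable_vec (S : Type) (e : S -> I) :
  measurable_fun [set: Omega] (fun w => (fun s => Z (e s) w) : RI R S).
Proof. exact: measurable_to_RI. Qed.

Lemma mutual_independence_integral (S T : finType) (e1 : S -> I) (e2 : T -> I)
    (F : RI R S -> \bar R) (G : RI R T -> \bar R) :
  injective e1 -> injective e2 -> (forall s t, e1 s != e2 t) ->
  measurable_fun setT F -> measurable_fun setT G ->
  (forall x, 0 <= F x)%E -> (forall x, 0 <= G x)%E ->
  (\int[P]_w (F (fun s => Z (e1 s) w) * G (fun t => Z (e2 t) w)) =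
   \int[P]_w F (fun s => Z (e1 s) w) * \int[P]_w G (fun t => Z (e2 t) w))%E.
Proof.
move=> i1 i2 e12 mF mG F0 G0.
apply: (indep_integral (measurable_vec e1) (measurable_vec e2)) => //.
move=> B C mB mC; rewrite !mutual_independence_box // -EFinM.
(* Independence of two disjoint groups of variables is the box formula over the disjoint sum of
   their index types. *)
pose e (u : S + T) := match u with inl s => e1 s | inr t => e2 t end.
pose D (u : S + T) := match u with inl s => B s | inr t => C t end.
have ie : injective e.
  move=> [s|t] [s'|t'] //= => [/i1->|/eqP|/esym/eqP|/i2->] //; by rewrite (negbTE (e12 _ _)).
have := @mutual_independence_box _ e D ie.
rewrite big_sumType /= => <-; last by case.
congr (P _); apply/seteqP; split=> w /=.
  by move=> [HB HC] [s|t] /=; [exact: HB|exact: HC].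
by move=> H; split=> [s|t]; [exact: (H (inl s))|exact: (H (inr t))].
Qed.

End mutual_independence.

Lemma measurable_prode {d} {T : measurableType d} {R : realType} (I : Type) (s : seq I)
    (g : I -> T -> \bar R) :
  (forall i, measurable_fun setT (g i)) ->
  measurable_fun setT (fun x => \prod_(i <- s) g i x)%E.
Proof.
move=> mg; elim: s => [|i s IH].
  by under eq_fun do rewrite big_nil; exact: measurable_cst.
under eq_fun do rewrite big_cons.
exact: emeasurable_funM.
Qed.

(** * Law of the data *)

Section data_law.
Context {R : realType} {d : measure_display} {Omega : measurableType d}.
Variable P : probability Omega R.
Context {p : nat}.
Variables (f0 : ('I_p -> R) -> R) (sigma0 : R).
Variables (X : nat -> Omega -> 'I_p -> R) (xi : nat -> Omega -> R).
Hypothesis sigma0_gt0 : 0 < sigma0.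
Hypothesis mf0 : forall B : set R, measurable B -> Rp_measurable p (f0 @^-1` B).
Hypothesis mX : forall i h, measurable_fun [set: Omega] (fun w => X i w h).
Hypothesis mxi : forall i, measurable_fun [set: Omega] (xi i).

(** Convertible to the family in the independence hypothesis of the theorem; [None] indexes the
    noise. *)
Definition coords (ih : nat * option 'I_p) : Omega -> R :=
  match ih.2 with Some h => fun w => X ih.1 w h | None => xi ih.1 end.

Hypothesis indZ : mutually_independent P coords.
Hypothesis lawX : forall i h (B : set R), measurable B ->
  P ((fun w => X i w h) @^-1` B) = lebesgue_measure (B `&` `[0%R, 1%R]).
Hypothesis lawxi : forall i (B : set R), measurable B ->
  P (xi i @^-1` B) = normal_prob 0 sigma0 B.

Lemma measurable_coords ih : measurable_fun [set: Omega] (coords ih).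
Proof. by case: ih => i [h|]; rewrite /coords /=; [exact: mX|exact: mxi]. Qed.

Lemma measurable_f0 : measurable_fun [set: RI R 'I_p] (f0 : RI R 'I_p -> R).
Proof. by move=> _ B mB; rewrite setTI; exact: mf0. Qed.

Lemma measurable_Xvec i : measurable_fun [set: Omega] (X i : Omega -> RI R 'I_p).
Proof. exact: measurable_to_RI. Qed.

Let fine_P (A : set Omega) : measurable A -> (fine (P A))%:E = P A.
Proof. by move=> mA; rewrite fineK // fin_num_measure. Qed.

Let mpre {d'} {T' : measurableType d'} (W : Omega -> T') A :
  measurable_fun [set: Omega] W -> measurable A -> measurable (W @^-1` A).
Proof. by move=> mW mA; rewrite -[X in measurable X]setTI; exact: mW. Qed.

Lemma law_Xvec i (A : set (RI R 'I_p)) : measurable A ->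
  P (X i @^-1` A) = leb p (A `&` (cube p : set (RI R 'I_p))).
Proof.
move=> mA.
pose m1 : {measure set (RI R 'I_p) -> \bar R} := push P (measurable_Xvec i).
pose m2 : {measure set (RI R 'I_p) -> \bar R} := mrestr (leb p) (@measurable_cube R p).
apply: (@box_unique _ _ m1 m2) => //.
  by rewrite /m1 /= /pushforward preimage_setT probability_setT ltry.
move=> B mB; rewrite /m1 /m2 /= /pushforward /mrestr.
have /= := @mutual_independence_box _ _ _ P _ coords measurable_coords indZ 'I_p
  (fun h => (i, Some h)) B _ mB.
rewrite /coords /= => -> //; last by move=> h h' [].
rewrite cube_box (_ : box B `&` _ = box (fun h => B h `&` [set t | 0 <= t <= 1])); last first.
  apply/seteqP; split=> [x [Bx Cx] s|x BCx]; first by split; [exact: Bx|exact: Cx].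
  by split=> s; have [] := BCx s.
rewrite leb_box; last by move=> h; apply: measurableI => //; exact: measurable_unit.
rewrite -prodEFin; apply: eq_bigr => h _; rewrite fine_P; last by apply: mpre.
by rewrite lawX //; congr (lebesgue_measure (_ `&` _)).
Qed.

Lemma law_pair i (A : set (RI R 'I_p)) (B : set R) : measurable A -> measurable B ->
  P (X i @^-1` A `&` xi i @^-1` B) = (P (X i @^-1` A) * P (xi i @^-1` B))%E.
Proof.
move=> mA mB.
(* The noise is read as a vector indexed by [unit], which puts the pair in the scope of
   [indep_sigma]. *)
have mV := measurable_vec measurable_coords (fun _ : unit => (i, None)).
have := @indep_sigma _ _ _ P 'I_p unit _ _ (measurable_Xvec i) mV _ A (box (fun=> B)) mA
  (measurable_box (fun=> mB)).
have -> : (fun w (s : unit) => coords (i, None) w) @^-1` box (fun=> B) = xi i @^-1` B.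
  by apply/seteqP; split=> w H; [exact: (H tt)|move=> []].
apply => C D mC mD.
have ie : injective (fun o : 'I_p + unit =>
   match o with inl h => (i, Some h) | inr _ => (i, None) end : nat * option 'I_p).
  by move=> [h|[]] [h'|[]] //= [->].
have ic : injective (fun h : 'I_p => (i, Some h)) by move=> h h' [].
have ix : injective (fun _ : unit => (i, None : option 'I_p)) by move=> [] [].
have e1 := mutual_independence_box measurable_coords indZ ic mC.
have e2 := mutual_independence_box measurable_coords indZ ix mD.
rewrite /coords /= in e1 e2 *; rewrite e1 e2 -EFinM.
have := @mutual_independence_box _ _ _ P _ coords measurable_coords indZ _ _
  (fun o => match o with inl h => C h | inr t => D t end) ie.
rewrite big_sumType /= => <-; last by case.
congr (P _); apply/seteqP; split=> w /=.
  by move=> [HB HC] [s|t] /=; [exact: HB|exact: HC].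
by move=> H; split=> [s|t]; [exact: (H (inl s))|exact: (H (inr t))].
Qed.

Definition Lam : {sigma_finite_measure set (RI R 'I_p * measurableTypeR R)%type -> \bar R} :=
  sprod (leb p) (lam R).

Lemma measurable_Y i : measurable_fun [set: Omega] (fun w => f0 (X i w) + xi i w).
Proof.
by apply: measurable_funD => //; exact: (measurableT_comp measurable_f0 (measurable_Xvec i)).
Qed.

Lemma measurable_ltrue :
  measurable_fun [set: RI R 'I_p * measurableTypeR R] (fun z => ltrue f0 sigma0 z.2 z.1).
Proof.
apply: measurable_gdens => //; first by move=> z; rewrite exprn_gt0.
exact: (measurableT_comp measurable_f0 measurable_fst).
Qed.

Lemma measurable_cube_ltrue :
  measurable_fun [set: RI R 'I_p * measurableTypeR R]
    (fun z => \1_(cube p) z.1 * ltrue f0 sigma0 z.2 z.1).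
Proof.
apply: measurable_funM; last exact: measurable_ltrue.
have mc : measurable_fun [set: RI R 'I_p] (\1_(cube p) : RI R 'I_p -> R).
  by apply: measurable_indic; exact: measurable_cube.
exact: (measurableT_comp mc measurable_fst).
Qed.

Lemma ltrue_gt0 (z : RI R 'I_p * measurableTypeR R) : 0 < ltrue f0 sigma0 z.2 z.1.
Proof. by rewrite gdens_gt0 // exprn_gt0. Qed.

Lemma cube_ltrue_ge0 (z : RI R 'I_p * measurableTypeR R) :
  0 <= \1_(cube p) z.1 * ltrue f0 sigma0 z.2 z.1.
Proof. by rewrite mulr_ge0 // ltW // ltrue_gt0. Qed.

(** The input and the noise have a product law. For a fixed input [x], translating the Gaussian
    density of the noise by [f0 x] turns it into [ltrue], and the uniform law contributes the
    indicator of the cube. *)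
Lemma integral_XY i (h : RI R 'I_p * measurableTypeR R -> \bar R) :
  measurable_fun setT h -> (forall z, 0 <= h z)%E ->
  (\int[P]_w h (X i w, (f0 (X i w) + xi i w)%R) =
   \int[Lam]_z (h z * (\1_(cube p) z.1 * ltrue f0 sigma0 z.2 z.1)%:E))%E.
Proof.
move=> mh h0.
have mxi' : measurable_fun [set: Omega] (xi i : Omega -> measurableTypeR R) by exact: mxi.
have mU : measurable_fun [set: Omega] (fun w => (X i w, xi i w) : RI R 'I_p * measurableTypeR R).
  by apply/measurable_fun_pairP; split; [exact: measurable_Xvec|exact: mxi'].
pose H (z : RI R 'I_p * measurableTypeR R) := h (z.1, f0 z.1 + z.2).
have mf1 : measurable_fun [set: RI R 'I_p * measurableTypeR R] (fun z => f0 z.1).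
  exact: (measurableT_comp measurable_f0 measurable_fst).
have m2 : measurable_fun [set: RI R 'I_p * measurableTypeR R] (fun z => z.2 : R).
  exact: measurable_snd.
have mH : measurable_fun setT H.
  apply: (measurableT_comp mh); apply/measurable_fun_pairP; split; first exact: measurable_fst.
  exact: (measurable_funD mf1 m2).
have H0 z : (0 <= H z)%E by exact: h0.
pose DX := distribution P (mkmfun (measurable_Xvec i)).
pose Dxi := distribution P (mkmfun mxi').
transitivity (\int[distribution P (mkmfun mU)]_z H z)%E.
  by rewrite (@ge0_integral_distribution _ _ _ _ _ _ (mkmfun mU) H).
transitivity (\int[(DX \x Dxi)%E]_z H z)%E.
  apply: eq_measure_integral => A mA _; apply/esym; apply: product_measure_unique => // B C mB mC.
  exact: law_pair.
rewrite fubini_tonelli1 //.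
have s2 : 0 < sigma0 ^+ 2 by rewrite exprn_gt0.
have inner x : (\int[Dxi]_t H (x, t) = \int[lam R]_y (h (x, y) * (ltrue f0 sigma0 y x)%:E))%E.
  have mHx : measurable_fun [set: measurableTypeR R] (fun t => H (x, t)).
    exact: (measurableT_comp mH (@pair1_measurable _ _ (RI R 'I_p) (measurableTypeR R) x)).
  have mg : measurable_fun [set: measurableTypeR R] (gdens 0 (sigma0 ^+ 2)).
    exact: (@measurable_gdens _ (measurableTypeR R)).
  have g0 t : 0 <= gdens 0 (sigma0 ^+ 2) t by rewrite ltW // gdens_gt0.
  have gD (B : set (measurableTypeR R)) : measurable B ->
      Dxi B = (\int[lam R]_(t in B) (gdens 0 (sigma0 ^+ 2) t)%:E)%E.
    move=> mB; transitivity (normal_prob 0 sigma0 B); first exact: (lawxi i mB).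
    by apply: eq_integral => t _; rewrite gdens_pdf.
  have Hx0 t : (0 <= H (x, t))%E by exact: H0.
  rewrite (@ge0_integral_density _ _ _ (lam R) Dxi _ mg g0 gD _ mHx Hx0).
  rewrite -[RHS](@ge0_integral_translate _ _ (f0 x)); last 2 first.
  - apply: emeasurable_funM.
      exact: (measurableT_comp mh (@pair1_measurable _ _ (RI R 'I_p) (measurableTypeR R) x)).
    apply/measurable_EFinP; exact: (@measurable_gdens _ (measurableTypeR R)).
  - by move=> y; rewrite mule_ge0 // lee_fin ltW // gdens_gt0.
  apply: eq_integral => t _; rewrite /H /= addrC; congr (_ * _%:E)%E.
  by rewrite /ltrue -(gdens_shift 0 (f0 x)) add0r.
rewrite (@ge0_integral_density _ _ _ (leb p) DX (\1_(cube p))) //; last 4 first.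
- by apply: measurable_indic; exact: measurable_cube.
- move=> B mB; transitivity (leb p (B `&` (cube p : set (RI R 'I_p)))); first exact: law_Xvec.
  by rewrite setIC (@integral_indic _ _ _ (leb p) B mB _ (@measurable_cube R p)).
- by apply: measurable_fun_fubini_tonelli_F.
- by move=> x; apply: integral_ge0.
rewrite /Lam /sprod fubini_tonelli1; last 2 first.
- by apply: emeasurable_funM => //; apply/measurable_EFinP; exact: measurable_cube_ltrue.
- by move=> z; rewrite mule_ge0 // lee_fin cube_ltrue_ge0.
apply: eq_integral => x _; rewrite /fubini_F inner.
rewrite -ge0_integralZr //; last 2 first.
- apply: emeasurable_funM.
    exact: (measurableT_comp mh (@pair1_measurable _ _ (RI R 'I_p) (measurableTypeR R) x)).
  apply/measurable_EFinP; exact: (@measurable_gdens _ (measurableTypeR R)).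
- by move=> y _; rewrite mule_ge0 // lee_fin ltW // gdens_gt0.
by apply: eq_integral => y _; rewrite /= EFinM -muleA [X in (_ * X)%E]muleC.
Qed.

(** By induction on [n]: the last factor depends on the coordinates [(n, o)], the earlier ones on
    [(i, o)] with [i < n], and the two groups are disjoint. *)
Lemma integral_prod_XY n (h : nat -> RI R 'I_p * measurableTypeR R -> \bar R) :
  (forall i, measurable_fun setT (h i)) -> (forall i z, 0 <= h i z)%E ->
  (\int[P]_w \prod_(i < n) h i (X i w, (f0 (X i w) + xi i w)%R) =
   \prod_(i < n) \int[P]_w h i (X i w, (f0 (X i w) + xi i w)%R))%E.
Proof.
move=> mh h0.
have m1 (o : option 'I_p) : measurable_fun [set: RI R (option 'I_p)] (fun z : RI R (option 'I_p) => z o).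
  exact: measurable_coord.
have mx : measurable_fun [set: RI R (option 'I_p)]
    (fun z : RI R (option 'I_p) => (fun h => z (Some h)) : RI R 'I_p).
  exact: measurable_to_RI.
pose g i (z : RI R (option 'I_p)) := h i ((fun h => z (Some h)), f0 (fun h => z (Some h)) + z None).
have mg i : measurable_fun setT (g i).
  apply: (measurableT_comp (mh i)); apply/measurable_fun_pairP; split => //.
  by apply: measurable_funD => //; exact: (measurableT_comp measurable_f0 mx).
elim: n => [|n IH]; first by under eq_integral do rewrite big_ord0; rewrite big_ord0 integral_cst //= probability_setT mule1.
under eq_integral do rewrite big_ord_recr.
rewrite big_ord_recr -IH /=.
pose F' (u : RI R ('I_n * option 'I_p)) : \bar R := (\prod_(i < n) g i (fun o => u (i, o)))%E.
have := @mutual_independence_integral _ _ _ P _ coords measurable_coords indZ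
  ('I_n * option 'I_p)%type (option 'I_p) (fun io => (val io.1, io.2)) (fun o => (n, o))
  F' (g n).
apply.
- by move=> [i o] [j o'] /= [/val_inj -> ->].
- by move=> o o' [].
- by move=> [i o] o' /=; apply/eqP => -[] /eqP; rewrite ltn_eqF.
- apply: measurable_prode => j; apply: (measurableT_comp (mg j)).
  by apply: measurable_to_RI => o; exact: measurable_coord.
- exact: mg.
- by move=> u; apply: prode_ge0 => i _; exact: h0.
- by move=> u; exact: h0.
Qed.

End data_law.

(** * Brackets for the network model *)

Section network.
Context {R : realType}.

Lemma sigmoid_gt0 (u : R) : 0 < sigmoid u.
Proof. by rewrite invr_gt0 addr_gt0 // expR_gt0. Qed.

Lemma sigmoid_le1 (u : R) : sigmoid u <= 1.
Proof. by rewrite invf_le1 ?addr_gt0 ?expR_gt0 // lerDl expR_ge0. Qed.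

Lemma sigmoid_lip (u w : R) : `|sigmoid u - sigmoid w| <= `|u - w|.
Proof.
wlog uw : u w / w <= u.
  by move=> H; have [/H//|/ltW/H] := leP w u; rewrite distrC [X in _ <= X]distrC.
have a0 := expR_gt0 (- u); have b0 := expR_gt0 (- w).
have ab : expR (- u) <= expR (- w) by rewrite ler_expR lerN2.
have ea : expR (- u) = expR (- w) * expR (- (u - w)) by rewrite -expRD; congr expR; ring.
have h := expR_ge1Dx (- (u - w)).
rewrite !ger0_norm ?subr_ge0 //; last by rewrite lef_pV2 ?posrE ?addr_gt0 // lerD2l.
have -> : sigmoid u - sigmoid w = (expR (- w) - expR (- u)) / ((1 + expR (- u)) * (1 + expR (- w))).
  rewrite /sigmoid; field.
  by rewrite !gt_eqF ?addr_gt0.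
rewrite ler_pdivrMr ?mulr_gt0 ?addr_gt0 //.
have h1 : expR (- w) - expR (- u) <= (u - w) * expR (- w).
  by rewrite ea; have := ler_wpM2l (ltW b0) h; lra.
apply: (le_trans h1); rewrite ler_wpM2l ?subr_ge0 //.
have := mulr_gt0 a0 b0; lra.
Qed.

Lemma measurable_sigmoid : measurable_fun setT (@sigmoid R).
Proof.
apply: measurable_inv_gt0; first by move=> u; rewrite addr_gt0 // expR_gt0.
apply: measurable_funD => //.
have mN : measurable_fun setT (fun u : R => - u) by exact: measurableT_comp.
exact: (measurableT_comp (@measurable_expR R) mN).
Qed.

Lemma measurable_fnet {d} {T : measurableType d} (k p : nat)
    (th : T -> 'I_(Kdim k p) -> R) (x : T -> 'I_p -> R) :
  (forall i, measurable_fun setT (fun t => th t i)) ->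
  (forall h, measurable_fun setT (fun t => x t h)) ->
  measurable_fun setT (fun t => fnet (th t) (x t)).
Proof.
move=> mth mx; rewrite /fnet /par; apply: measurable_funD; first exact: mth.
apply: measurable_sum => j; apply: measurable_funM; first exact: mth.
have ma : measurable_fun setT (fun t => th t (inord (k.+1 + j * p.+1)) +
    \sum_(h < p) th t (inord (k.+1 + j * p.+1 + h.+1)) * x t h).
  apply: measurable_funD; first exact: mth.
  by apply: measurable_sum => h; apply: measurable_funM; [exact: mth|exact: mx].
exact: (measurableT_comp measurable_sigmoid ma).
Qed.

(** Only the centre [th'] has to be bounded. In each product the change of the outer weight
    multiplies a sigmoid, which is at most one, and the change of the sigmoid multiplies a weight of
    [th']. [loglik_lower] relies on this asymmetry, since there [th] ranges over the whole space. *)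
Lemma fnet_lip (k p : nat) (th th' : 'I_(Kdim k p) -> R) (x : 'I_p -> R) (e B : R) :
  cube p x -> 0 <= e -> 0 <= B -> (forall i, `|th i - th' i| <= e) ->
  (forall i, `|th' i| <= B) ->
  `|fnet th x - fnet th' x| <= e * (k.+1%:R * (1 + p.+1%:R * B)).
Proof.
move=> cx e0 B0 he hB; rewrite /fnet /par.
set A := fun (t : 'I_(Kdim k p) -> R) (j : 'I_k) => t (inord (k.+1 + j * p.+1)) +
    \sum_(h < p) t (inord (k.+1 + j * p.+1 + h.+1)) * x h.
have hA j : `|A th j - A th' j| <= e * p.+1%:R.
  rewrite /A opprD addrACA -sumrB (le_trans (ler_normD _ _)) // -natr1 mulrDr mulr1 [leRHS]addrC lerD //.
  apply: (le_trans (ler_norm_sum _ _ _)).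
  apply: (@le_trans _ _ (\sum_(h < p) e)); last by rewrite sumr_const card_ord mulr_natr.
  apply: ler_sum => h _; rewrite -mulrBl normrM.
  have /andP[x0 x1] := cx h.
  by rewrite -[leRHS]mulr1 ler_pM // ger0_norm.
have hj (j : 'I_k) : `|th (inord j.+1) * sigmoid (A th j) - th' (inord j.+1) * sigmoid (A th' j)|
    <= e * (1 + p.+1%:R * B).
  have -> : th (inord j.+1) * sigmoid (A th j) - th' (inord j.+1) * sigmoid (A th' j) =
    (th (inord j.+1) - th' (inord j.+1)) * sigmoid (A th j) +
    th' (inord j.+1) * (sigmoid (A th j) - sigmoid (A th' j)) by ring.
  rewrite (le_trans (ler_normD _ _)) // [leRHS]mulrDr mulr1 lerD //.
    rewrite normrM -[leRHS]mulr1 ler_pM //.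
    by rewrite ger0_norm ?sigmoid_le1 // ltW // sigmoid_gt0.
  rewrite normrM mulrA [leRHS]mulrC ler_pM //.
  exact: le_trans (sigmoid_lip _ _) (hA j).
rewrite opprD addrACA -sumrB (le_trans (ler_normD _ _)) //.
rewrite -natr1 mulrDl mul1r mulrDr [leLHS]addrC lerD //.
  apply: (le_trans (ler_norm_sum _ _ _)).
  apply: (@le_trans _ _ (\sum_(j < k) e * (1 + p.+1%:R * B))); first exact: ler_sum.
  by rewrite sumr_const card_ord -[leLHS]mulr_natl mulrCA.
apply: (le_trans (he _)); rewrite -[leLHS]mulr1 ler_wpM2l // lerDl mulr_ge0 //.
Qed.

Lemma measurable_lmod {d} {T : measurableType d} (k p : nat)
    (th : T -> 'I_(Kdim k p) -> R) (rho y : T -> R) (x : T -> 'I_p -> R) :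
  (forall i, measurable_fun setT (fun t => th t i)) ->
  measurable_fun setT rho -> measurable_fun setT y ->
  (forall h, measurable_fun setT (fun t => x t h)) ->
  measurable_fun setT (fun t => lmod (th t) (rho t) (y t) (x t)).
Proof.
move=> mth mr my mx; apply: measurable_gdens => //.
- by move=> t; rewrite exprn_gt0 // softplus_gt0.
- exact: measurable_fnet.
- apply: measurable_funX; exact: (measurableT_comp measurable_softplus mr).
Qed.

Lemma lmod_gt0 (k p : nat) (th : 'I_(Kdim k p) -> R) rho y x : 0 < lmod th rho y x.
Proof. by rewrite gdens_gt0 // exprn_gt0 // softplus_gt0. Qed.

Lemma softplus_ratio (r r' : R) : (softplus r' ^+ 2)^-1 <= expR (2 * `|r - r'|) / softplus r ^+ 2.
Proof.
have h := softplus_le r r'; have a := softplus_gt0 r; have b := softplus_gt0 r'.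
rewrite -[leLHS]mul1r ler_pdivrMr ?exprn_gt0 // mulrAC ler_pdivlMr ?exprn_gt0 // mul1r.
have -> : expR (2 * `|r - r'|) = expR `|r - r'| ^+ 2 by rewrite expr2 -expRD mulr2n mulrDl mul1r.
by rewrite -exprMn ler_pXn2r ?nnegrE ?(ltW a) ?mulr_ge0 ?expR_ge0 ?(ltW b) // mulrC.
Qed.

(* Up to the factor [expR (...)], the Gaussian with inflated variance dominates all
   the Gaussians whose mean and log-scale are [l]- and [t]-close. *)
Lemma gdens_bracket (t kap l f f' rho rho' y : R) :
  0 <= t -> 0 < kap -> `|rho' - rho| <= t -> `|f' - f| <= l ->
  gdens f' (softplus rho' ^+ 2) y <=
  expR (2 * t + kap + l ^+ 2 * expR (2 * t) / (2 * kap * softplus rho ^+ 2)) *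
  gdens f (softplus rho ^+ 2 * (1 + kap) * expR (2 * t)) y.
Proof.
move=> t0 k0 hr hf.
set s := softplus rho; set s' := softplus rho'.
have s0 : 0 < s by exact: softplus_gt0.
have s'0 : 0 < s' by exact: softplus_gt0.
have k1 : 0 < 1 + kap by rewrite addr_gt0.
set E := expR (2 * t); have E0 : 0 < E by exact: expR_gt0.
set v := s ^+ 2 * (1 + kap) * E.
have v0 : 0 < v by rewrite !mulr_gt0 // exprn_gt0.
have s20 : 0 < s ^+ 2 by rewrite exprn_gt0.
have s'20 : 0 < s' ^+ 2 by rewrite exprn_gt0.
have le1 : (s' ^+ 2)^-1 <= E / s ^+ 2.
  apply: (le_trans (softplus_ratio rho rho')); rewrite ler_wpM2r ?invr_ge0 ?(ltW s20) //.
  by rewrite ler_expR ler_pM2l // distrC.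
have le2 : s' ^+ 2 <= s ^+ 2 * E.

  have h2 : (s ^+ 2)^-1 <= E / s' ^+ 2.
    apply: (le_trans (softplus_ratio rho' rho)); rewrite ler_wpM2r ?invr_ge0 ?(ltW s'20) //.
    by rewrite ler_expR ler_pM2l.
  by move: h2; rewrite ler_pdivlMr // ler_pdivrMl.
rewrite -[leLHS]lnK ?posrE ?gdens_gt0 //.
rewrite -[X in _ * X]lnK ?posrE ?gdens_gt0 // -expRD ler_expR !ln_gdens //.
have p2 : 0 < 2 * pi :> R by rewrite mulr_gt0 // pi_gt0.
have hln : ln (2 * pi * v) <= ln (2 * pi * s' ^+ 2) + 4 * t + kap.
  have -> : 2 * pi * v = (2 * pi * s ^+ 2) * (1 + kap) * E by rewrite /v; ring.
  have q0 : 0 < 2 * pi * s ^+ 2 by rewrite mulr_gt0.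
  have q1 : 0 < 2 * pi * s ^+ 2 * (1 + kap) by rewrite mulr_gt0.
  rewrite lnM ?posrE // lnM ?posrE // [ln E]expRK.
  have : ln (1 + kap) <= kap by rewrite -[leRHS]expRK ler_ln ?posrE ?expR_gt0 // expR_ge1Dx.
  have : ln (2 * pi * s ^+ 2) <= ln (2 * pi * s' ^+ 2) + 2 * t.
    have q2 : 0 < 2 * pi * s' ^+ 2 by rewrite mulr_gt0.
    have q3 : 0 < 2 * pi * s' ^+ 2 * E by rewrite mulr_gt0.
    rewrite -[X in _ + X]expRK -lnM ?posrE // ler_ln ?posrE //.
    by rewrite -[leRHS]mulrA ler_pM2l //; move: le1; rewrite ler_pdivlMr // ler_pdivrMl.
  lra.
have hq : (y - f) ^+ 2 / (2 * v) <= (y - f') ^+ 2 / (2 * s' ^+ 2) + l ^+ 2 * E / (2 * kap * s ^+ 2).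
  (* Young's inequality with weight [kap]; the defect is the square
     [(kap (y - f') - (f' - f))^2 / kap]. The factor [1 + kap] in the variance [v] is there to
     cancel the [1 + kap] produced here. *)
  have h1 : (y - f) ^+ 2 <= (1 + kap) * (y - f') ^+ 2 + (1 + kap^-1) * l ^+ 2.
    have l2 : (f' - f) ^+ 2 <= l ^+ 2.
      by rewrite -[leLHS]real_normK ?num_real // ler_pXn2r ?nnegrE // (le_trans _ hf).
    have : (1 + kap^-1) * (f' - f) ^+ 2 <= (1 + kap^-1) * l ^+ 2.
      by rewrite ler_wpM2l // addr_ge0 // invr_ge0 ltW.
    have : 0 <= (kap * (y - f') - (f' - f)) ^+ 2 / kap by rewrite divr_ge0 ?sqr_ge0 // ltW.
    have -> : (kap * (y - f') - (f' - f)) ^+ 2 / kap =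
       kap * (y - f') ^+ 2 - 2 * (y - f') * (f' - f) + kap^-1 * (f' - f) ^+ 2.
      by field; rewrite gt_eqF.
    nra.
  have h2 : (y - f) ^+ 2 / (2 * v) <= ((1 + kap) * (y - f') ^+ 2 + (1 + kap^-1) * l ^+ 2) / (2 * v).
    by rewrite ler_wpM2r // invr_ge0 mulr_ge0 // ltW.
  apply: (le_trans h2); rewrite mulrDl; apply: lerD.
    have -> : (1 + kap) * (y - f') ^+ 2 / (2 * v) = (y - f') ^+ 2 / 2 * (s ^+ 2 * E)^-1.
      by rewrite /v; field; rewrite !gt_eqF.
    have -> : (y - f') ^+ 2 / (2 * s' ^+ 2) = (y - f') ^+ 2 / 2 * (s' ^+ 2)^-1.
      by field; rewrite gt_eqF.
    rewrite ler_wpM2l ?divr_ge0 ?sqr_ge0 //.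
    by rewrite lef_pV2 ?posrE ?mulr_gt0.
  have -> : (1 + kap^-1) * l ^+ 2 / (2 * v) = l ^+ 2 / (2 * kap * s ^+ 2) * E^-1.
    by rewrite /v; field; rewrite !gt_eqF.

  have E1 : 1 <= E by rewrite expR_ge1 // mulr_ge0.
  rewrite [l ^+ 2 * E / _]mulrAC ler_wpM2l //.
    by rewrite divr_ge0 ?sqr_ge0 // !mulr_ge0 // ltW.
  by rewrite (@le_trans _ _ 1) // invf_le1.
lra.
Qed.

(* [y = f + r + xi]; [s] balances the cross term [xi * r]. *)
Lemma ln_ratio_le (rho rho0 xi r s f v0 e : R) : 0 < s -> s <= 1 ->
  v0 = softplus rho0 ^+ 2 -> e = expR (2 * `|rho - rho0|) ->
  ln (gdens (f + r) v0 (f + r + xi)) - ln (gdens f (softplus rho ^+ 2) (f + r + xi)) <=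
  `|rho - rho0| + xi ^+ 2 / (2 * v0) * (e - 1) + e / v0 * (s * xi ^+ 2 / 2 + r ^+ 2 / s).
Proof.
move=> s0 s1 v0E eE.
have v00 : 0 < v0 by rewrite v0E exprn_gt0 // softplus_gt0.
have v10 : 0 < softplus rho ^+ 2 by rewrite exprn_gt0 // softplus_gt0.
have p2 : 0 < 2 * pi :> R by rewrite mulr_gt0 // pi_gt0.
rewrite !ln_gdens //.
have -> : f + r + xi - (f + r) = xi by ring.
have -> : f + r + xi - f = xi + r by ring.
have hln : ln (2 * pi * softplus rho ^+ 2) <= ln (2 * pi * v0) + 2 * `|rho - rho0|.
  have q0 : 0 < 2 * pi * softplus rho ^+ 2 by rewrite mulr_gt0.
  have q1 : 0 < 2 * pi * v0 by rewrite mulr_gt0.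
  have e0 : 0 < e by rewrite eE expR_gt0.
  have q2 : 0 < 2 * pi * v0 * e by rewrite mulr_gt0.
  rewrite -[X in _ + X]expRK -eE -lnM ?posrE // ler_ln ?posrE //.
  rewrite -[leRHS]mulrA ler_pM2l //; have := softplus_ratio rho rho0.
  by rewrite -v0E -eE ler_pdivlMr // ler_pdivrMl.
have hi : (softplus rho ^+ 2)^-1 <= e / v0.
  by have := softplus_ratio rho0 rho; rewrite distrC -v0E -eE.
have hq : (xi + r) ^+ 2 / (2 * softplus rho ^+ 2) <= (xi + r) ^+ 2 / 2 * (e / v0).
  have -> : (xi + r) ^+ 2 / (2 * softplus rho ^+ 2) = (xi + r) ^+ 2 / 2 * (softplus rho ^+ 2)^-1.
    by field; rewrite gt_eqF // softplus_gt0.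
  by rewrite ler_wpM2l ?divr_ge0 ?sqr_ge0.
(* The cross term [xi r] is at most [s xi^2 / 2 + r^2 / (2 s)], and the remaining [r^2 / 2] is at
   most [r^2 / (2 s)] because [s <= 1]. *)
have hr : (xi + r) ^+ 2 / 2 <= xi ^+ 2 / 2 + (s * xi ^+ 2 / 2 + r ^+ 2 / s).
  have : 0 <= (s * xi - r) ^+ 2 / (2 * s) by rewrite divr_ge0 ?sqr_ge0 // mulr_ge0 // ltW.
  have -> : (s * xi - r) ^+ 2 / (2 * s) = s * xi ^+ 2 / 2 - xi * r + r ^+ 2 / (2 * s).
    by field; rewrite gt_eqF.
  have -> : r ^+ 2 / s = r ^+ 2 / (2 * s) * 2 by field; rewrite gt_eqF.
  have : r ^+ 2 / 2 <= r ^+ 2 / (2 * s).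
    by rewrite ler_wpM2l ?sqr_ge0 // lef_pV2 ?posrE ?mulr_gt0 // ler_piMr.
  lra.
have e0 : 0 <= e / v0 by rewrite divr_ge0 ?eE ?expR_ge0 // ltW.
have := ler_wpM2r e0 hr.
have -> : xi ^+ 2 / (2 * v0) * (e - 1) = xi ^+ 2 / 2 * (e / v0) - xi ^+ 2 / (2 * v0).
  by field; rewrite gt_eqF.
lra.
Qed.

End network.

(** * Hellinger distance *)

Section hellinger.
Context {R : realType} {p : nat}.
Variables (f0 : ('I_p -> R) -> R) (sigma0 : R).
Hypothesis sigma0_gt0 : 0 < sigma0.
Hypothesis mf0 : forall B : set R, measurable B -> Rp_measurable p (f0 @^-1` B).
Local Notation Z := (RI R 'I_p * measurableTypeR R)%type.

Lemma measurable_cube1 : measurable_fun [set: Z] (fun z => \1_(cube p) z.1 : R).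
Proof.
have mc : measurable_fun [set: RI R 'I_p] (\1_(cube p) : RI R 'I_p -> R).
  by apply: measurable_indic; exact: measurable_cube.
exact: (measurableT_comp mc measurable_fst).
Qed.

Lemma measurable_gdensZ (m : RI R 'I_p -> R) (v : R) : 0 < v ->
  measurable_fun setT m -> measurable_fun [set: Z] (fun z => gdens (m z.1) v z.2).
Proof.
move=> v0 mm; apply: (@measurable_gdens _ _ _ (fun z : Z => m z.1) (fun=> v) (fun z : Z => z.2)) => //.
  exact: (measurableT_comp mm measurable_fst).
exact: measurable_snd.
Qed.

Lemma integral_cube_gdens (m : RI R 'I_p -> R) (v : R) : 0 < v ->
  measurable_fun setT m ->
  (\int[Lam]_z (\1_(cube p) z.1 * gdens (m z.1) v z.2)%:E = 1)%E.
Proof.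
move=> v0 mm; rewrite /Lam /sprod fubini_tonelli1; last 2 first.
- by apply/measurable_EFinP; apply: measurable_funM; [exact: measurable_cube1|exact: measurable_gdensZ].
- by move=> z; rewrite lee_fin mulr_ge0 // ltW // gdens_gt0.
transitivity (\int[leb p]_x (\1_(cube p : set (RI R 'I_p)) x)%:E)%E.
  apply: eq_integral => x _; rewrite /fubini_F /=.
  under eq_integral do rewrite EFinM.
  rewrite ge0_integralZl_EFin //; last 2 first.
  - by move=> y _; rewrite lee_fin ltW // gdens_gt0.
  - by apply/measurable_EFinP; exact: (@measurable_gdens _ (measurableTypeR R)).
  by rewrite integral_gdens // mule1.
transitivity (leb p (cube p : set (RI R 'I_p))); last exact: leb_cube.
by rewrite (@integral_indic _ _ _ (leb p) setT measurableT _ (@measurable_cube R p)) setIT.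
Qed.

Lemma measurable_fnetx k (th : 'I_(Kdim k p) -> R) :
  measurable_fun [set: RI R 'I_p] (fun x => fnet th x).
Proof. by apply: measurable_fnet => //; exact: measurable_coord. Qed.

Lemma measurable_lmodz k (th : 'I_(Kdim k p) -> R) rho :
  measurable_fun [set: Z] (fun z => lmod th rho z.2 z.1).
Proof.
apply: measurable_gdensZ; last exact: measurable_fnetx.
by rewrite exprn_gt0 // softplus_gt0.
Qed.

Definition hdiff k (th : 'I_(Kdim k p) -> R) (rho : R) (z : Z) : R :=
  (Num.sqrt (lmod th rho z.2 z.1) - Num.sqrt (ltrue f0 sigma0 z.2 z.1)) ^+ 2.

Lemma measurable_hdiff k {d} {T : measurableType d} (th : T -> 'I_(Kdim k p) -> R)
    (rho : T -> R) (z : T -> Z) :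
  (forall i, measurable_fun setT (fun t => th t i)) ->
  measurable_fun setT rho -> measurable_fun setT z ->
  measurable_fun setT (fun t => hdiff (th t) (rho t) (z t)).
Proof.
move=> mth mr mz.
have mz1 : measurable_fun setT (fun t => (z t).1) by exact: (measurableT_comp measurable_fst mz).
have mz2 : measurable_fun setT (fun t => (z t).2) by exact: (measurableT_comp measurable_snd mz).
apply: measurable_funX; apply: measurable_funB; apply: measurable_sqrt_ge0.
- by move=> t; rewrite ltW // lmod_gt0.
- apply: measurable_lmod => // h; exact: (measurableT_comp (measurable_coord h) mz1).
- by move=> t; rewrite ltW // ltrue_gt0.
- exact: (measurableT_comp (measurable_ltrue sigma0_gt0 mf0) mz).
Qed.

Lemma hellE k (th : 'I_(Kdim k p) -> R) rho :
  hell f0 sigma0 th rho = (\int[Lam]_z (\1_(cube p) z.1 * hdiff th rho z)%:E)%E.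
Proof.
have mh : measurable_fun [set: Z] (fun z => hdiff th rho z) by exact: measurable_hdiff.
have mch : measurable_fun [set: Z] (fun z => (\1_(cube p) z.1 * hdiff th rho z)%:E).
  by apply/measurable_EFinP; apply: measurable_funM => //; exact: measurable_cube1.
have ch0 z : (0 <= (\1_(cube p) z.1 * hdiff th rho z)%:E)%E.
  by rewrite lee_fin mulr_ge0 // sqr_ge0.
have E x : ((\1_(cube p) x)%:E * \int[lam R]_y (hdiff th rho (x, y))%:E =
    fubini_F (lam R) (fun z : Z => (\1_(cube p) z.1 * hdiff th rho z)%:E) x)%E.
  rewrite /fubini_F /=; under [in RHS]eq_integral do rewrite EFinM.
  rewrite ge0_integralZl_EFin //; first by move=> y _; rewrite lee_fin sqr_ge0.
  apply/measurable_EFinP.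
  exact: (measurableT_comp mh (@pair1_measurable _ _ (RI R 'I_p) (measurableTypeR R) x)).
pose F := fubini_F (lam R) (fun z : Z => (\1_(cube p) z.1 * hdiff th rho z)%:E).
have mF : measurable_fun setT F by exact: measurable_fun_fubini_tonelli_F.
have F0 x : (0 <= F x)%E by apply: integral_ge0.
transitivity (iint F); first by congr iint; apply/funext => x; rewrite /F -E.
by rewrite /Lam /sprod fubini_tonelli1 //; exact: (iintE mF F0).
Qed.

Lemma measurable_hell k :
  measurable_fun [set: measurableTypeR R * RI R 'I_(Kdim k p)] (fun w => hell f0 sigma0 w.2 w.1).
Proof.
pose H (t : (measurableTypeR R * RI R 'I_(Kdim k p)) * Z) : \bar R :=
  (\1_(cube p) t.2.1 * hdiff t.1.2 t.1.1 t.2)%:E.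
rewrite (_ : (fun w => _) = fubini_F Lam H); last first.
  by apply/funext => w; rewrite hellE.
apply: measurable_fun_fubini_tonelli_F; last first.
  by move=> t; rewrite lee_fin mulr_ge0 // sqr_ge0.
apply/measurable_EFinP; apply: measurable_funM.
  exact: (measurableT_comp measurable_cube1 measurable_snd).
apply: measurable_hdiff.
- by move=> i; exact: (measurableT_comp (measurable_coord i) (measurableT_comp measurable_snd measurable_fst)).
- exact: (measurableT_comp measurable_fst measurable_fst).
- exact: measurable_snd.
Qed.

(** Here [b] is a model density, [a] its bracket and [c] the true density. Write [sqrt (a c) = sqrt
    (b c) + (sqrt a - sqrt b) sqrt c]. The first term is [(b + c) / 2] minus half the Hellinger
    integrand; the second is at most [(sqrt a - sqrt b)^2 / (2 s) + s c / 2], and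
    [(sqrt a - sqrt b)^2 <= a - b]. The subtracted terms stand on the left so that both sides are
    sums of nonnegative integrands. *)
Lemma sqrt_dominate (a b c s : R) : 0 <= b -> b <= a -> 0 <= c -> 0 < s ->
  Num.sqrt (a * c) + (Num.sqrt b - Num.sqrt c) ^+ 2 / 2 + b / (2 * s) <=
  b / 2 + c / 2 + a / (2 * s) + s * c / 2.
Proof.
move=> b0 ab c0 s0; have a0 : 0 <= a by exact: le_trans ab.
rewrite sqrtrM //.
have ea := sqr_sqrtr a0; have eb := sqr_sqrtr b0; have ec := sqr_sqrtr c0.
have ba : Num.sqrt b <= Num.sqrt a by rewrite ler_sqrt.
move: (Num.sqrt a) (Num.sqrt b) (Num.sqrt c) (sqrtr_ge0 a) (sqrtr_ge0 b) (sqrtr_ge0 c) ba ea eb ec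
  => A B C A0 B0 C0 BA <- <- <-.
have h1 : 0 <= (A - B - s * C) ^+ 2 / (2 * s) by rewrite divr_ge0 ?sqr_ge0 // mulr_ge0 // ltW.
have e1 : (A - B - s * C) ^+ 2 / (2 * s) = (A - B) ^+ 2 / (2 * s) - (A - B) * C + s * C ^+ 2 / 2.
  by field; rewrite gt_eqF.
have h2 : (A - B) ^+ 2 / (2 * s) <= (A ^+ 2 - B ^+ 2) / (2 * s).
  rewrite ler_pM2r ?invr_gt0 ?mulr_gt0 //.
  have BAp : 0 <= B * (A - B) by rewrite mulr_ge0 // subr_ge0.
  nra.
nra.
Qed.

(** [sqrt_dominate] is integrated against Lebesgue measure on the cube times the line: the bracket
    has mass [U], the model and the truth have mass one, and the Hellinger term gives [eps / 2]. *)
Lemma affinity_bracket k (th : 'I_(Kdim k p) -> R) (rho U v s eps : R) :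
  0 < s -> 0 <= U -> 0 < v -> (eps%:E <= hell f0 sigma0 th rho)%E ->
  (forall z : Z, lmod th rho z.2 z.1 <= U * gdens (fnet th z.1) v z.2) ->
  (\int[Lam]_z (\1_(cube p) z.1 *
     Num.sqrt (U * gdens (fnet th z.1) v z.2 * ltrue f0 sigma0 z.2 z.1))%:E <=
   (1 - eps / 2 + (U - 1) / (2 * s) + s / 2)%:E)%E.
Proof.
move=> s0 U0 v0 heps dom.
pose c (z : Z) : R := \1_(cube p) z.1.
pose l (z : Z) : R := lmod th rho z.2 z.1.
pose l0 (z : Z) : R := ltrue f0 sigma0 z.2 z.1.
pose g (z : Z) : R := gdens (fnet th z.1) v z.2.
have l00 z : 0 <= l0 z by rewrite ltW // ltrue_gt0.
have lge0 z : 0 <= l z by rewrite ltW // lmod_gt0.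
have g0 z : 0 <= g z by rewrite ltW // gdens_gt0.
have mc : measurable_fun setT c by exact: measurable_cube1.
have ml : measurable_fun setT l by exact: measurable_lmodz.
have ml0 : measurable_fun setT l0 by exact: measurable_ltrue.
have mg : measurable_fun setT g by apply: measurable_gdensZ => //; exact: measurable_fnetx.
have mh : measurable_fun [set: Z] (fun z => hdiff th rho z) by exact: measurable_hdiff.
pose I (h : Z -> R) := (\int[Lam]_z (c z * h z)%:E)%E.
have ID (h1 h2 : Z -> R) : measurable_fun setT h1 -> measurable_fun setT h2 ->
    (forall z, 0 <= h1 z) -> (forall z, 0 <= h2 z) ->
    I (fun z => h1 z + h2 z) = (I h1 + I h2)%E.
  move=> m1 m2 p1 p2; rewrite /I -ge0_integralD //.
  - by apply: eq_integral => z _; rewrite mulrDr EFinD.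
  - by move=> z _; rewrite lee_fin mulr_ge0.
  - by apply/measurable_EFinP; exact: measurable_funM.
  - by move=> z _; rewrite lee_fin mulr_ge0.
  - by apply/measurable_EFinP; exact: measurable_funM.
have IZ (a : R) (h1 : Z -> R) : 0 <= a -> measurable_fun setT h1 -> (forall z, 0 <= h1 z) ->
    I (fun z => a * h1 z) = (a%:E * I h1)%E.
  move=> a0 m1 p1; rewrite /I -ge0_integralZl_EFin //.
  - by apply: eq_integral => z _; rewrite mulrCA EFinM.
  - by move=> z _; rewrite lee_fin mulr_ge0.
  - by apply/measurable_EFinP; exact: measurable_funM.
have Il : I l = 1%E.
  by rewrite /I /c /l /lmod integral_cube_gdens ?exprn_gt0 ?softplus_gt0 //; exact: measurable_fnetx.
have Il0 : I l0 = 1%E.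
  by rewrite /I /c /l0 /ltrue integral_cube_gdens ?exprn_gt0 //; exact: measurable_f0.
have Ig : I g = 1%E by rewrite /I /c /g integral_cube_gdens //; exact: measurable_fnetx.
pose sq (z : Z) : R := Num.sqrt (U * g z * l0 z).
have msq : measurable_fun setT sq.
  apply: measurable_sqrt_ge0; first by move=> z; rewrite !mulr_ge0.
  by apply: measurable_funM => //; exact: measurable_funM.
have s2 : 0 < (2 * s)^-1 by rewrite invr_gt0 mulr_gt0.
have mZ (a : R) (h1 : Z -> R) : measurable_fun setT h1 -> measurable_fun setT (fun z => a * h1 z).
  by move=> m1; exact: measurable_funM.
pose hd := hdiff th rho.
have mhd : measurable_fun setT hd by exact: mh.
have hd0 z : 0 <= hd z by rewrite sqr_ge0.
have hI : I hd = hell f0 sigma0 th rho by rewrite hellE.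
have sq0 z : 0 <= sq z by rewrite sqrtr_ge0.
have key : (I (fun z : Z => sq z + 2^-1 * hd z + (2 * s)^-1 * l z)%R <=
    I (fun z : Z => 2^-1 * l z + 2^-1 * l0 z + ((2 * s)^-1 * U) * g z + (s / 2) * l0 z)%R)%E.
  apply: le_integralT => z; rewrite lee_fin ler_wpM2l //.
  have := @sqrt_dominate (U * g z) (l z) (l0 z) s (lge0 z) (dom z) (l00 z) s0.
  rewrite /sq /hd /hdiff /l /l0 /=; lra.
change (I sq <= (1 - eps / 2 + (U - 1) / (2 * s) + s / 2)%:E)%E.
clearbody l l0 g sq hd.
move: key; rewrite !ID ?IZ //; try (by move=> z; rewrite ?addr_ge0 ?mulr_ge0 ?sqrtr_ge0 ?sqr_ge0 // ltW);
  try (by rewrite ?mulr_ge0 // ltW); try (by repeat (apply: measurable_funD => //); exact: mZ).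
rewrite Il Il0 Ig !mule1 => key.
have Isq0 : (0 <= I sq)%E by apply: integral_ge0 => z _; rewrite lee_fin mulr_ge0.
have : (I sq + (2^-1 * eps)%:E + (2 * s)^-1%:E <= (2^-1 + 2^-1 + (2 * s)^-1 * U + s / 2)%:E)%E.
  apply: le_trans key; rewrite hI leeD2r // leeD2l // EFinM lee_wpmul2l // lee_fin.
move: (I sq) Isq0 => [i| |] //= _.
rewrite -!EFinD !lee_fin => H.
have -> : (U - 1) / (2 * s) = (2 * s)^-1 * U - (2 * s)^-1 by rewrite mulrBl mul1r mulrC.
lra.
Qed.

End hellinger.

Lemma ln_prod (R : realType) (I : Type) (s : seq I) (g : I -> R) :
  (forall i, 0 < g i) -> ln (\prod_(i <- s) g i) = \sum_(i <- s) ln (g i).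
Proof.
move=> g0; elim: s => [|i s IH]; first by rewrite !big_nil ln1.
by rewrite !big_cons lnM ?posrE ?IH // prodr_gt0.
Qed.

(** The quadratic term of the first density has the right sign and is dropped; the second uses
    [x^2 <= 2 (x - m)^2 + 2 m^2]. *)
Lemma ln_gdens_sub_le (R : realType) (c m s x : R) : 0 < s -> 0 < c ->
  ln (gdens m (s ^+ 2) x) - ln (gdens 0 (c ^+ 2) x) <= ln (c / s) + ((x - m) ^+ 2 + m ^+ 2) / c ^+ 2.
Proof.
move=> s0 c0; rewrite !ln_gdens ?exprn_gt0 // subr0.
have p2 : 0 < 2 * pi :> R by rewrite mulr_gt0 // pi_gt0.
have s20 : 0 < s ^+ 2 by rewrite exprn_gt0.
have c20 : 0 < c ^+ 2 by rewrite exprn_gt0.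
rewrite (lnM p2 s20) (lnM p2 c20) (ln_div c0 s0) !lnXn //.
have e1 : 0 <= (x - m) ^+ 2 / (2 * s ^+ 2) by rewrite divr_ge0 ?sqr_ge0 // mulr_ge0 // sqr_ge0.
have e2 : x ^+ 2 / (2 * c ^+ 2) <= ((x - m) ^+ 2 + m ^+ 2) / c ^+ 2.
  rewrite invfM mulrA ler_wpM2r ?invr_ge0 ?sqr_ge0 // ler_pdivrMr //.
  have := sqr_ge0 (x - 2 * m); lra.
rewrite -![ln _ *+ 2]mulr_natl; lra.
Qed.

(** * Variational bounds *)

Section inflated.
Context {R : realType} {K : nat}.
Implicit Type v : vpar R K.

(* [vdens v] with the variance of rho doubled if [a.1], and the variance of the
   coordinate [i] doubled if [a.2 = Some i]. *)
Definition infl v (a : bool * option 'I_K) (th : 'I_K -> R) (rho : R) : R :=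
  gdens v.1.1.1 ((if a.1 then 2 else 1) * v.1.1.2 ^+ 2) rho *
  \prod_(i < K) gdens (v.1.2 i) ((if a.2 == Some i then 2 else 1) * v.2 i ^+ 2) (th i).

Lemma infl_vdens v th rho : infl v (false, None) th rho = vdens v th rho.
Proof. by rewrite /infl /vdens mul1r; congr (_ * _); apply: eq_bigr => i _; rewrite mul1r. Qed.

(** The prior is itself a mean-field Gaussian, so the facts about [vdens] and [infl] serve for it
    too. *)
Lemma prior_vdens (eta zeta : R) th rho :
  prior eta zeta th rho = vdens ((0, eta, (fun=> 0), (fun=> zeta)) : vpar R K) th rho.
Proof. by []. Qed.

Lemma vdens_gt0 v th rho : vfamily v -> 0 < vdens v th rho.
Proof.
move=> [v0 v1]; rewrite mulr_gt0 ?gdens_gt0 ?exprn_gt0 // prodr_gt0 // => i _.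
by rewrite gdens_gt0 // exprn_gt0.
Qed.

(** Every [infl v a] is a product of probability densities, so a pointwise bound by a combination of
    them integrates to the sum of the coefficients, whatever their signs. *)
Lemma pint_infl_sum v (s : seq (R * (bool * option 'I_K))) : vfamily v ->
  pint (fun th rho => (\sum_(j <- s) j.1 * infl v j.2 th rho)%:E) = (\sum_(j <- s) j.1)%:E.
Proof.
move=> [v0 v1].
have p1 (b : bool) : 0 < (if b then 2 else 1) :> R by case: b.
pose J := (R * (bool * option 'I_K))%type.
pose g (j : J) := @gdens R v.1.1.1 ((if j.2.1 then 2 else 1) * v.1.1.2 ^+ 2).
pose phi (j : J) i := @gdens R (v.1.2 i) ((if j.2.2 == Some i then 2 else 1) * v.2 i ^+ 2).
apply: (@pint_sum_prod R K J s fst g phi).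
- by move=> j; apply: integrable_gdens; rewrite mulr_gt0 // exprn_gt0.
- by move=> j; apply: integral_gdens; rewrite mulr_gt0 // exprn_gt0.
- by move=> j i; apply: integrable_gdens; rewrite mulr_gt0 // exprn_gt0.
- by move=> j i; apply: integral_gdens; rewrite mulr_gt0 // exprn_gt0.
Qed.

Lemma pint_vdens v : vfamily v -> pint (fun th rho => (vdens v th rho)%:E) = 1%E.
Proof.
move=> vv; have := pint_infl_sum [:: (1, (false, None))] vv.
rewrite big_seq1 /= => <-; congr pint.
by apply/funext => th; apply/funext => rho; rewrite big_seq1 /= mul1r infl_vdens.
Qed.

Lemma infl_rho_le v o (c h : R) th rho : vfamily v ->
  h <= c * expR ((rho - v.1.1.1) ^+ 2 / (4 * v.1.1.2 ^+ 2)) ->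
  infl v (false, o) th rho * h <= c * Num.sqrt 2 * infl v (true, o) th rho.
Proof.
move=> [v0 v1] hc; rewrite /infl /= mulrAC [leRHS]mulrA ler_wpM2r //.
  apply: prodr_ge0 => i _; rewrite ltW // gdens_gt0 // mulr_gt0 ?exprn_gt0 //.
  by case: ifP.
by rewrite mul1r; apply: gdens_inflate_le => //; rewrite exprn_gt0.
Qed.

Lemma infl_coord_le v b i (c h : R) th rho : vfamily v ->
  h <= c * expR ((th i - v.1.2 i) ^+ 2 / (4 * v.2 i ^+ 2)) ->
  infl v (b, None) th rho * h <= c * Num.sqrt 2 * infl v (b, Some i) th rho.
Proof.
move=> [v0 v1] hc; rewrite /infl /= -mulrA [leRHS]mulrCA ler_wpM2l //.
  by rewrite ltW // gdens_gt0 // mulr_gt0 ?exprn_gt0 //; case: b.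
rewrite (bigD1 i) //= [in leRHS](bigD1 i) //= eqxx mulrAC [leRHS]mulrA mul1r.
rewrite [X in _ <= _ * X](eq_bigr (fun j => gdens (v.1.2 j) (1 * v.2 j ^+ 2) (th j))); last first.
  by move=> j ji; case: eqP => // -[] ij; rewrite ij eqxx in ji.
rewrite ler_wpM2r //.
  by apply: prodr_ge0 => j _; rewrite ltW // gdens_gt0 // mul1r exprn_gt0.
by apply: gdens_inflate_le => //; rewrite exprn_gt0.
Qed.

Local Notation Om := (measurableTypeR R * RI R 'I_K)%type.

Lemma measurable_om1 : measurable_fun [set: Om] (fun w => w.1 : R).
Proof. exact: measurable_fst. Qed.

Lemma measurable_om2 i : measurable_fun [set: Om] (fun w => w.2 i).
Proof. exact: (measurableT_comp (measurable_coord i) measurable_snd). Qed.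

Lemma measurable_vdens v : vfamily v ->
  measurable_fun [set: Om] (fun w => vdens v w.2 w.1).
Proof.
move=> [v0 v1]; apply: measurable_funM.
  by apply: measurable_gdens => // _; rewrite exprn_gt0.
apply: measurable_prod => i _; apply: measurable_gdens => //; first by move=> _; rewrite exprn_gt0.
exact: measurable_om2.
Qed.

Lemma pintZ (c : R) (F : ('I_K -> R) -> R -> \bar R) : 0 <= c ->
  measurable_fun [set: Om] (fun w => F w.2 w.1) ->
  (forall th rho, 0 <= F th rho)%E ->
  pint (fun th rho => c%:E * F th rho)%E = (c%:E * pint F)%E.
Proof.
move=> c0 mF F0; rewrite !pintE ?ge0_integralZl_EFin //.
  by apply: emeasurable_funM.
by move=> th rho; rewrite mule_ge0.
Qed.

Lemma pintD (F G : ('I_K -> R) -> R -> \bar R) :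
  measurable_fun [set: Om] (fun w => F w.2 w.1) ->
  measurable_fun [set: Om] (fun w => G w.2 w.1) ->
  (forall th rho, 0 <= F th rho)%E -> (forall th rho, 0 <= G th rho)%E ->
  pint (fun th rho => F th rho + G th rho)%E = (pint F + pint G)%E.
Proof.
move=> mF mG F0 G0; rewrite !pintE ?ge0_integralD //.
  by apply: emeasurable_funD.
by move=> th rho; rewrite adde_ge0.
Qed.

Lemma pint_ge0 (F : ('I_K -> R) -> R -> \bar R) :
  (forall th rho, 0 <= F th rho)%E -> (0 <= pint F)%E.
Proof. by move=> F0; apply: integral_ge0 => r _; exact: iint_ge0. Qed.

(** If the integral vanished, then [F = 0] almost everywhere, so the whole space would be negligible
    and a standard Gaussian density would also integrate to zero, although its mass is one. *)
Lemma pint_gt0 (F : ('I_K -> R) -> R -> R) :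
  measurable_fun [set: Om] (fun w => F w.2 w.1) ->
  (forall th rho, 0 < F th rho) -> (0 < pint (fun th rho => (F th rho)%:E))%E.
Proof.
move=> mF F0; rewrite lt0e pint_ge0 ?andbT; last by move=> th rho; rewrite lee_fin ltW.
apply/eqP; rewrite pintE; last 2 first.
- exact/measurable_EFinP.
- by move=> th rho; rewrite lee_fin ltW.
move=> I0.
have mE : measurable_fun [set: Om] (fun w => (F w.2 w.1)%:E) by exact/measurable_EFinP.
have /ae_eq_integral_abs : (\int[pleb]_w `|(F w.2 w.1)%:E| = 0)%E.
  by rewrite -I0; apply: eq_integral => w _; rewrite gee0_abs // lee_fin ltW.
move=> /(_ measurableT mE) ae0.
pose v : vpar R K := (0, 1, (fun=> 0), (fun=> 1)).
have vv : vfamily v by split=> //=.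
have mv := measurable_vdens vv.
have mvE : measurable_fun [set: Om] (fun w => (vdens v w.2 w.1)%:E) by exact/measurable_EFinP.
have : (\int[pleb]_w `|(vdens v w.2 w.1)%:E| = 0)%E.
  apply/ae_eq_integral_abs => //; apply: filterS ae0 => w /(_ Logic.I) [] F00.
  by have := F0 w.2 w.1; rewrite F00 ltxx.
have := pint_vdens vv; rewrite pintE //; last by move=> th rho; rewrite lee_fin ltW // vdens_gt0.
have -> : (\int[pleb]_w `|(vdens v w.2 w.1)%:E| = \int[pleb]_w (vdens v w.2 w.1)%:E)%E.
  by apply: eq_integral => w _; rewrite gee0_abs // lee_fin ltW // vdens_gt0.
by move=> -> /eqP; rewrite onee_eq0.
Qed.

(* Gibbs variational inequality, tested on the function [t \1_V]. *)
Lemma variational_lower v (U : ('I_K -> R) -> R -> R) (V : set (('I_K -> R) * R)) (t : R) :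
  vfamily v -> 0 <= t ->
  measurable_fun [set: Om] (fun w => U w.2 w.1) -> (forall th rho, 0 < U th rho) ->
  measurable_fun [set: Om] (fun w => \1_V (w.2, w.1) : R) ->
  (pint (fun th rho => (U th rho * expR (t * \1_V (th, rho)))%:E) < +oo)%E ->
  (t%:E * pint (fun th rho => (vdens v th rho * \1_V (th, rho))%:E) <=
   (ln (fine (pint (fun th rho => (U th rho * expR (t * \1_V (th, rho)))%:E))) -
    ln (fine (pint (fun th rho => (U th rho)%:E))))%:E +
   KL (vdens v) (fun th rho => (U th rho / fine (pint (fun th rho => (U th rho)%:E)))%R))%E.
Proof.
move=> vv t0 mU U0 mV.
set Z' := pint _; set Z := pint (fun th rho => (U th rho)%:E) => Z'oo.
have mq := measurable_vdens vv.
have me : measurable_fun [set: Om] (fun w => expR (t * \1_V (w.2, w.1)) : R).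
  have mtV : measurable_fun [set: Om] (fun w => t * \1_V (w.2, w.1) : R) by exact: measurable_funM.
  exact: (measurableT_comp (@measurable_expR R) mtV).
have mUe : measurable_fun [set: Om] (fun w => U w.2 w.1 * expR (t * \1_V (w.2, w.1))).
  exact: measurable_funM.
have Zgt0 : (0 < Z)%E by exact: pint_gt0.
have ZZ' : (Z <= Z')%E.
  apply: le_pint => th rho; rewrite lee_fin ler_peMr ?(ltW (U0 _ _)) //.
  by rewrite expR_ge1 // mulr_ge0.
have [z zE] : exists z, Z = z%:E.
  by exists (fine Z); rewrite fineK // (ge0_fin_numE (ltW Zgt0)) (le_lt_trans ZZ').
have [z' z'E] : exists z', Z' = z'%:E.
  by exists (fine Z'); rewrite fineK // ge0_fin_numE // (le_trans (ltW Zgt0)).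
rewrite zE z'E /= in Zgt0 ZZ' *.
rewrite lte_fin in Zgt0; rewrite lee_fin in ZZ'.
have z'0 : 0 < z' by exact: lt_le_trans ZZ'.
pose lC := ln z' - ln z.
have lC0 : 0 <= lC by rewrite subr_ge0 ler_ln ?posrE.
(* The integrand of [KL] is at least [A - B]: this is [ln x <= x - 1] at
   [x = U exp(t \1_V) / (z' q)], multiplied by [q]. Both [A] and [B] are nonnegative, the latter
   because [t >= 0] gives [z <= z'], hence [lC >= 0]. So [pintB_le] applies, and the integral of [B]
   is exactly [1 + lC]. *)
pose A th rho : \bar R := ((vdens v th rho)%:E + t%:E * (vdens v th rho * \1_V (th, rho))%:E)%E.
pose B th rho : \bar R := ((z'^-1)%:E * (U th rho * expR (t * \1_V (th, rho)))%:E + lC%:E * (vdens v th rho)%:E)%E.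
have mqV : measurable_fun [set: Om] (fun w => (vdens v w.2 w.1 * \1_V (w.2, w.1))%:E).
  by apply/measurable_EFinP; exact: measurable_funM.
have q0 th rho : 0 <= vdens v th rho by rewrite ltW // vdens_gt0.
have mA : measurable_fun [set: Om] (fun w => A w.2 w.1).
  by apply: emeasurable_funD; [exact/measurable_EFinP|exact: emeasurable_funM].
have mqE : measurable_fun [set: Om] (fun w => (vdens v w.2 w.1)%:E) by exact/measurable_EFinP.
have mUeE : measurable_fun [set: Om] (fun w => (U w.2 w.1 * expR (t * \1_V (w.2, w.1)))%:E).
  exact/measurable_EFinP.
have mB : measurable_fun [set: Om] (fun w => B w.2 w.1).
  by apply: emeasurable_funD; exact: emeasurable_funM.
have qV0 th rho : (0 <= (vdens v th rho * \1_V (th, rho))%:E)%E by rewrite lee_fin mulr_ge0.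
have Ue0 th rho : (0 <= (U th rho * expR (t * \1_V (th, rho)))%:E)%E.
  by rewrite lee_fin mulr_ge0 ?expR_ge0 // ltW.
have A0 th rho : (0 <= A th rho)%E.
  by apply: adde_ge0; [rewrite lee_fin|apply: mule_ge0 => //; rewrite lee_fin].
have z'V0 : 0 <= z'^-1 by rewrite invr_ge0 ltW.
have B0 th rho : (0 <= B th rho)%E.
  by apply: adde_ge0; apply: mule_ge0 => //; rewrite lee_fin.
have pA : pint A = (1 + t%:E * pint (fun th rho => (vdens v th rho * \1_V (th, rho))%:E))%E.
  rewrite pintD ?pintZ ?pint_vdens //; first exact: emeasurable_funM.
  by move=> th rho; apply: mule_ge0 => //; rewrite lee_fin.
have pB : pint B = (1 + lC)%:E.
  rewrite pintD ?pintZ ?pint_vdens //; try exact: emeasurable_funM;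
    try by move=> th rho; apply: mule_ge0 => //; rewrite lee_fin.
  by rewrite -/Z' z'E -EFinM mulVf ?gt_eqF // mule1.
have AB := pintB_le mA mB A0 B0.
have key : (pint (fun th rho => A th rho - B th rho)%E <=
    KL (vdens v) (fun th rho => (U th rho / z)%R))%E.
  apply: le_pint => th rho; rewrite /= /A /B -!EFinM -!EFinD lee_fin.
  set q := vdens v th rho; set e := t * _; set u := U th rho.
  have qgt0 : 0 < q by exact: vdens_gt0.
  have ugt0 : 0 < u by exact: U0.
  have -> : ln (q / (u / z)) = e - lC - ln (u * expR e / z' / q).
    have p1 : 0 < u / z by rewrite divr_gt0.
    have p2 : 0 < u * expR e by rewrite mulr_gt0 ?expR_gt0.
    have p3 : 0 < u * expR e / z' by rewrite divr_gt0.
    rewrite (ln_div qgt0 p1) (ln_div ugt0 Zgt0) (ln_div p3 qgt0) (ln_div p2 z'0).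
    rewrite lnM ?posrE ?expR_gt0 // expRK /lC; ring.
  have w0 : 0 < u * expR e / z' / q by rewrite !divr_gt0 // mulr_gt0 // expR_gt0.
  have hln : ln (u * expR e / z' / q) <= u * expR e / z' / q - 1.
    by rewrite lerBrDl -[leRHS]lnK ?posrE // expR_ge1Dx.
  have := ler_wpM2l (ltW qgt0) hln.
  have -> : q * (u * expR e / z' / q - 1) = z'^-1 * (u * expR e) - q by field; rewrite !gt_eqF.
  rewrite /e; lra.
have := le_trans AB key; rewrite pA pB.
set m := pint (fun th rho => (vdens v th rho * _)%:E).
have m0 : (0 <= t%:E * m)%E by rewrite mule_ge0 // pint_ge0.
set kl := KL _ _.
have -> : (1 + t%:E * m - (1 + lC)%:E = t%:E * m - lC%:E)%E.
  move: (t%:E * m)%E m0 => [y| |] //= _.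
  by rewrite -!EFinD; congr EFin; ring.
by rewrite leeBlDl.
Qed.

(** The hypothesis on [L] isolates what the likelihood must provide: growth in [rho] that is at most
    exponential and quadratic growth in [th]. Each such term times the test density is below a
    multiple of an inflated density, so the divergence is bounded by a sum of coefficients. *)
Lemma kl_upper (eta zeta tau rho0 l0 A0 A1 A2 A3 z : R) (th0 : 'I_K -> R)
  (L : ('I_K -> R) -> R -> R) :
  0 < eta -> 0 < zeta -> 0 < tau -> 0 < z ->
  0 <= A0 -> 0 <= A1 -> 0 <= A2 -> 0 <= A3 ->
  (forall th rho, 0 < L th rho) ->
  (forall th rho, - ln (L th rho) <= - l0 + A0 * `|rho - rho0| +
     A1 * (expR (2 * `|rho - rho0|) - 1) +
     expR (2 * `|rho - rho0|) * (A2 + A3 * \sum_(i < K) (th i - th0 i) ^+ 2)) ->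
  (KL (vdens (rho0, tau, th0, (fun=> tau)))
      (fun th rho => (L th rho * prior eta zeta th rho / z)%R) <=
   (ln z - l0 + (K%:R * ln (zeta / tau) + ln (eta / tau) +
       (\sum_(i < K) th0 i ^+ 2) / zeta ^+ 2 + rho0 ^+ 2 / eta ^+ 2) +
    Num.sqrt 2 * (4 * tau ^+ 2 / eta ^+ 2 + 2 * tau * A0 + 8 * tau * expR (8 * tau ^+ 2) * A1 +
      expR (4 * tau ^+ 2) * A2) +
    K%:R * (Num.sqrt 2 * (4 * tau ^+ 2 / zeta ^+ 2)) +
    K%:R * (8 * tau ^+ 2 * expR (4 * tau ^+ 2) * A3))%:E)%E.
Proof.
move=> eta0 zeta0 tau0 z0 A00 A10 A20 A30 L0 hL.
pose v : vpar R K := (rho0, tau, th0, (fun=> tau)).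
have vv : vfamily v by [].
set kap := ln z - l0 + _.
set B := _ + expR (4 * tau ^+ 2) * A2.
(* In order: the constant terms, of unknown sign, with no inflation; the terms in [rho] alone; the
   quadratic terms of the prior in each coordinate; the quadratic terms of the likelihood, which
   carry a factor in [rho] and so inflate both variances. The last kind pays [sqrt 2] twice, whence
   [8 tau^2] and no root. *)
pose s : seq (R * (bool * option 'I_K)) := [:: (kap, (false, None)); (Num.sqrt 2 * B, (true, None))] ++
  [seq (Num.sqrt 2 * (4 * tau ^+ 2 / zeta ^+ 2), (false, Some i)) | i <- index_enum 'I_K] ++
  [seq (8 * tau ^+ 2 * expR (4 * tau ^+ 2) * A3, (true, Some i)) | i <- index_enum 'I_K].
have sE (g : R * (bool * option 'I_K) -> R) : \sum_(j <- s) g j =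
    g (kap, (false, None)) + g (Num.sqrt 2 * B, (true, None)) +
    \sum_(i < K) g (Num.sqrt 2 * (4 * tau ^+ 2 / zeta ^+ 2), (false, Some i)) +
    \sum_(i < K) g (8 * tau ^+ 2 * expR (4 * tau ^+ 2) * A3, (true, Some i)).
  by rewrite !big_cat /= !big_cons big_nil addr0 !big_map addrA.
have sumE : \sum_(j <- s) j.1 = kap + Num.sqrt 2 * B +
    K%:R * (Num.sqrt 2 * (4 * tau ^+ 2 / zeta ^+ 2)) +
    K%:R * (8 * tau ^+ 2 * expR (4 * tau ^+ 2) * A3).
  by rewrite (sE fst) !sumr_const card_ord !mulr_natl.
rewrite -sumE -(pint_infl_sum s vv).
apply: le_pint => th rho; rewrite lee_fin (sE (fun j => j.1 * infl v j.2 th rho)) [leRHS]/=.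
rewrite -[vdens _ _ _](infl_vdens v).
set q := infl v (false, None) th rho.
set D := rho - rho0; set S := \sum_(i < K) (th i - th0 i) ^+ 2.
have q0 : 0 < q by rewrite /q infl_vdens; exact: vdens_gt0.
have t20 : 0 < tau ^+ 2 by rewrite exprn_gt0.
have hq : ln q - ln (prior eta zeta th rho) <= K%:R * ln (zeta / tau) + ln (eta / tau) +
    (D ^+ 2 + rho0 ^+ 2) / eta ^+ 2 + (S + \sum_(i < K) th0 i ^+ 2) / zeta ^+ 2.
  rewrite /q infl_vdens /vdens /prior /=.
  have g0 (m c x : R) : 0 < c -> 0 < gdens m (c ^+ 2) x by move=> c0; rewrite gdens_gt0 // exprn_gt0.
  have p1 : 0 < \prod_(i < K) gdens (th0 i) (tau ^+ 2) (th i) by apply: prodr_gt0 => i _; exact: g0.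
  have p2 : 0 < \prod_(i < K) gdens 0 (zeta ^+ 2) (th i) by apply: prodr_gt0 => i _; exact: g0.
  rewrite (lnM (g0 _ _ _ tau0) p1) (lnM (g0 _ _ _ eta0) p2).
  rewrite !ln_prod; try by move=> i; exact: g0.
  have := ln_gdens_sub_le rho0 rho tau0 eta0; rewrite -/D.
  have : \sum_(i < K) (ln (gdens (th0 i) (tau ^+ 2) (th i)) - ln (gdens 0 (zeta ^+ 2) (th i))) <=
      \sum_(i < K) (ln (zeta / tau) + ((th i - th0 i) ^+ 2 + th0 i ^+ 2) / zeta ^+ 2).
    by apply: ler_sum => i _; exact: ln_gdens_sub_le.
  rewrite sumrB big_split /= sumr_const card_ord -mulr_suml big_split /= -/S -[_ *+ K]mulr_natl.
  lra.
have pr0 : 0 < prior eta zeta th rho by rewrite prior_vdens vdens_gt0.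
have Lp0 : 0 < L th rho * prior eta zeta th rho by rewrite mulr_gt0.
have Lpz0 : 0 < L th rho * prior eta zeta th rho / z by rewrite divr_gt0.
rewrite (ln_div q0 Lpz0) (ln_div Lp0 z0) (lnM (L0 _ _) pr0).
have hLL := hL th rho; rewrite -/D -/S in hLL.
set hr := D ^+ 2 / eta ^+ 2 + A0 * `|D| + A1 * (expR (2 * `|D|) - 1) + expR (2 * `|D|) * A2.
have hD : ln q - (ln (L th rho) + ln (prior eta zeta th rho) - ln z) <=
   kap + hr + S / zeta ^+ 2 + expR (2 * `|D|) * A3 * S by rewrite /kap /hr; lra.
apply: (le_trans (ler_wpM2l (ltW q0) hD)).
rewrite (mulrDr q _ (_ * S)) (mulrDr q _ (S / _)) (mulrDr q kap).
apply: lerD; first apply: lerD; first apply: lerD.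
- by rewrite mulrC.
- rewrite [Num.sqrt 2 * B]mulrC; apply: infl_rho_le => //=.
  have iv : 0 <= (eta ^+ 2)^-1 by rewrite invr_ge0 sqr_ge0.
  have := ler_wpM2r iv (sqr_le_inflate D t20).
  have := ler_wpM2l A00 (norm_le_inflate D tau0).
  have := ler_wpM2l A10 (expR_norm_sub1_inflate D tau0).
  have := ler_wpM2r A20 (expR_norm_inflate D t20).
  rewrite -/D /B /hr; set E := expR (D ^+ 2 / _); set E8 := expR (8 * _).
  set E4 := expR (4 * _); set E2 := expR (2 * `|D|); lra.
- rewrite /S mulrA mulr_sumr mulr_suml; apply: ler_sum => i _.
  rewrite -mulrA [Num.sqrt 2 * _]mulrC; apply: infl_coord_le => //=.
  rewrite [leRHS]mulrAC ler_wpM2r ?invr_ge0 ?sqr_ge0 //; exact: sqr_le_inflate.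
- rewrite /S mulr_sumr mulr_sumr; apply: ler_sum => i _.
  have i1 : q * (th i - th0 i) ^+ 2 <= 4 * tau ^+ 2 * Num.sqrt 2 * infl v (false, Some i) th rho.
    by apply: infl_coord_le => //=; exact: sqr_le_inflate.
  have i2 : infl v (false, Some i) th rho * expR (2 * `|D|) <=
      expR (4 * tau ^+ 2) * Num.sqrt 2 * infl v (true, Some i) th rho.
    by apply: infl_rho_le => //=; exact: expR_norm_inflate.
  have sq2 : Num.sqrt 2 * Num.sqrt 2 = 2 :> R by rewrite -expr2 sqr_sqrtr.
  have eA : 0 <= expR (2 * `|D|) * A3 by rewrite mulr_ge0 // expR_ge0.
  have c0 : 0 <= 4 * tau ^+ 2 * Num.sqrt 2 * A3.
    by apply: mulr_ge0 => //; apply: mulr_ge0; rewrite ?sqrtr_ge0 // mulr_ge0 // ltW.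
  have := ler_wpM2r eA i1; have := ler_wpM2l c0 i2.
  set I1 := infl _ _ _ _; set I2 := infl _ _ _ _.
  have -> : 4 * tau ^+ 2 * Num.sqrt 2 * A3 * (expR (4 * tau ^+ 2) * Num.sqrt 2 * I2) =
    8 * tau ^+ 2 * expR (4 * tau ^+ 2) * A3 * I2.
    by rewrite -[RHS]mul1r; transitivity (4 * tau ^+ 2 * A3 * expR (4 * tau ^+ 2) * I2 * (Num.sqrt 2 * Num.sqrt 2)); [ring|rewrite sq2; ring].
  move=> j2 j1; lra.
Qed.

End inflated.

Lemma sqrtr_divM (R : rcfType) (a c : R) : 0 <= a -> 0 < c ->
  Num.sqrt (a / c) * c = Num.sqrt (a * c).
Proof.
move=> a0 c0; rewrite -{2}(gtr0_norm c0) -sqrtr_sqr -sqrtrM ?divr_ge0 ?(ltW c0) //.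
by congr Num.sqrt; rewrite expr2 mulrA divfK // gt_eqF.
Qed.

(** * Likelihood ratios and the sieve *)

Section probability_bounds.
Context {R : realType} {d : measure_display} {Omega : measurableType d}.
Variable P : probability Omega R.

Lemma markov_ge0 (f : Omega -> \bar R) (M t : R) :
  measurable_fun setT f -> (forall w, 0 <= f w)%E -> 0 < t ->
  (\int[P]_w f w <= M%:E)%E ->
  measurable [set w | (t%:E < f w)%E] /\ (P [set w | (t%:E < f w)%E] <= (M / t)%:E)%E.
Proof.
move=> mf f0 t0 hM.
have mA : measurable [set w | (t%:E < f w)%E].
  by rewrite -[X in measurable X]setTI; exact: emeasurable_fun_o_infty.
split=> //; rewrite EFinM lee_pdivlMr // muleC; apply: le_trans hM.
have -> : P [set w | (t%:E < f w)%E] = (\int[P]_w (\1_[set w | (t%:E < f w)%E] w)%:E)%E.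
  by rewrite (@integral_indic _ _ _ P setT measurableT _ mA) setIT.
rewrite -ge0_integralZl_EFin ?(ltW t0) //; last first.
  by apply/measurable_EFinP; exact: measurable_indic.
apply: le_integralT => w; rewrite indicE; case: (boolP (w \in _)); rewrite ?inE /= => h.
  by rewrite mule1 ltW.
by rewrite mule0.
Qed.

Lemma measureU_le (A B : set Omega) (x y : R) :
  measurable A -> measurable B -> (P A <= x%:E)%E -> (P B <= y%:E)%E ->
  (P (A `|` B) <= (x + y)%:E)%E.
Proof.
move=> mA mB hA hB; apply: le_trans (measureU2 _ mA mB) _.
by rewrite EFinD; exact: leeD.
Qed.

Lemma measure_bigU_le (J : Type) (s : seq J) (A : J -> set Omega) (c : R) :
  (forall j, measurable (A j)) -> (forall j, P (A j) <= c%:E)%E ->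
  (P (\big[setU/set0]_(j <- s) A j) <= ((size s)%:R * c)%:E)%E.
Proof.
move=> mA hA; elim: s => [|j s IH]; first by rewrite big_nil measure0 mul0r.
rewrite big_cons; apply: le_trans (measureU2 _ _ _) _ => //.
  by apply: bigsetU_measurable.
rewrite /= -natr1 mulrDl mul1r addrC EFinD; exact: leeD.
Qed.

End probability_bounds.

Section likelihood_ratio.
Context {R : realType} {d : measure_display} {Omega : measurableType d}.
Variable P : probability Omega R.
Context {p : nat}.
Variables (f0 : ('I_p -> R) -> R) (sigma0 : R).
Variables (X : nat -> Omega -> 'I_p -> R) (xi : nat -> Omega -> R).
Hypothesis sigma0_gt0 : 0 < sigma0.
Hypothesis mf0 : forall B : set R, measurable B -> Rp_measurable p (f0 @^-1` B).
Hypothesis mX : forall i h, measurable_fun [set: Omega] (fun w => X i w h).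
Hypothesis mxi : forall i, measurable_fun [set: Omega] (xi i).
Hypothesis indZ : mutually_independent P (coords X xi).
Hypothesis lawX : forall i h (B : set R), measurable B ->
  P ((fun w => X i w h) @^-1` B) = lebesgue_measure (B `&` `[0%R, 1%R]).
Hypothesis lawxi : forall i (B : set R), measurable B ->
  P (xi i @^-1` B) = normal_prob 0 sigma0 B.
Local Notation Z := (RI R 'I_p * measurableTypeR R)%type.

Let XY i w : Z := (X i w, f0 (X i w) + xi i w).

Lemma measurable_XY i : measurable_fun [set: Omega] (XY i).
Proof.
apply/measurable_fun_pairP; split; first exact: (measurable_Xvec mX).
exact: (measurable_Y mf0 mX mxi).
Qed.

Lemma expectation_prod_le n (h : Z -> R) (C : R) :
  measurable_fun setT h -> (forall z, 0 <= h z) ->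
  (\int[Lam]_z (h z * (\1_(cube p) z.1 * ltrue f0 sigma0 z.2 z.1))%:E <= C%:E)%E ->
  (\int[P]_w (\prod_(i < n) h (XY i w))%:E <= (C ^+ n)%:E)%E.
Proof.
move=> mh h0; set J := (\int[Lam]_z _)%E => hC.
have mhE : measurable_fun setT (fun z => (h z)%:E) by exact/measurable_EFinP.
have h0E z : (0 <= (h z)%:E)%E by rewrite lee_fin.
have J0 : (0 <= J)%E.
  by apply: integral_ge0 => z _; rewrite lee_fin mulr_ge0 // cube_ltrue_ge0.
under eq_integral do rewrite -prodEFin.
rewrite (@integral_prod_XY _ _ _ P _ _ _ _ mf0 mX mxi indZ n (fun=> EFin \o h)) //.
rewrite (eq_bigr (fun=> J)); last first.
  move=> i _.
  exact: (@integral_XY _ _ _ P _ _ _ _ _ sigma0_gt0 mf0 mX mxi indZ lawX lawxi i (EFin \o h)).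
case: J J0 hC => [j| |] //; rewrite ?leye_eq // !lee_fin => j0 jC.
by rewrite prodEFin lee_fin prodr_const card_ord lerXn2r // nnegrE (le_trans j0).
Qed.

Definition lratio k n (th : 'I_(Kdim k p) -> R) (rho : R) (w : Omega) : R :=
  \prod_(i < n) (lmod th rho (XY i w).2 (XY i w).1 / ltrue f0 sigma0 (XY i w).2 (XY i w).1).

Lemma lratio_gt0 k n (th : 'I_(Kdim k p) -> R) rho w : 0 < lratio n th rho w.
Proof. by apply: prodr_gt0 => i _; rewrite divr_gt0 ?lmod_gt0 // ltrue_gt0. Qed.

Lemma measurable_lratio k n {d'} {T : measurableType d'}
    (th : T -> 'I_(Kdim k p) -> R) (rho : T -> R) (w : T -> Omega) :
  (forall i, measurable_fun setT (fun t => th t i)) ->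
  measurable_fun setT rho -> measurable_fun setT w ->
  measurable_fun setT (fun t => lratio n (th t) (rho t) (w t)).
Proof.
move=> mth mr mw; apply: measurable_prod => i _.
have mXYi := measurableT_comp (measurable_XY i) mw.
have mY := measurableT_comp measurable_snd mXYi.
have mX1 := measurableT_comp measurable_fst mXYi.
apply: measurable_funM.
  apply: measurable_lmod => //.
  by move=> h; exact: (measurableT_comp (measurable_coord h) mX1).
apply: measurable_inv_gt0; first by move=> t; exact: ltrue_gt0.
exact: (measurableT_comp (measurable_ltrue sigma0_gt0 mf0) mXYi).
Qed.

Lemma expectation_lratio k n (th : 'I_(Kdim k p) -> R) rho :
  (\int[P]_w (lratio n th rho w)%:E <= 1)%E.
Proof.
have := @expectation_prod_le n (fun z => lmod th rho z.2 z.1 / ltrue f0 sigma0 z.2 z.1) 1.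
rewrite expr1n; apply.
- apply: measurable_funM; first exact: measurable_lmodz.
  apply: measurable_inv_gt0; first by move=> t; exact: ltrue_gt0.
  exact: measurable_ltrue.
- by move=> z; rewrite divr_ge0 // ltW ?lmod_gt0 // ltrue_gt0.
rewrite (eq_integral (fun z : Z => (\1_(cube p) z.1 *
   gdens (fnet th z.1) (softplus rho ^+ 2) z.2)%:E)); last first.
  move=> z _; rewrite mulrCA; congr (EFin (_ * _)).
  by rewrite divfK // gt_eqF // ltrue_gt0.
by rewrite integral_cube_gdens ?exprn_gt0 ?softplus_gt0 //; exact: measurable_fnetx.
Qed.

(** The bracket depends only on the centre, so one event serves the whole cell. With [s = eps / 4]
    and [U - 1 <= (eps / 4)^2] the affinity is at most [1 - eps / 2 + eps / 8 + eps / 8 <= exp(- eps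
    / 4)]. Markov's inequality at level [exp(- n eps / 8)] leaves the same probability, and the
    square of that level is [exp(- n eps / 4)]. *)
Lemma bracket_event k n (th : 'I_(Kdim k p) -> R) (rho eps b kap tau : R) :
  0 < eps -> 0 <= b -> 0 < kap -> 0 <= tau -> (forall i, `|th i| <= b) ->
  (eps%:E <= hell f0 sigma0 th rho)%E ->
  expR (2 * tau + kap + (tau * (k.+1%:R * (1 + p.+1%:R * b))) ^+ 2 * expR (2 * tau) /
     (2 * kap * softplus rho ^+ 2)) <= 1 + (eps / 4) ^+ 2 ->
  exists A, [/\ measurable A, (P A <= (expR (- (eps / 8 * n%:R)))%:E)%E &
    forall w, ~ A w -> (forall i, (i < n)%N -> cube p (X i w)) ->
    forall th' rho', (forall i, `|th' i - th i| <= tau) -> `|rho' - rho| <= tau ->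
    lratio n th' rho' w * expR (eps / 4 * n%:R) <= 1].
Proof.
move=> eps0 b0 kap0 tau0 thb heps.
set l := tau * _; set U := expR _ => hU.
set v := softplus rho ^+ 2 * (1 + kap) * expR (2 * tau).
have U0 : 0 < U by exact: expR_gt0.
have v0 : 0 < v by rewrite !mulr_gt0 ?expR_gt0 ?exprn_gt0 ?softplus_gt0 // addr_gt0.
pose g (z : Z) := U * gdens (fnet th z.1) v z.2.
have g0 z : 0 < g z by rewrite mulr_gt0 // gdens_gt0.
have mg : measurable_fun setT g.
  by apply: measurable_funM => //; apply: measurable_gdensZ => //; exact: measurable_fnetx.
pose h (z : Z) := Num.sqrt (g z / ltrue f0 sigma0 z.2 z.1).
have gl0 z : 0 < g z / ltrue f0 sigma0 z.2 z.1 by rewrite divr_gt0 // ltrue_gt0.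
have mh : measurable_fun setT h.
  apply: measurable_sqrt_ge0; first by move=> z; exact: ltW.
  apply: measurable_funM => //; apply: measurable_inv_gt0; first by move=> t; exact: ltrue_gt0.
  exact: measurable_ltrue.
have h0 z : 0 <= h z by exact: sqrtr_ge0.
have hdom z : lmod th rho z.2 z.1 <= g z.
  by apply: gdens_bracket => //; rewrite subrr normr0 // /l mulr_ge0 // mulr_ge0 // addr_ge0 // mulr_ge0.
have hint : (\int[Lam]_z (h z * (\1_(cube p) z.1 * ltrue f0 sigma0 z.2 z.1))%:E <= (expR (- (eps / 4)))%:E)%E.
  have s0 : 0 < eps / 4 by rewrite divr_gt0.
  have := affinity_bracket sigma0_gt0 mf0 s0 (ltW U0) v0 heps hdom.
  rewrite (eq_integral (fun z => (h z * (\1_(cube p) z.1 * ltrue f0 sigma0 z.2 z.1))%:E)); last first.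
    move=> z _; congr EFin; rewrite [RHS]mulrCA /h sqrtr_divM ?(ltW (g0 z)) //.
    exact: ltrue_gt0.
  move=> /le_trans; apply; rewrite lee_fin.
  have e1 : 1 - eps / 4 <= expR (- (eps / 4)) by exact: expR_ge1Dx.
  have e2 : (U - 1) / (2 * (eps / 4)) <= eps / 8.
    rewrite ler_pdivrMr ?mulr_gt0 //; move: hU; rewrite expr2; lra.
  lra.
have := @expectation_prod_le n h _ mh h0 hint.
rewrite -expRM_natl => hE.
have mprod : measurable_fun setT (fun w => (\prod_(i < n) h (XY i w))%:E).
  apply/measurable_EFinP; apply: measurable_prod => i _.
  exact: (measurableT_comp mh (measurable_XY i)).
have p0 w : (0 <= (\prod_(i < n) h (XY i w))%:E)%E by rewrite lee_fin prodr_ge0.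
have [mA hA] := markov_ge0 mprod p0 (expR_gt0 (- (eps / 8 * n%:R))) hE.
eexists; split; first exact: mA.
  apply: (le_trans hA); rewrite lee_fin -expRN -expRD ler_expR; lra.
move=> w /negP; rewrite -leNgt lee_fin => hw hc th' rho' hth hrho.
have le1 : lratio n th' rho' w <= (\prod_(i < n) h (XY i w)) ^+ 2.
  rewrite expr2 -big_split /=; apply: ler_prod => i _.
  rewrite divr_ge0 ?(ltW (lmod_gt0 _ _ _ _)) ?(ltW (ltrue_gt0 _ _ _)) //=.
  have hl : lmod th' rho' (XY i w).2 (XY i w).1 <= g (XY i w).
    by apply: gdens_bracket => //; apply: fnet_lip => //; exact: hc.
  have li : 0 <= (ltrue f0 sigma0 (XY i w).2 (XY i w).1)^-1.
    by rewrite invr_ge0 ltW // ltrue_gt0.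
  rewrite -expr2 /h sqr_sqrtr ?(ltW (gl0 _)) //.
  exact: (ler_wpM2r li hl).
have le2 : (\prod_(i < n) h (XY i w)) ^+ 2 <= expR (- (eps / 8 * n%:R)) ^+ 2.
  by rewrite ler_pXn2r // ?nnegrE ?expR_ge0 ?prodr_ge0.
rewrite -ler_pdivlMr ?expR_gt0 // -expRN mul1r.
apply: (le_trans le1); apply: (le_trans le2).
rewrite expr2 -expRD ler_expR; lra.
Qed.

End likelihood_ratio.

Definition bounded_params (R : realType) K (b : R) : set (('I_K -> R) * R) :=
  [set w | `|w.2| <= b /\ forall i, `|w.1 i| <= b].

(** A union bound over the [K + 1] coordinates. Where [|x| > b], the condition on [kap] gives
    [1 <= exp(- kap b^2) exp(x^2 / (4 e^2))] for a coordinate of standard deviation [e], and the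
    second factor is absorbed by doubling the variance. *)
Lemma prior_tail (R : realType) K (eta zeta b kap : R) : 0 < eta -> 0 < zeta -> 0 <= b ->
  kap * (4 * eta ^+ 2) <= 1 -> kap * (4 * zeta ^+ 2) <= 1 ->
  (pint (fun th rho => (prior eta zeta th rho * \1_(~` @bounded_params R K b) (th, rho))%:E) <=
   (K.+1%:R * (expR (- (kap * b ^+ 2)) * Num.sqrt 2))%:E)%E.
Proof.
move=> eta0 zeta0 b0 he hz.
pose v : vpar R K := (0, eta, (fun=> 0), (fun=> zeta)).
have vv : vfamily v by [].
set c := expR _ * _.
have c0 : 0 <= c by rewrite mulr_ge0 ?expR_ge0 ?sqrtr_ge0.
pose s : seq (R * (bool * option 'I_K)) :=
  (c, (true, None)) :: [seq (c, (false, Some i)) | i <- index_enum 'I_K].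
have sE (g : R * (bool * option 'I_K) -> R) : \sum_(j <- s) g j =
    g (c, (true, None)) + \sum_(i < K) g (c, (false, Some i)).
  by rewrite big_cons big_map.
have sumE : \sum_(j <- s) j.1 = K.+1%:R * c.
  by rewrite (sE fst) sumr_const card_ord /= -[K.+1%:R]natr1 mulrDl mul1r addrC mulr_natl.
rewrite -sumE -(pint_infl_sum s vv).
apply: le_pint => th rho; rewrite lee_fin (sE (fun j => j.1 * infl v j.2 th rho)) [leRHS]/=.
have i0 a : 0 <= infl v a th rho.
  rewrite /infl mulr_ge0 ?prodr_ge0 //= => *; rewrite ltW // gdens_gt0 // mulr_gt0 ?exprn_gt0 //;
    by case: ifP.
have tail (x e : R) : 0 < e -> kap * (4 * e ^+ 2) <= 1 -> b < `|x| ->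
    1 <= expR (- (kap * b ^+ 2)) * expR ((x - 0) ^+ 2 / (4 * e ^+ 2)).
  move=> e0 he' bx; rewrite -expRD -[leLHS]expR0 ler_expR addrC subr_ge0 subr0.
  rewrite ler_pdivlMr ?mulr_gt0 ?exprn_gt0 // mulrAC.
  have : b ^+ 2 <= x ^+ 2 by rewrite -[leRHS]real_normK ?num_real // ler_pXn2r ?nnegrE // ltW.
  have := sqr_ge0 b.
  move: (b ^+ 2) (x ^+ 2) => B Y B0 BY.
  apply: le_trans BY; rewrite -[leRHS]mul1r; exact: ler_wpM2r.
have ci0 a : 0 <= c * infl v a th rho by apply: mulr_ge0.
have sum0 : 0 <= \sum_(i < K) c * infl v (false, Some i) th rho.
  by apply: sumr_ge0 => i _; exact: ci0.
rewrite indicE; case: (boolP (_ \in _)); rewrite ?inE /= => h; last first.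
  by rewrite mulr0; apply: addr_ge0.
rewrite prior_vdens -(infl_vdens v).
case: (leP `|rho| b) => hrho; last first.
  have := @infl_rho_le _ _ v None _ _ th rho vv (tail rho eta eta0 he hrho).
  by move=> /le_trans; apply; rewrite lerDl.
have [i hi] : exists i, b < `|th i|.
  apply: contrapT => hn; apply: h; split=> // i.
  by rewrite leNgt; apply/negP => hi; apply: hn; exists i.
rewrite (bigD1 i) //= addrCA.
have := @infl_coord_le _ _ v false i _ _ th rho vv (tail (th i) zeta zeta0 hz hi).
move=> /le_trans; apply.
by rewrite lerDl; apply: addr_ge0 => //; apply: sumr_ge0.
Qed.

Lemma measurable_bounded_params (R : realType) K (b : R) :
  measurable [set v : (measurableTypeR R * RI R 'I_K)%type | bounded_params b (v.2, v.1)].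
Proof.
set Om := (_ * _)%type.
have mle (g : Om -> R) : measurable_fun setT g -> measurable [set v | `|g v| <= b].
  move=> mg; rewrite -[X in measurable X]setTI.
  have -> : [set v | `|g v| <= b] = (fun v => `|g v|) @^-1` `]-oo, b].
    by apply/seteqP; split=> z; rewrite /= in_itv.
  apply: (measurableT_comp (@normr_measurable _ setT) mg) => //; exact: measurable_itv.
have -> : [set v : Om | bounded_params b (v.2, v.1)] =
    [set v : Om | `|v.1 : R| <= b] `&` \bigcap_(i in setT) [set v : Om | `|v.2 i| <= b].
  by apply/seteqP; split=> z [h1 h2]; split=> // i; [move=> _|]; apply: h2.
apply: measurableI; first by apply: mle; exact: measurable_om1.
apply: fin_bigcap_measurable => [|i _]; first exact: finite_finset.
by apply: mle; exact: measurable_om2.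
Qed.

Section grid.
Context {R : realType}.

Definition grid_size (b tau : R) : nat := Num.truncn (2 * b / tau).

(** The index is meaningful only on [[- b, b]], where [x + b <= 2 b] keeps it within range of
    [inord]. *)
Definition grid_cell (b tau x : R) : 'I_(grid_size b tau).+1 :=
  inord (Num.truncn ((x + b) / tau)).

Lemma grid_cell_close (b tau x y : R) : 0 < tau -> `|x| <= b -> `|y| <= b ->
  grid_cell b tau x = grid_cell b tau y -> `|x - y| <= tau.
Proof.
move=> tau0; rewrite !ler_norml => /andP[x1 x2] /andP[y1 y2] /(congr1 val).
have r0 z : - b <= z -> 0 <= (z + b) / tau by move=> hz; rewrite divr_ge0 ?(ltW tau0) //; lra.
have lt z : - b <= z -> z <= b -> (Num.truncn ((z + b) / tau) < (grid_size b tau).+1)%N.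
  by move=> h1 h2; rewrite ltnS /grid_size le_truncn // ler_pM2r ?invr_gt0 //; lra.
rewrite /= !inordK ?lt // => E.
have /andP[a1 a2] := truncn_itv (r0 _ x1); have /andP[c1 c2] := truncn_itv (r0 _ y1).
rewrite E in a1 a2.
move: (Num.truncn _) a1 a2 c1 c2 => N; rewrite !ler_pdivlMr // !ltr_pdivrMr //.
rewrite -[N.+1%:R]natr1 [(_ + 1) * _]mulrDl mul1r; move: (_ * tau) => M a1 a2 c1 c2; apply/andP; split; lra.
Qed.

End grid.

Section evidence.
Context {R : realType} {d : measure_display} {Omega : measurableType d}.
Variable P : probability Omega R.
Context {p : nat}.
Variables (f0 : ('I_p -> R) -> R) (sigma0 : R).
Variables (X : nat -> Omega -> 'I_p -> R) (xi : nat -> Omega -> R).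
Hypothesis sigma0_gt0 : 0 < sigma0.
Hypothesis mf0 : forall B : set R, measurable B -> Rp_measurable p (f0 @^-1` B).
Hypothesis mX : forall i h, measurable_fun [set: Omega] (fun w => X i w h).
Hypothesis mxi : forall i, measurable_fun [set: Omega] (xi i).
Hypothesis indZ : mutually_independent P (coords X xi).
Hypothesis lawX : forall i h (B : set R), measurable B ->
  P ((fun w => X i w h) @^-1` B) = lebesgue_measure (B `&` `[0%R, 1%R]).
Hypothesis lawxi : forall i (B : set R), measurable B ->
  P (xi i @^-1` B) = normal_prob 0 sigma0 B.

Local Notation lratio := (lratio f0 sigma0 X xi).

Definition far k eps : set (('I_(Kdim k p) -> R) * R) :=
  [set w | ~ (hell f0 sigma0 w.1 w.2 < eps%:E)%E].

(** A union bound over the cells of a grid in [K + 1] dimensions, [None] being the axis of [rho].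
    The factor [expR (2 * b) / softplus 0 ^+ 2] bounds the precision uniformly on the box. *)
Lemma uniform_bracket k n (eps b kap tau : R) :
  0 < eps -> 0 <= b -> 0 < kap -> 0 < tau ->
  expR (2 * tau + kap + (tau * (k.+1%:R * (1 + p.+1%:R * b))) ^+ 2 * expR (2 * tau) *
     (expR (2 * b) / softplus 0 ^+ 2) / (2 * kap)) <= 1 + (eps / 4) ^+ 2 ->
  exists A, [/\ measurable A,
    (P A <= (((grid_size b tau).+1 ^ (Kdim k p).+1)%:R * expR (- (eps / 8 * n%:R)))%:E)%E &
    forall w, ~ A w -> (forall i, (i < n)%N -> cube p (X i w)) ->
    forall (th : 'I_(Kdim k p) -> R) rho, bounded_params b (th, rho) -> far eps (th, rho) ->
    lratio n th rho w * expR (eps / 4 * n%:R) <= 1].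
Proof.
move=> eps0 b0 kap0 tau0 hU.
set m := grid_size b tau; set K := Kdim k p.
pose cell (th : 'I_K -> R) (rho : R) : {ffun option 'I_K -> 'I_m.+1} :=
  [ffun o => grid_cell b tau (if o is Some i then th i else rho)].
have /choice[A hA] : forall j, exists B : set Omega,
  [/\ measurable B, (P B <= (expR (- (eps / 8 * n%:R)))%:E)%E &
    forall w, ~ B w -> (forall i, (i < n)%N -> cube p (X i w)) ->
    forall (th : 'I_(Kdim k p) -> R) rho, cell th rho = j -> bounded_params b (th, rho) -> far eps (th, rho) ->
    lratio n th rho w * expR (eps / 4 * n%:R) <= 1].
  move=> j.
  (* The bracket is centred at some far point of the cell and not at its midpoint, which may be
     close to the truth. A cell without a far point in the box gets the empty event. *)
  have [[[th0 rho0] [hj [/= hrho0 hth0] hfar]]|hno] := pselect (exists v : ('I_K -> R) * R,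
     [/\ cell v.1 v.2 = j, bounded_params b v & far eps v]); last first.
    exists set0; split; [exact: measurable0|by rewrite measure0 lee_fin expR_ge0|].
    by move=> w _ _ th rho h1 h2 h3; exfalso; apply: hno; exists (th, rho).
  have hell0 : (eps%:E <= hell f0 sigma0 th0 rho0)%E by rewrite leNgt; apply/negP.
  have hU0 : expR (2 * tau + kap + (tau * (k.+1%:R * (1 + p.+1%:R * b))) ^+ 2 * expR (2 * tau) /
     (2 * kap * softplus rho0 ^+ 2)) <= 1 + (eps / 4) ^+ 2.
    apply: le_trans hU; rewrite ler_expR lerD2l.
    have sr := softplus_ratio 0 rho0.
    have e2b : expR (2 * `|0 - rho0|) <= expR (2 * b) by rewrite sub0r normrN ler_expR ler_pM2l.
    have sp0 : 0 < softplus 0 ^+ 2 :> R by rewrite exprn_gt0 // softplus_gt0.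
    have h1 : (softplus rho0 ^+ 2)^-1 <= expR (2 * b) / softplus 0 ^+ 2.
      by apply: (le_trans sr); rewrite ler_pM2r ?invr_gt0.
    have l20 : 0 <= (tau * (k.+1%:R * (1 + p.+1%:R * b))) ^+ 2 * expR (2 * tau) / (2 * kap).
      by apply: divr_ge0; apply: mulr_ge0; rewrite ?sqr_ge0 ?expR_ge0 ?(ltW kap0).
    by rewrite [in leLHS]invfM [leLHS]mulrA [leRHS]mulrAC; exact: (ler_wpM2l l20 h1).
  have [B [mB PB hB]] := bracket_event sigma0_gt0 mf0 mX mxi indZ lawX lawxi n
    eps0 b0 kap0 (ltW tau0) hth0 hell0 hU0.
  exists B; split=> // w Bw hc th rho hcell [/= hrho hth] _.
  have close o := congr1 (fun g : {ffun option 'I_K -> 'I_m.+1} => g o) (etrans hcell (esym hj)).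
  apply: hB => // [i|].
    by have := close (Some i); rewrite !ffunE; exact: grid_cell_close.
  by have := close None; rewrite !ffunE; exact: grid_cell_close.
pose J := {ffun option 'I_K -> 'I_m.+1}.
exists (\big[setU/set0]_(j <- enum J) A j); split.
- by apply: bigsetU_measurable => j _; have [] := hA j.
- have := measure_bigU_le (P := P) (enum J) (fun j => let: And3 a _ _ := hA j in a)
     (fun j => let: And3 _ a _ := hA j in a).
  by rewrite -cardE card_ffun card_option !card_ord.
- move=> w hw hc th rho hb hf; have [_ _ /(_ w)] := hA (cell th rho).
  apply => //; move=> hAw; apply: hw.
  by rewrite -bigcup_seq; exists (cell th rho) => //=; rewrite mem_enum.
Qed.

(** The inputs lie in the cube only almost surely, whereas the Lipschitz bound for the network asks
    for it at every observation. *)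
Lemma cube_event n : exists A, [/\ measurable A, P A = 0%E &
  forall w, ~ A w -> forall i, (i < n)%N -> cube p (X i w)].
Proof.
pose B i := X i @^-1` (~` (cube p : set (RI R 'I_p))).
have mB i : measurable (B i).
  rewrite -[X in measurable X]setTI; apply: (measurable_Xvec mX) => //.
  by apply: measurableC; exact: measurable_cube.
have PB i : P (B i) = 0%E.
  rewrite (law_Xvec mX mxi indZ lawX); last by apply: measurableC; exact: measurable_cube.
  by rewrite setICl measure0.
exists (\big[setU/set0]_(i <- iota 0 n) B i); split.
- by apply: bigsetU_measurable.
- apply/eqP; rewrite eq_le measure_ge0 andbT.
  have := measure_bigU_le (P := P) (iota 0 n) (c := 0) mB.
  by rewrite mulr0; apply=> j; rewrite PB.
- move=> w hw i hi; apply: contrapT => hc; apply: hw.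
  by rewrite -bigcup_seq; exists i => //=; rewrite mem_iota.
Qed.

Local Notation Om k := (measurableTypeR R * RI R 'I_(Kdim k p))%type.

Lemma expectation_pint k n (G : ('I_(Kdim k p) -> R) -> R -> R) :
  measurable_fun [set: Om k] (fun v => G v.2 v.1) -> (forall th rho, 0 <= G th rho) ->
  measurable_fun [set: Omega] (fun w => pint (fun th rho => (lratio n th rho w * G th rho)%:E)) /\
  (\int[P]_w pint (fun th rho => (lratio n th rho w * G th rho)%:E) <=
   pint (fun th rho => (G th rho)%:E))%E.
Proof.
move=> mG G0.
pose F (z : Omega * Om k) := (lratio n z.2.2 z.2.1 z.1 * G z.2.2 z.2.1)%:E.
have mF : measurable_fun setT F.
  apply/measurable_EFinP; apply: measurable_funM; last first.
    exact: (measurableT_comp mG measurable_snd).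
  apply: (measurable_lratio sigma0_gt0 mf0 mX mxi); last exact: measurable_fst.
    move=> i; exact: (measurableT_comp (measurable_om2 i) measurable_snd).
  exact: (measurableT_comp measurable_om1 measurable_snd).
have F0 z : (0 <= F z)%E by rewrite lee_fin mulr_ge0 // ltW // lratio_gt0.
have E w : pint (fun th rho => (lratio n th rho w * G th rho)%:E) = fubini_F pleb F w.
  rewrite pintE //; last by move=> th rho; exact: (F0 (w, (rho, th))).
  apply/measurable_EFinP; apply: measurable_funM => //.
  by apply: (measurable_lratio sigma0_gt0 mf0 mX mxi) => //; exact: measurable_om2.
under eq_fun do rewrite E.
split; first exact: measurable_fun_fubini_tonelli_F.
rewrite (@fubini_tonelli _ _ _ _ _ P pleb F) // pintE //; last first.
  exact/measurable_EFinP.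
apply: le_integralT => v; rewrite /fubini_G /F /=.
under eq_integral do rewrite EFinM muleC.
rewrite ge0_integralZl_EFin //; last 2 first.
- by move=> w _; rewrite lee_fin ltW // lratio_gt0.
- apply/measurable_EFinP; apply: (measurable_lratio sigma0_gt0 mf0 mX mxi) => //.
rewrite -[leRHS]mule1; apply: lee_wpmul2l; first by rewrite lee_fin.
exact: (expectation_lratio sigma0_gt0 mf0 mX mxi indZ lawX lawxi).
Qed.

Lemma measurable_far k eps : measurable_fun [set: Om k] (fun v => \1_(far eps) (v.2, v.1) : R).
Proof.
apply: (@measurable_indic _ _ _ setT [set v : Om k | ~ (hell f0 sigma0 v.2 v.1 < eps%:E)%E]).
apply: measurableC.
rewrite -[X in measurable X]setTI; apply: emeasurable_fun_infty_o => //.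
exact: measurable_hell.
Qed.

(** The integral splits into three: near the truth the weight is one and Markov's inequality at
    level [s] costs [1 / s]; outside the box the weight [exp(t)] is compensated by Markov's
    inequality at level [exp(- t)]; inside the box and far from the truth the weighted ratio is at
    most one off the bracket events. The last two regions contribute the [2]. *)
Lemma evidence_bound k n (eta zeta eps b kap tau kp s : R) :
  0 < eta -> 0 < zeta -> 0 < eps -> 0 <= b -> 0 < kap -> 0 < tau -> 0 < s ->
  kp * (4 * eta ^+ 2) <= 1 -> kp * (4 * zeta ^+ 2) <= 1 ->
  expR (2 * tau + kap + (tau * (k.+1%:R * (1 + p.+1%:R * b))) ^+ 2 * expR (2 * tau) *
     (expR (2 * b) / softplus 0 ^+ 2) / (2 * kap)) <= 1 + (eps / 4) ^+ 2 ->
  exists A, [/\ measurable A,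
    (P A <= (s^-1 + expR (eps / 4 * n%:R) *
        ((Kdim k p).+1%:R * (expR (- (kp * b ^+ 2)) * Num.sqrt 2)) +
      ((grid_size b tau).+1 ^ (Kdim k p).+1)%:R * expR (- (eps / 8 * n%:R)))%:E)%E &
    forall w, ~ A w ->
    (pint (fun (th : 'I_(Kdim k p) -> R) rho => (lratio n th rho w * prior eta zeta th rho *
       expR (eps / 4 * n%:R * \1_(far eps) (th, rho)))%:E) <= (s + 2)%:E)%E].
Proof.
move=> eta0 zeta0 eps0 b0 kap0 tau0 s0 he hz hU.
set K := Kdim k p; set cn := eps / 4 * n%:R.
have [A1 [mA1 PA1 hA1]] := uniform_bracket n eps0 b0 kap0 tau0 hU.
have [A2 [mA2 PA2 hA2]] := cube_event n.
pose v : vpar R K := (0, eta, (fun=> 0), (fun=> zeta)).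
have vv : vfamily v by [].
have mpr : measurable_fun [set: Om k] (fun v => prior eta zeta v.2 v.1) := measurable_vdens vv.
have pr0 (th : 'I_K -> R) rho : 0 < prior eta zeta th rho by exact: (vdens_gt0 th rho vv).
have mb : measurable_fun [set: Om k] (fun v => \1_(~` bounded_params b) (v.2, v.1) : R).
  apply: (@measurable_indic _ _ _ setT [set v : Om k | ~ bounded_params b (v.2, v.1)]).
  exact: (measurableC (measurable_bounded_params b)).
pose G1 (th : 'I_K -> R) rho := prior eta zeta th rho.
pose G2 (th : 'I_K -> R) rho := prior eta zeta th rho * \1_(~` bounded_params b) (th, rho).
have G20 th rho : 0 <= G2 th rho by rewrite mulr_ge0 // ltW.
have mG2 : measurable_fun [set: Om k] (fun v => G2 v.2 v.1) by exact: measurable_funM.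
have [mT1 ET1] := @expectation_pint k n G1 mpr (fun th rho => ltW (pr0 th rho)).
have [mT2 ET2] := @expectation_pint k n G2 mG2 G20.
have T0 (G : ('I_K -> R) -> R -> R) : (forall th rho, 0 <= G th rho) -> forall w,
   (0 <= pint (fun th rho => (lratio n th rho w * G th rho)%:E))%E.
  by move=> G0 w; apply: pint_ge0 => th rho; rewrite lee_fin mulr_ge0 // ltW // lratio_gt0.
have G10 th rho : 0 <= G1 th rho by rewrite ltW // pr0.
rewrite (pint_vdens vv : pint (fun th rho => (G1 th rho)%:E) = 1%E) in ET1.
have ET2' := le_trans ET2 (@prior_tail R K eta zeta b kp eta0 zeta0 b0 he hz).
have [mA3 PA3] := markov_ge0 mT1 (T0 _ G10) s0 ET1.
have [mA4 PA4] := markov_ge0 mT2 (T0 _ G20) (expR_gt0 (- cn)) ET2'.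
set A3 := [set w | _] in mA3 PA3; set A4 := [set w | _] in mA4 PA4.
exists (A1 `|` A2 `|` A3 `|` A4); split.
- exact: (measurableU _ _ (measurableU _ _ (measurableU _ _ mA1 mA2) mA3) mA4).
- have mA12 := measurableU _ _ mA1 mA2; have mA123 := measurableU _ _ mA12 mA3.
  have PA2' : (P A2 <= 0%:E)%E by rewrite PA2.
  have := measureU_le mA123 mA4 (measureU_le mA12 mA3 (measureU_le mA1 mA2 PA1 PA2') PA3) PA4.
  have eV : (expR (- cn))^-1 = expR cn by rewrite expRN invrK.
  move=> /le_trans; apply; rewrite lee_fin mul1r eV.
  by rewrite addr0 [X in _ + X <= _]mulrC [X in X + _ <= _]addrC [leLHS]addrAC.
move=> w /not_orP[/not_orP[/not_orP[w1 w2] w3] w4].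
have {w3} h3 : (pint (fun th rho => (lratio n th rho w * G1 th rho)%:E) <= s%:E)%E.
  by rewrite leNgt; apply/negP.
have {w4} h4 : (pint (fun th rho => (lratio n th rho w * G2 th rho)%:E) <= (expR (- cn))%:E)%E.
  by rewrite leNgt; apply/negP.
pose S th rho : \bar R := ((lratio n th rho w * G1 th rho)%:E +
  ((expR cn)%:E * (lratio n th rho w * G2 th rho)%:E + (G1 th rho)%:E))%E.
have mlr : measurable_fun [set: Om k] (fun v => lratio n v.2 v.1 w).
  by apply: (measurable_lratio sigma0_gt0 mf0 mX mxi) => //; exact: measurable_om2.
have m1 : measurable_fun [set: Om k] (fun v => (lratio n v.2 v.1 w * G1 v.2 v.1)%:E).
  by apply/measurable_EFinP; exact: measurable_funM.
have m2 : measurable_fun [set: Om k] (fun v => (lratio n v.2 v.1 w * G2 v.2 v.1)%:E).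
  by apply/measurable_EFinP; exact: measurable_funM.
have m3 : measurable_fun [set: Om k] (fun v => (G1 v.2 v.1)%:E) by exact/measurable_EFinP.
have n1 th rho : (0 <= (lratio n th rho w * G1 th rho)%:E)%E.
  by rewrite lee_fin mulr_ge0 // ltW // lratio_gt0.
have n2 th rho : (0 <= (lratio n th rho w * G2 th rho)%:E)%E.
  by rewrite lee_fin mulr_ge0 // ltW // lratio_gt0.
have n3 th rho : (0 <= (G1 th rho)%:E)%E by rewrite lee_fin.
have n2' th rho : (0 <= (expR cn)%:E * (lratio n th rho w * G2 th rho)%:E)%E.
  by rewrite mule_ge0 // lee_fin expR_ge0.
have m2' : measurable_fun [set: Om k] (fun v => (expR cn)%:E * (lratio n v.2 v.1 w * G2 v.2 v.1)%:E)%E.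
  exact: emeasurable_funM.
apply: (@le_trans _ _ (pint S)); last first.
  rewrite /S pintD //; last 2 first.
  - exact: emeasurable_funD.
  - by move=> th rho; exact: adde_ge0.
  rewrite pintD // pintZ ?expR_ge0 // (pint_vdens vv).
  apply: (le_trans (leeD h3 (leeD (lee_wpmul2l _ h4) (lexx _)))); first by rewrite lee_fin expR_ge0.
  by rewrite -EFinM -expRD subrr expR0 -!EFinD lee_fin; lra.
apply: le_pint => th rho; rewrite /S /G2 -EFinM -!EFinD lee_fin.
have l0 : 0 < lratio n th rho w by exact: lratio_gt0.
have g0 : 0 < G1 th rho by exact: pr0.
rewrite -/(G1 th rho).
have lg0 : 0 < lratio n th rho w * G1 th rho by exact: mulr_gt0.
have e0 := expR_gt0 cn.
rewrite !indicE; case: (boolP (_ \in far eps)); rewrite ?inE => hf; last first.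
  rewrite mulr0 expR0 mulr1 lerDl; apply: addr_ge0; last exact: ltW.
  by do 3 (apply: mulr_ge0; first exact: ltW).
rewrite mulr1; case: (boolP (_ \in ~` _)); rewrite ?inE => hb.
  by rewrite mulr1 [_ * expR cn]mulrC; lra.
have /(_ _ w1 (hA2 w w2) th rho) := hA1; rewrite -/cn.
have hb' : bounded_params b (th, rho) by move: hb; rewrite notin_setE /= => /contrapT.
move=> /(_ hb' hf) h1; rewrite !mulr0 add0r mulrAC.
have := ler_wpM2r (ltW g0) h1; rewrite mul1r; lra.
Qed.

End evidence.

(** * Divergence of the test density from the posterior *)

Section data_terms.
Context {R : realType} {d : measure_display} {Omega : measurableType d}.
Variable P : probability Omega R.
Context {p : nat}.
Variables (f0 : ('I_p -> R) -> R) (sigma0 : R).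
Variables (X : nat -> Omega -> 'I_p -> R) (xi : nat -> Omega -> R).
Hypothesis sigma0_gt0 : 0 < sigma0.
Hypothesis mf0 : forall B : set R, measurable B -> Rp_measurable p (f0 @^-1` B).
Hypothesis sqf0 : (iint (fun x => (\1_(cube p) x * f0 x ^+ 2)%:E) < +oo)%E.
Hypothesis mX : forall i h, measurable_fun [set: Omega] (fun w => X i w h).
Hypothesis mxi : forall i, measurable_fun [set: Omega] (xi i).
Hypothesis indZ : mutually_independent P (coords X xi).
Hypothesis lawX : forall i h (B : set R), measurable B ->
  P ((fun w => X i w h) @^-1` B) = lebesgue_measure (B `&` `[0%R, 1%R]).
Hypothesis lawxi : forall i (B : set R), measurable B ->
  P (xi i @^-1` B) = normal_prob 0 sigma0 B.
Local Notation Z := (RI R 'I_p * measurableTypeR R)%type.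
Local Notation lratio := (lratio f0 sigma0 X xi).

(** The exact value is [sigma0 ^+ 2]; the inflation bound gives a constant multiple without
    computing a second moment. *)
Lemma expectation_noise_sq i :
  (\int[P]_w (xi i w ^+ 2)%:E <= (4 * sigma0 ^+ 2 * Num.sqrt 2)%:E)%E.
Proof.
set C := 4 * _ * _; have s20 : 0 < sigma0 ^+ 2 by rewrite exprn_gt0.
have C0 : 0 <= C by rewrite mulr_ge0 ?sqrtr_ge0 // mulr_ge0 // ltW.
have mf := measurable_f0 mf0.
pose h (z : Z) : \bar R := ((z.2 - f0 z.1) ^+ 2)%:E.
have mh : measurable_fun setT h.
  apply/measurable_EFinP; apply: measurable_funX; apply: measurable_funB; first exact: measurable_snd.
  exact: (measurableT_comp mf measurable_fst).
have -> : (\int[P]_w (xi i w ^+ 2)%:E = \int[P]_w h (X i w, (f0 (X i w) + xi i w)%R))%E.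
  by apply: eq_integral => w _; rewrite /h /= addrAC subrr add0r.
rewrite (integral_XY sigma0_gt0 mf0 mX mxi indZ lawX lawxi) //; last first.
  by move=> z; rewrite lee_fin sqr_ge0.
have v0 : 0 < 2 * sigma0 ^+ 2 by rewrite mulr_gt0.
apply: (@le_trans _ _ (\int[Lam]_z (C%:E * (\1_(cube p) z.1 * gdens (f0 z.1) (2 * sigma0 ^+ 2) z.2)%:E))%E).
  apply: le_integralT => z; rewrite /h -!EFinM lee_fin mulrCA [leRHS]mulrCA.
  apply: ler_wpM2l => //; rewrite mulrC.
  by apply: gdens_inflate_le => //; exact: sqr_le_inflate.
rewrite ge0_integralZl_EFin //; last 2 first.
- by move=> z _; rewrite lee_fin mulr_ge0 // ltW // gdens_gt0.
- by apply/measurable_EFinP; apply: measurable_funM; [exact: measurable_cube1|exact: measurable_gdensZ].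
by rewrite integral_cube_gdens // mule1.
Qed.

Lemma expectation_approx_sq i (g : RI R 'I_p -> R) : measurable_fun setT g ->
  (\int[P]_w ((g (X i w) - f0 (X i w)) ^+ 2)%:E =
   iint (fun x => (\1_(cube p) x * (g x - f0 x) ^+ 2)%:E))%E.
Proof.
move=> mg; have s20 : 0 < sigma0 ^+ 2 by rewrite exprn_gt0.
have mgf : measurable_fun [set: RI R 'I_p] (fun x => (g x - f0 x) ^+ 2).
  by apply: measurable_funX; apply: measurable_funB => //; exact: measurable_f0.
pose h (z : Z) : \bar R := ((g z.1 - f0 z.1) ^+ 2)%:E.
have mh : measurable_fun setT h.
  by apply/measurable_EFinP; exact: (measurableT_comp mgf measurable_fst).
rewrite (integral_XY sigma0_gt0 mf0 mX mxi indZ lawX lawxi i mh); last first.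
  by move=> z; rewrite lee_fin sqr_ge0.
rewrite /Lam /sprod fubini_tonelli1; last 2 first.
- by apply: emeasurable_funM => //; apply/measurable_EFinP; exact: measurable_cube_ltrue.
- by move=> z; rewrite mule_ge0 // lee_fin ?sqr_ge0 // cube_ltrue_ge0.
have mc : measurable_fun [set: RI R 'I_p] (\1_(cube p) : RI R 'I_p -> R).
  by apply: measurable_indic; exact: measurable_cube.
rewrite iintE; last 2 first.
- by apply/measurable_EFinP; exact: measurable_funM.
- by move=> x; rewrite lee_fin mulr_ge0 // sqr_ge0.
apply: eq_integral => x _; rewrite /fubini_F /h /=.
transitivity (\int[lam R]_y ((\1_(cube p) x * (g x - f0 x) ^+ 2)%:E * (ltrue f0 sigma0 y x)%:E))%E.
  by apply: eq_integral => y _; rewrite -!EFinM; congr EFin; ring.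
rewrite ge0_integralZl_EFin //; last 3 first.
- by move=> y _; rewrite lee_fin ltW // gdens_gt0.
- by apply/measurable_EFinP; exact: (@measurable_gdens _ (measurableTypeR R)).
- by rewrite mulr_ge0 // sqr_ge0.
by rewrite integral_gdens // mule1.
Qed.

Lemma fnet_bounded k (th : 'I_(Kdim k p) -> R) :
  exists C, forall x, cube p x -> `|fnet th x| <= C.
Proof.
set e := \sum_i `|th i|.
have he i : `|th i - 0| <= e by rewrite subr0 /e (bigD1 i) //= lerDl sumr_ge0.
exists (e * (k.+1%:R * (1 + p.+1%:R * 0))) => x cx.
have := @fnet_lip _ k p th (fun=> 0) x e 0 cx _ (lexx 0) he _.
rewrite {2}/fnet /par add0r big1 ?subr0; last by move=> j _; rewrite mul0r.
by apply; [exact: sumr_ge0|move=> i; rewrite normr0].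
Qed.

(** [l2dist] passes through [fine], which would send an infinite integral to zero. Finiteness
    follows from the square integrability of [f0] and the boundedness of the network on the cube. *)
Lemma l2dist_sq k (th : 'I_(Kdim k p) -> R) :
  (iint (fun x => (\1_(cube p) x * (fnet th x - f0 x) ^+ 2)%:E) =
   (l2dist (fnet th) f0 ^+ 2)%:E)%E.
Proof.
have J0 : (0 <= iint (fun x => (\1_(cube p) x * (fnet th x - f0 x) ^+ 2)%:E))%E.
  by apply: iint_ge0 => x; rewrite lee_fin mulr_ge0 // sqr_ge0.
have Joo : (iint (fun x => (\1_(cube p) x * (fnet th x - f0 x) ^+ 2)%:E) < +oo)%E.
  have [C hC] := fnet_bounded th.
  have mc : measurable_fun [set: RI R 'I_p] (\1_(cube p) : RI R 'I_p -> R).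
    by apply: measurable_indic; exact: measurable_cube.
  have mcE : measurable_fun [set: RI R 'I_p] (fun x => (\1_(cube p) x)%:E : \bar R).
    exact/measurable_EFinP.
  have mcf : measurable_fun [set: RI R 'I_p] (fun x => (\1_(cube p) x * f0 x ^+ 2)%:E).
    by apply/measurable_EFinP; apply: measurable_funM => //; apply: measurable_funX; exact: measurable_f0.
  have c20 : 0 <= 2 * C ^+ 2 by rewrite mulr_ge0 // sqr_ge0.
  have f20 x : (0 <= (\1_(cube p) x * f0 x ^+ 2)%:E)%E by rewrite lee_fin mulr_ge0 // sqr_ge0.
  apply: (@le_lt_trans _ _ (iint (fun x => (2 * C ^+ 2)%:E * (\1_(cube p) x)%:E +
      2%:E * (\1_(cube p) x * f0 x ^+ 2)%:E)%E)).
    apply: le_iint => x; rewrite -!EFinM -EFinD lee_fin mulrC !indicE.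
    case: (boolP (_ \in _)); rewrite ?inE => cx; last by rewrite !(mulr0, mul0r) addr0.
    rewrite !(mulr1, mul1r); have : fnet th x ^+ 2 <= C ^+ 2.
      by rewrite -[leLHS]real_normK ?num_real // ler_pXn2r ?nnegrE ?hC // (le_trans _ (hC _ cx)).
    have := sqr_ge0 (fnet th x + f0 x); lra.
  have t0 (x : 'I_p -> R) : (0 <= (2 * C ^+ 2)%:E * (\1_(cube p) x)%:E)%E by rewrite -EFinM lee_fin mulr_ge0.
  have t1 x : (0 <= 2%:E * (\1_(cube p) x * f0 x ^+ 2)%:E)%E.
    by rewrite -EFinM lee_fin mulr_ge0 // mulr_ge0 // sqr_ge0.
  rewrite iintE; last 2 first.
  - by apply: emeasurable_funD; exact: emeasurable_funM.
  - by move=> x; exact: adde_ge0.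
  rewrite ge0_integralD //; [|exact: emeasurable_funM|exact: emeasurable_funM].
  rewrite !ge0_integralZl_EFin //.
  rewrite (@integral_indic _ _ _ (leb p) setT measurableT _ (@measurable_cube R p)) setIT.
  have lc : (leb p (cube p : set (RI R 'I_p)) < +oo)%E by rewrite leb_cube ltry.
  have lf : (\int[leb p]_x (\1_(cube p) x * f0 x ^+ 2)%:E < +oo)%E by rewrite -iintE.
  by apply: lte_add_pinfty; apply: lte_mul_pinfty.
rewrite /l2dist; move: J0 Joo; case: (iint _) => [j| |] //= j0 _.
by rewrite sqr_sqrtr.
Qed.

(** This is the hypothesis of [kl_upper] with [A0 = n]. The weight [s] splits the product of the
    noise with the approximation error: when [s] is of the order of the [L2] error, both halves are
    of order [n s], so the loss is linear in that error. *)
Lemma loglik_lower n k (th0 : 'I_(Kdim k p) -> R) (xs : 'I_n -> 'I_p -> R) (e : 'I_n -> R)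
    (rho0 s B : R) : 0 < s -> s <= 1 -> 0 <= B -> softplus rho0 = sigma0 ->
  (forall i, cube p (xs i)) -> (forall i, `|th0 i| <= B) -> forall th rho,
  - ln (likelihood xs (fun i => f0 (xs i) + e i) th rho) <=
  - ln (\prod_(i < n) ltrue f0 sigma0 (f0 (xs i) + e i) (xs i)) + n%:R * `|rho - rho0| +
  (\sum_(i < n) e i ^+ 2) / (2 * sigma0 ^+ 2) * (expR (2 * `|rho - rho0|) - 1) +
  expR (2 * `|rho - rho0|) *
   ((\sum_(i < n) (s * e i ^+ 2 / 2 + 2 * (fnet th0 (xs i) - f0 (xs i)) ^+ 2 / s)) / sigma0 ^+ 2 +
    n%:R * (2 * (k.+1%:R * (1 + p.+1%:R * B)) ^+ 2) / (s * sigma0 ^+ 2) *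
    \sum_j (th j - th0 j) ^+ 2).
Proof.
move=> s0 s1 B0 hrho0 hc hB th rho.
have s20 : 0 < sigma0 ^+ 2 by rewrite exprn_gt0.
set D := `|rho - rho0|; set E := expR (2 * D); set G := _ * (1 + _).
set S := \sum_j (th j - th0 j) ^+ 2; have S0 : 0 <= S by apply: sumr_ge0 => j _; exact: sqr_ge0.
rewrite /likelihood !ln_prod; last 2 first.
- by move=> i; rewrite gdens_gt0.
- by move=> i; exact: lmod_gt0.
pose r i := f0 (xs i) - fnet th (xs i).
pose r0 i := fnet th0 (xs i) - f0 (xs i).
have term i : ln (ltrue f0 sigma0 (f0 (xs i) + e i) (xs i)) - ln (lmod th rho (f0 (xs i) + e i) (xs i)) <=
   D + e i ^+ 2 / (2 * sigma0 ^+ 2) * (E - 1) +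
   E / sigma0 ^+ 2 * ((s * e i ^+ 2 / 2 + 2 * r0 i ^+ 2 / s) + 2 * G ^+ 2 / s * S).
  have h := @ln_ratio_le _ rho rho0 (e i) (r i) s (fnet th (xs i)) (sigma0 ^+ 2) E s0 s1
     (congr1 (fun x => x ^+ 2) (esym hrho0)) erefl.
  have fr : f0 (xs i) = fnet th (xs i) + r i by rewrite /r addrC subrK.
  rewrite -fr in h.
  apply: (le_trans h); rewrite lerD2l ler_wpM2l ?divr_ge0 ?expR_ge0 ?(ltW s20) //.
  rewrite -addrA lerD2l.
  have -> : 2 * r0 i ^+ 2 / s + 2 * G ^+ 2 / s * S = (2 * r0 i ^+ 2 + 2 * (G ^+ 2 * S)) / s by ring.
  rewrite ler_pM2r ?invr_gt0 //.
  (* Every coordinate of [th - th0] is at most [sqrt S] in absolute value, so the squared Lipschitz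
     bound is linear in the sum of squares [S]. *)
  have hl : `|fnet th (xs i) - fnet th0 (xs i)| <= Num.sqrt S * G.
    apply: fnet_lip => // j; rewrite -sqrtr_sqr ler_sqrt // /S (bigD1 j) //= lerDl.
    by apply: sumr_ge0 => *; exact: sqr_ge0.
  have hl2 : (fnet th (xs i) - fnet th0 (xs i)) ^+ 2 <= G ^+ 2 * S.
    rewrite -[leLHS]real_normK ?num_real // -[in leRHS](sqr_sqrtr S0) -exprMn [G * _]mulrC.
    by rewrite ler_pXn2r ?nnegrE // (le_trans _ hl).
  have := sqr_ge0 (r0 i - (fnet th (xs i) - fnet th0 (xs i))); rewrite /r0 /r; lra.
rewrite -lerBlDl.
have : \sum_(i < n) (ln (ltrue f0 sigma0 (f0 (xs i) + e i) (xs i)) - ln (lmod th rho (f0 (xs i) + e i) (xs i))) <=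
   \sum_(i < n) (D + e i ^+ 2 / (2 * sigma0 ^+ 2) * (E - 1) +
   E / sigma0 ^+ 2 * ((s * e i ^+ 2 / 2 + 2 * r0 i ^+ 2 / s) + 2 * G ^+ 2 / s * S)).
  by apply: ler_sum => i _; exact: term.
set Q := \sum_(i < n) (s * e i ^+ 2 / 2 + _).
rewrite sumrB; have -> : \sum_(i < n) (D + e i ^+ 2 / (2 * sigma0 ^+ 2) * (E - 1) +
   E / sigma0 ^+ 2 * ((s * e i ^+ 2 / 2 + 2 * r0 i ^+ 2 / s) + 2 * G ^+ 2 / s * S)) =
   n%:R * D + (\sum_(i < n) e i ^+ 2) / (2 * sigma0 ^+ 2) * (E - 1) +
   E / sigma0 ^+ 2 * (Q + n%:R * (2 * G ^+ 2 / s * S)).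
  rewrite big_split /= big_split /=; congr (_ + _ + _).
  - by rewrite sumr_const card_ord mulr_natl.
  - by rewrite !mulr_suml.
  - by rewrite -mulr_sumr big_split /= sumr_const card_ord -[X in _ * (_ + X) = _]mulr_natl.
have -> : E / sigma0 ^+ 2 * (Q + n%:R * (2 * G ^+ 2 / s * S)) =
   E * (Q / sigma0 ^+ 2 + n%:R * (2 * G ^+ 2) / (s * sigma0 ^+ 2) * S).
  by field; rewrite !gt_eqF.
set SE := \sum_(i < n) e i ^+ 2; lra.
Qed.

End data_terms.

Section posterior_bound.
Context {R : realType} {d : measure_display} {Omega : measurableType d}.
Variable P : probability Omega R.
Context {p : nat}.
Variables (f0 : ('I_p -> R) -> R) (sigma0 : R).
Variables (X : nat -> Omega -> 'I_p -> R) (xi : nat -> Omega -> R).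
Hypothesis sigma0_gt0 : 0 < sigma0.
Hypothesis mf0 : forall B : set R, measurable B -> Rp_measurable p (f0 @^-1` B).
Hypothesis sqf0 : (iint (fun x => (\1_(cube p) x * f0 x ^+ 2)%:E) < +oo)%E.
Hypothesis mX : forall i h, measurable_fun [set: Omega] (fun w => X i w h).
Hypothesis mxi : forall i, measurable_fun [set: Omega] (xi i).
Hypothesis indZ : mutually_independent P (coords X xi).
Hypothesis lawX : forall i h (B : set R), measurable B ->
  P ((fun w => X i w h) @^-1` B) = lebesgue_measure (B `&` `[0%R, 1%R]).
Hypothesis lawxi : forall i (B : set R), measurable B ->
  P (xi i @^-1` B) = normal_prob 0 sigma0 B.
Local Notation Z := (RI R 'I_p * measurableTypeR R)%type.
Local Notation lratio := (lratio f0 sigma0 X xi).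


(** [s] is only required to dominate the [L2] error, which may be zero while [s] is a divisor. With
    [C] the bound on the second moment of the noise, the expectations are at most [n C] and
    [n s (C / 2 + 2)], the latter since [D^2 / s <= s]. Two applications of Markov's inequality cost
    [(3 C / 2 + 2) / M], which is rounded up. *)
Lemma noise_event n k (th0 : 'I_(Kdim k p) -> R) (s M : R) : (0 < n)%N ->
  0 < s -> l2dist (fnet th0) f0 <= s -> 0 < M ->
  exists A, [/\ measurable A,
    (P A <= ((12 * sigma0 ^+ 2 * Num.sqrt 2 + 2) / M)%:E)%E &
    forall w, ~ A w -> \sum_(i < n) xi i w ^+ 2 <= M * n%:R /\
      \sum_(i < n) (s * xi i w ^+ 2 / 2 + 2 * (fnet th0 (X i w) - f0 (X i w)) ^+ 2 / s) <= M * (n%:R * s)].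
Proof.
move=> n0 s0 hs M0; set C := 4 * sigma0 ^+ 2 * Num.sqrt 2.
have n0' : 0 < n%:R :> R by rewrite ltr0n.
set D := l2dist _ _ in hs; have D0 : 0 <= D by exact: sqrtr_ge0.
have C0 : 0 <= C by rewrite mulr_ge0 ?sqrtr_ge0 // mulr_ge0 // sqr_ge0.
have mr i : measurable_fun [set: Omega] (fun w => (fnet th0 (X i w) - f0 (X i w)) ^+ 2).
  apply: measurable_funX; apply: measurable_funB.
    exact: (measurableT_comp (measurable_fnetx th0) (measurable_Xvec mX i)).
  exact: (measurableT_comp (measurable_f0 mf0) (measurable_Xvec mX i)).
have mx i : measurable_fun [set: Omega] (fun w => xi i w ^+ 2) by exact: measurable_funX.
have m1 : measurable_fun setT (fun w => (\sum_(i < n) xi i w ^+ 2)%:E).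
  by apply/measurable_EFinP; apply: measurable_sum.
have ms i : measurable_fun setT (fun w => (s * xi i w ^+ 2 / 2 + 2 * (fnet th0 (X i w) - f0 (X i w)) ^+ 2 / s)).
  by apply: measurable_funD; apply: measurable_funM => //; apply: measurable_funM.
have m2 : measurable_fun setT
   (fun w => (\sum_(i < n) (s * xi i w ^+ 2 / 2 + 2 * (fnet th0 (X i w) - f0 (X i w)) ^+ 2 / s))%:E).
  by apply/measurable_EFinP; apply: measurable_sum.
have p2 i w : 0 <= s * xi i w ^+ 2 / 2 + 2 * (fnet th0 (X i w) - f0 (X i w)) ^+ 2 / s.
  by apply: addr_ge0; apply: divr_ge0; rewrite ?(ltW s0) //; apply: mulr_ge0; rewrite ?sqr_ge0 ?(ltW s0).
have sumI (g : nat -> Omega -> R) (c : R) : (forall i, measurable_fun setT (g i)) ->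
    (forall i w, 0 <= g i w) -> (forall i, (\int[P]_w (g i w)%:E <= c%:E)%E) ->
    (\int[P]_w (\sum_(i < n) g i w)%:E <= (n%:R * c)%:E)%E.
  move=> mg g0 hg; under eq_integral do rewrite -sumEFin.
  rewrite ge0_integral_sum //; last 2 first.
  - by move=> i; exact/measurable_EFinP.
  - by move=> i w _; rewrite lee_fin.
  apply: (@le_trans _ _ (\sum_(i < n) c%:E)%E); first by apply: lee_sum => i _; exact: hg.
  by rewrite sumEFin sumr_const card_ord mulr_natl.
have I1 := sumI (fun i w => xi i w ^+ 2) C mx (fun i w => sqr_ge0 _)
   (fun i => expectation_noise_sq sigma0_gt0 mf0 mX mxi indZ lawX lawxi i).
have I2 := sumI (fun i w => s * xi i w ^+ 2 / 2 + 2 * (fnet th0 (X i w) - f0 (X i w)) ^+ 2 / s)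
   (s * (C / 2 + 2)) ms p2.
have {}I2 := I2 _.
have mM1 : 0 < M * n%:R by rewrite mulr_gt0.
have mM2 : 0 < M * (n%:R * s) by rewrite !mulr_gt0.
have hI i : (\int[P]_w (s * xi i w ^+ 2 / 2 + 2 * (fnet th0 (X i w) - f0 (X i w)) ^+ 2 / s)%:E <=
    (s * (C / 2 + 2))%:E)%E.
  have e1 := expectation_noise_sq sigma0_gt0 mf0 mX mxi indZ lawX lawxi i.
  have e2 := expectation_approx_sq sigma0_gt0 mf0 mX mxi indZ lawX lawxi i (measurable_fnetx th0).
  rewrite (l2dist_sq mf0 sqf0) -/D in e2.
  have -> : (\int[P]_w (s * xi i w ^+ 2 / 2 + 2 * (fnet th0 (X i w) - f0 (X i w)) ^+ 2 / s)%:E =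
     (s / 2)%:E * \int[P]_w (xi i w ^+ 2)%:E +
     (2 / s)%:E * \int[P]_w ((fnet th0 (X i w) - f0 (X i w)) ^+ 2)%:E)%E.
    rewrite -!ge0_integralZl_EFin ?divr_ge0 ?(ltW s0) //; last 4 first.
    - by move=> w _; rewrite lee_fin sqr_ge0.
    - exact/measurable_EFinP.
    - by move=> w _; rewrite lee_fin sqr_ge0.
    - exact/measurable_EFinP.
    rewrite -ge0_integralD //; last 4 first.
    - by move=> w _; rewrite -EFinM lee_fin mulr_ge0 ?sqr_ge0 // divr_ge0 // ltW.
    - by apply: emeasurable_funM => //; exact/measurable_EFinP.
    - by move=> w _; rewrite -EFinM lee_fin mulr_ge0 ?sqr_ge0 // divr_ge0 // ltW.
    - by apply: emeasurable_funM => //; exact/measurable_EFinP.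
    by apply: eq_integral => w _; rewrite -!EFinM -EFinD; congr EFin; ring.
  rewrite e2; apply: (@le_trans _ _ ((s / 2)%:E * C%:E + (2 / s)%:E * (D ^+ 2)%:E)%E).
    by apply: leeD => //; apply: lee_wpmul2l => //; rewrite lee_fin divr_ge0 // ltW.
  rewrite -!EFinM -EFinD lee_fin.
  have : D ^+ 2 / s <= s by rewrite ler_pdivrMr // -expr2 ler_pXn2r ?nnegrE // ltW.
  lra.
have q1 w : (0 <= (\sum_(i < n) xi i w ^+ 2)%:E)%E.
  by rewrite lee_fin; apply: sumr_ge0 => i _; exact: sqr_ge0.
have q2 w : (0 <= (\sum_(i < n) (s * xi i w ^+ 2 / 2 + 2 * (fnet th0 (X i w) - f0 (X i w)) ^+ 2 / s))%:E)%E.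
  by rewrite lee_fin; apply: sumr_ge0.
have [mA1 PA1] := markov_ge0 m1 q1 mM1 I1.
have [mA2 PA2] := markov_ge0 m2 q2 mM2 (I2 hI).
set A1 := [set w | _] in mA1 PA1; set A2 := [set w | _] in mA2 PA2.
exists (A1 `|` A2); split.
- exact: measurableU.
- apply: (le_trans (measureU2 _ mA1 mA2)).
  apply: (le_trans (leeD PA1 PA2)); rewrite -EFinD lee_fin.
  have -> : n%:R * C / (M * n%:R) + n%:R * (s * (C / 2 + 2)) / (M * (n%:R * s)) = (C + (C / 2 + 2)) / M.
    by field; rewrite !gt_eqF.
  rewrite ler_pM2r ?invr_gt0 // /C; move: C0; rewrite /C; lra.
- move=> w /not_orP[h1 h2]; split.
    by rewrite -lee_fin leNgt; apply/negP.
  by rewrite -lee_fin leNgt; apply/negP.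
Qed.

(** Deterministic, for a fixed outcome [w]: the bound on the weighted evidence makes both
    normalising constants finite, and optimality is used only against the test density [v0]. *)
Lemma vmass_le n k (eta zeta eps tau s S B rho0 : R) (th0 : 'I_(Kdim k p) -> R)
    (q : vpar R (Kdim k p)) w :
  let xs := fun i : 'I_n => X i w in
  let ys := fun i : 'I_n => f0 (X i w) + xi i w in
  let K := Kdim k p in
  0 < eta -> 0 < zeta -> 0 < eps -> 0 < tau -> 0 < s -> s <= 1 -> 0 <= S -> 0 <= B ->
  softplus rho0 = sigma0 -> (forall i, `|th0 i| <= B) ->
  (forall i, (i < n)%N -> cube p (X i w)) ->
  vfamily q ->
  (forall v, vfamily v -> (KL (vdens q) (posterior k eta zeta xs ys) <=
                          KL (vdens v) (posterior k eta zeta xs ys))%E) ->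
  (pint (fun (th : 'I_K -> R) rho => (lratio n th rho w * prior eta zeta th rho *
       expR (eps / 4 * n%:R * \1_(far f0 sigma0 eps) (th, rho)))%:E) <= (S + 2)%:E)%E ->
  eps / 4 * n%:R * fine (vmass_out f0 sigma0 (vdens q) eps) <=
  ln (S + 2) + (K%:R * ln (zeta / tau) + ln (eta / tau) +
       (\sum_i th0 i ^+ 2) / zeta ^+ 2 + rho0 ^+ 2 / eta ^+ 2) +
    Num.sqrt 2 * (4 * tau ^+ 2 / eta ^+ 2 + 2 * tau * n%:R +
      8 * tau * expR (8 * tau ^+ 2) * ((\sum_(i < n) xi i w ^+ 2) / (2 * sigma0 ^+ 2)) +
      expR (4 * tau ^+ 2) *
       ((\sum_(i < n) (s * xi i w ^+ 2 / 2 + 2 * (fnet th0 (X i w) - f0 (X i w)) ^+ 2 / s)) / sigma0 ^+ 2)) +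
    K%:R * (Num.sqrt 2 * (4 * tau ^+ 2 / zeta ^+ 2)) +
    K%:R * (8 * tau ^+ 2 * expR (4 * tau ^+ 2) *
      (n%:R * (2 * (k.+1%:R * (1 + p.+1%:R * B)) ^+ 2) / (s * sigma0 ^+ 2))).
Proof.
move=> xs ys K eta0 zeta0 eps0 tau0 s0 s1 S0 B0 hrho0 hB hc vq opt hev.
set A1 := _ / (2 * sigma0 ^+ 2); set A2 := _ / sigma0 ^+ 2; set A3 := _ / (s * _).
have s20 : 0 < sigma0 ^+ 2 by rewrite exprn_gt0.
have A10 : 0 <= A1.
  by apply: divr_ge0; [apply: sumr_ge0 => i _; exact: sqr_ge0|exact: mulr_ge0 _ (ltW s20)].
have A20 : 0 <= A2.
  apply: divr_ge0; last exact: ltW; apply: sumr_ge0 => i _.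
  by apply: addr_ge0; apply: divr_ge0; rewrite ?(ltW s0) //; apply: mulr_ge0; rewrite ?sqr_ge0 ?(ltW s0).
have A30 : 0 <= A3.
  apply: divr_ge0; last by rewrite mulr_ge0 ?ltW.
  by apply: mulr_ge0 => //; apply: mulr_ge0 => //; exact: sqr_ge0.
pose L (th : 'I_K -> R) rho := likelihood xs ys th rho.
have L0 th rho : 0 < L th rho by apply: prodr_gt0 => i _; exact: lmod_gt0.
set L00 := \prod_(i < n) ltrue f0 sigma0 (ys i) (xs i).
have L000 : 0 < L00 by apply: prodr_gt0 => i _; rewrite gdens_gt0.
have LE th rho : L th rho = L00 * lratio n th rho w.
  by rewrite -big_split; apply: eq_bigr => i _; rewrite /= mulrCA divff ?mulr1 // gt_eqF // gdens_gt0.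
pose v : vpar R K := (0, eta, (fun=> 0), (fun=> zeta)).
have vv : vfamily v by [].
pose U th rho := L th rho * prior eta zeta th rho.
have U0 th rho : 0 < U th rho by apply: mulr_gt0 => //; exact: (vdens_gt0 th rho vv).
have mpr : measurable_fun [set: measurableTypeR R * RI R 'I_K] (fun v => prior eta zeta v.2 v.1) := measurable_vdens vv.
have mlr : measurable_fun [set: measurableTypeR R * RI R 'I_K] (fun v => lratio n v.2 v.1 w).
  by apply: (measurable_lratio sigma0_gt0 mf0 mX mxi) => //; exact: measurable_om2.
have mU : measurable_fun [set: measurableTypeR R * RI R 'I_K] (fun v => U v.2 v.1).
  have mU' : measurable_fun [set: measurableTypeR R * RI R 'I_K]
     (fun v => L00 * lratio n v.2 v.1 w * prior eta zeta v.2 v.1).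
    by apply: measurable_funM => //; apply: measurable_funM.
  by apply: eq_measurable_fun mU' => u _; rewrite /U LE.
have t0 : 0 <= eps / 4 * n%:R by rewrite mulr_ge0 // divr_ge0 // ltW.
have mfar := measurable_far sigma0_gt0 mf0 (k := k) eps.
set Z' := pint _ in hev.
have m3 : measurable_fun [set: measurableTypeR R * RI R 'I_K] (fun v => (lratio n v.2 v.1 w * prior eta zeta v.2 v.1 *
       expR (eps / 4 * n%:R * \1_(far f0 sigma0 eps) (v.2, v.1)))%:E).
  apply/measurable_EFinP; apply: measurable_funM; first exact: measurable_funM.
  apply: (measurableT_comp (@measurable_expR R)); exact: measurable_funM.
have n3 (th : 'I_K -> R) rho : (0 <= (lratio n th rho w * prior eta zeta th rho *
       expR (eps / 4 * n%:R * \1_(far f0 sigma0 eps) (th, rho)))%:E)%E.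
  rewrite lee_fin mulr_ge0 ?expR_ge0 // mulr_ge0 // ltW ?lratio_gt0 //; exact: (vdens_gt0 th rho vv).
(* The likelihood is the true likelihood [L00] times the ratio. The [ln L00] that appears here
   cancels with the [- l0] of [kl_upper], as does [ln z] with the one in the posterior. *)
have ZE : (pint (fun th rho => (U th rho * expR (eps / 4 * n%:R * \1_(far f0 sigma0 eps) (th, rho)))%:E) =
    L00%:E * Z')%E.
  rewrite -(pintZ (ltW L000) m3 n3); congr pint; apply/funext => th; apply/funext => rho.
  by rewrite -EFinM /U LE !mulrA.
have Z'0 : (0 <= Z')%E by exact: pint_ge0.
have [z' z'E] : exists z', Z' = z'%:E.
  by exists (fine Z'); rewrite fineK // ge0_fin_numE // (le_lt_trans hev) ?ltry.
rewrite z'E lee_fin in hev.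
have Zoo : (pint (fun th rho => (U th rho * expR (eps / 4 * n%:R * \1_(far f0 sigma0 eps) (th, rho)))%:E) < +oo)%E.
  by rewrite ZE z'E -EFinM ltry.
have VL := variational_lower vq t0 mU U0 mfar Zoo.
rewrite ZE z'E -EFinM /= in VL.
set Z := pint (fun th rho => (U th rho)%:E) in VL.
have Zgt0 : (0 < Z)%E by exact: pint_gt0.
have Zle : (Z <= (L00 * z')%:E)%E.
  rewrite EFinM -z'E -ZE; apply: le_pint => th rho; rewrite lee_fin ler_peMr ?(ltW (U0 _ _)) //.
  by rewrite expR_ge1 // mulr_ge0.
have [z zE] : exists z, Z = z%:E.
  by exists (fine Z); rewrite fineK // (ge0_fin_numE (ltW Zgt0)) (le_lt_trans Zle) ?ltry.
rewrite zE /= lte_fin in Zgt0; rewrite zE lee_fin in Zle.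
have z'0 : 0 < z' by rewrite -(pmulr_rgt0 _ L000) (lt_le_trans Zgt0).
rewrite zE /= in VL.
pose v0 : vpar R K := (rho0, tau, th0, (fun=> tau)).
have vv0 : vfamily v0 by [].
have hc' (i : 'I_n) : cube p (xs i) by exact: hc.
have LL := loglik_lower f0 sigma0_gt0 (fun i : 'I_n => xi i w) s0 s1 B0 hrho0 hc' hB.
have KU := kl_upper (l0 := ln L00) (A0 := n%:R) eta0 zeta0 tau0 Zgt0 (ler0n _ _) A10 A20 A30 L0 LL.
have postE : posterior k eta zeta xs ys = (fun th rho => (U th rho / z)%R).
  by apply/funext => th; apply/funext => rho; rewrite /posterior -/(U _ _) -[pint _]/Z zE.
have := opt v0 vv0; rewrite postE => hopt.
have := le_trans VL (leeD (lexx _) (le_trans hopt KU)).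
rewrite -EFinD -[pint _]/(vmass_out f0 sigma0 (vdens q) eps).
have : (0 <= vmass_out f0 sigma0 (vdens q) eps)%E.
  by apply: pint_ge0 => th rho; rewrite lee_fin mulr_ge0 // ltW // vdens_gt0.
set m := vmass_out _ _ _ _ => m0.
(* In the case [m = +oo], [fine m] is zero and the inequality is trivial, so finiteness of the mass
   is not an issue. *)
have tm : ((eps / 4 * n%:R * fine m)%:E <= (eps / 4 * n%:R)%:E * m)%E.
  case: (m) m0 => [x| |] //= _.
  by rewrite mulr0 mule_ge0.
move=> /(le_trans tm); rewrite lee_fin => /le_trans; apply.
have : ln z' <= ln (S + 2) by rewrite ler_ln ?posrE //; lra.
rewrite (lnM L000 z'0) /K; lra.
Qed.

End posterior_bound.

(** * Rates *)

Section rates.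
Context {R : realType}.

Lemma exprn_le_expR (m : nat) (y : R) : 0 <= y -> y ^+ m <= m%:R ^+ m * expR y.
Proof.
move=> y0; case: m => [|m]; first by rewrite !expr0 mul1r expR_ge1.
have m0 : 0 < m.+1%:R :> R by rewrite ltr0n.
have -> : expR y = expR (y / m.+1%:R) ^+ m.+1 by rewrite -expRM_natl mulrC divfK // gt_eqF.
have h : y <= m.+1%:R * expR (y / m.+1%:R).
  rewrite mulrC -ler_pdivrMr //; by rewrite (le_trans _ (expR_ge1Dx _)) // lerDr.
by rewrite -exprMn ler_pXn2r // nnegrE // mulr_ge0 // expR_ge0.
Qed.

Lemma expRN_le_inv (y : R) : 0 < y -> expR (- y) <= y^-1.
Proof.
move=> y0; rewrite expRN lef_pV2 ?posrE ?expR_gt0 //.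
by apply: le_trans (expR_ge1Dx _); lra.
Qed.

Lemma ln_le_powR (g x : R) : 0 < g -> 0 < x -> ln x <= x `^ g / g.
Proof.
move=> g0 x0; rewrite ler_pdivlMr // mulrC -ln_powR.
have h : 0 < x `^ g by exact: powR_gt0.
by rewrite -[leRHS]lnK ?posrE //; apply: le_trans (expR_ge1Dx _); lra.
Qed.

Lemma powR_near_ge (g C : R) : 0 < g -> \forall n \near \oo, C <= n%:R `^ g.
Proof.
move=> g0; have [r hr] : exists r, 0 <= r /\ C <= r `^ g.
  exists (`|C| `^ g^-1); split; first exact: powR_ge0.
  by rewrite -powRrM mulVf ?gt_eqF // powRr1 // ler_norm.
case: hr => r0 hr; near=> n.
apply: (le_trans hr); apply: ge0_ler_powR; rewrite ?nnegrE //; first exact: ltW.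
by near: n; exact: nbhs_infty_ger.
Unshelve. all: by end_near. Qed.

(** The exponent has three terms and each is at most [kap], a third of the logarithm of the
    right-hand side. In the last one the side [exp(- 2 b)] squared against the precision [exp(2 b)]
    leaves [exp(- 2 b)]; the polynomial [b^6] costs [6^6 exp b], and the surviving [exp(- b)] is at
    most [1 / b]. *)
Lemma bracket_const_le (p k : nat) (b eps kap : R) :
  0 < eps -> kap = ln (1 + (eps / 4) ^+ 2) / 3 -> 1 <= b -> k.+1%:R <= 3 * b ^+ 2 ->
  2 / kap <= b ->
  9 * p.+2%:R ^+ 2 * 6 ^+ 6 * expR 2 / softplus 0 ^+ 2 / (2 * kap) / kap <= b ->
  expR (2 * expR (- (2 * b)) + kap +
     (expR (- (2 * b)) * (k.+1%:R * (1 + p.+1%:R * b))) ^+ 2 * expR (2 * expR (- (2 * b))) *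
     (expR (2 * b) / softplus 0 ^+ 2) / (2 * kap)) <= 1 + (eps / 4) ^+ 2.
Proof.
move=> eps0 kapE b1 kb h1 h2.
have b0 : 0 < b by lra.
have e40 : 0 < (eps / 4) ^+ 2 by rewrite exprn_gt0 // divr_gt0.
have kap0 : 0 < kap by rewrite kapE divr_gt0 // ln_gt0 // ltrDl.
rewrite -[leRHS]lnK ?posrE; last by rewrite addr_gt0.
have -> : ln (1 + (eps / 4) ^+ 2) = 3 * kap by rewrite kapE; field.
rewrite ler_expR.
have t1 : expR (- (2 * b)) <= b^-1.
  apply: (le_trans (expRN_le_inv _)); first lra.
  by rewrite lef_pV2 ?posrE //; lra.
have sp0 : 0 < softplus 0 ^+ 2 :> R by rewrite exprn_gt0 // softplus_gt0.
have a1 : 2 * expR (- (2 * b)) <= kap.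
  have : 2 * expR (- (2 * b)) <= 2 * b^-1 by rewrite ler_pM2l.
  move=> /le_trans; apply; rewrite ler_pdivrMr // mulrC -ler_pdivrMr //.
have e2 : expR (2 * expR (- (2 * b))) <= expR 2.
  rewrite ler_expR; have : expR (- (2 * b)) <= 1 by rewrite -[leRHS]expR0 ler_expR; lra.
  lra.
set C := 9 * _ ^+ 2 * 6 ^+ 6 * expR 2 / _ / _ in h2.
suff : (expR (- (2 * b)) * (k.+1%:R * (1 + p.+1%:R * b))) ^+ 2 * expR (2 * expR (- (2 * b))) *
     (expR (2 * b) / softplus 0 ^+ 2) / (2 * kap) <= C * expR (- b).
  have C0 : 0 < C.
    by rewrite /C !divr_gt0 ?mulr_gt0 ?expR_gt0 ?exprn_gt0 ?softplus_gt0.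
  have : C * expR (- b) <= C * b^-1 by rewrite ler_pM2l // expRN_le_inv.
  have : C * b^-1 <= kap by rewrite ler_pdivrMr // mulrC -ler_pdivrMr.
  lra.
have k0 : 0 <= k.+1%:R * (1 + p.+1%:R * b) by rewrite mulr_ge0 // addr_ge0 // mulr_ge0 // ltW.
have pb : k.+1%:R * (1 + p.+1%:R * b) <= 3 * p.+2%:R * b ^+ 3.
  have : 1 + p.+1%:R * b <= p.+2%:R * b by rewrite -[p.+2%:R]natr1 mulrDl mul1r; lra.
  move=> h; have := ler_pM _ _ kb h; rewrite ler0n addr_ge0 ?mulr_ge0 ?(ltW b0) //.
  move=> /(_ isT isT) /le_trans; apply; rewrite le_eqVlt; apply/orP; left; apply/eqP; ring.
have q2 : (k.+1%:R * (1 + p.+1%:R * b)) ^+ 2 <= 9 * p.+2%:R ^+ 2 * (6 ^+ 6 * expR b).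
  have : (k.+1%:R * (1 + p.+1%:R * b)) ^+ 2 <= (3 * p.+2%:R * b ^+ 3) ^+ 2.
    by rewrite ler_pXn2r ?nnegrE // (le_trans k0).
  move=> /le_trans; apply.
  have -> : (3 * p.+2%:R * b ^+ 3) ^+ 2 = 9 * p.+2%:R ^+ 2 * b ^+ 6 by ring.
  by rewrite ler_wpM2l ?mulr_ge0 ?sqr_ge0 // exprn_le_expR // ltW.
have -> : (expR (- (2 * b)) * (k.+1%:R * (1 + p.+1%:R * b))) ^+ 2 * expR (2 * expR (- (2 * b))) *
     (expR (2 * b) / softplus 0 ^+ 2) / (2 * kap) =
   (k.+1%:R * (1 + p.+1%:R * b)) ^+ 2 * expR (2 * expR (- (2 * b))) *
   ((expR (- (2 * b)) ^+ 2 * expR (2 * b)) / softplus 0 ^+ 2 / (2 * kap)) by field; rewrite !gt_eqF // softplus_gt0.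
have -> : expR (- (2 * b)) ^+ 2 * expR (2 * b) = expR (- b) ^+ 2.
  by rewrite -!expRM_natl -expRD; congr expR; ring.
have q3 : (k.+1%:R * (1 + p.+1%:R * b)) ^+ 2 * expR (2 * expR (- (2 * b))) <=
   9 * p.+2%:R ^+ 2 * (6 ^+ 6 * expR b) * expR 2.
  by apply: ler_pM => //; rewrite ?sqr_ge0 ?expR_ge0.
have w0 : 0 <= expR (- b) ^+ 2 / softplus 0 ^+ 2 / (2 * kap).
  by rewrite !divr_ge0 ?sqr_ge0 ?mulr_ge0 ?(ltW kap0).
apply: (le_trans (ler_wpM2r w0 q3)).
have eb : expR b * expR (- b) = 1 by rewrite -expRD subrr expR0.
rewrite /C le_eqVlt; apply/orP; left; apply/eqP.
transitivity (9 * p.+2%:R ^+ 2 * 6 ^+ 6 * expR 2 / softplus 0 ^+ 2 / (2 * kap) * expR (- b) * (expR b * expR (- b))).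
  ring.
by rewrite eb mulr1.
Qed.

(** The grid has at most [2 b exp(2 b) + 1] cells per axis, and [1 + 2 b <= exp(2 b)]. *)
Lemma grid_size_le (b : R) : 0 <= b -> (grid_size b (expR (- (2 * b)))).+1%:R <= expR (4 * b).
Proof.
move=> b0; rewrite /grid_size expRN invrK -natr1.
have z0 : 0 <= 2 * b * expR (2 * b) by rewrite !mulr_ge0 // expR_ge0.
have /andP[h _] := truncn_itv z0.
have -> : expR (4 * b) = expR (2 * b) * expR (2 * b) by rewrite -expRD; congr expR; ring.
have e1 : 1 <= expR (2 * b) by rewrite expR_ge1 // mulr_ge0.
have e2 := expR_ge1Dx (2 * b).
have e0 : 0 <= expR (2 * b) by lra.
have := ler_wpM2l e0 e2; lra.
Qed.

Lemma prior_mass_rate (K n : nat) (eps kp b C pr : R) : (0 < n)%N -> 0 < pr ->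
  (eps / 4 + 1) * n%:R <= kp * b ^+ 2 -> K.+1%:R <= C * n%:R ->
  4 * C * Num.sqrt 2 / pr <= n%:R ->
  expR (eps / 4 * n%:R) * (K.+1%:R * (expR (- (kp * b ^+ 2)) * Num.sqrt 2)) <= pr.
Proof.
move=> n0 pr0 hb hK hn; set y := n%:R in hb hK hn *.
have y0 : 0 < y by rewrite ltr0n.
have s2 : 0 <= Num.sqrt 2 :> R by exact: sqrtr_ge0.
have -> : expR (eps / 4 * y) * (K.+1%:R * (expR (- (kp * b ^+ 2)) * Num.sqrt 2)) =
  K.+1%:R * Num.sqrt 2 * (expR (eps / 4 * y) * expR (- (kp * b ^+ 2))) by ring.
rewrite -expRD.
have h1 : expR (eps / 4 * y - kp * b ^+ 2) <= expR (- y) by rewrite ler_expR; lra.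
have h2 : y * expR (- y) <= 4 / y.
  rewrite ler_pdivlMr // mulrAC -expr2 expRN ler_pdivrMr ?expR_gt0 //.
  have := exprn_le_expR 2 (ltW y0); lra.
have h3 : K.+1%:R * Num.sqrt 2 * expR (- y) <= C * Num.sqrt 2 * (y * expR (- y)).
  have := ler_wpM2r s2 hK; have e0 := expR_ge0 (- y).
  move=> /(ler_wpM2r e0) /le_trans; apply; rewrite le_eqVlt; apply/orP; left; apply/eqP; ring.
have C0 : 0 <= C.
  have : 0 <= C * y by apply: le_trans hK; exact: ler0n.
  by rewrite pmulr_lge0.
have h4 : C * Num.sqrt 2 * (y * expR (- y)) <= C * Num.sqrt 2 * (4 / y) by rewrite ler_wpM2l // mulr_ge0.
have h5 : C * Num.sqrt 2 * (4 / y) <= pr.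
  rewrite mulrA ler_pdivrMr // [pr * y]mulrC -ler_pdivrMr //.
  by apply: le_trans hn; rewrite le_eqVlt; apply/orP; left; apply/eqP; ring.
have h6 : K.+1%:R * Num.sqrt 2 * expR (eps / 4 * y - kp * b ^+ 2) <= K.+1%:R * Num.sqrt 2 * expR (- y).
  by rewrite ler_wpM2l // mulr_ge0.
lra.
Qed.

(** The log-number of cells may use half of the exponent [eps n / 8]; the other half tends to
    infinity. *)
Lemma covering_rate (K n : nat) (eps b pr : R) : (0 < n)%N -> 0 < pr -> 0 < eps -> 0 <= b ->
  4 * b * K.+1%:R <= eps / 16 * n%:R -> 16 / eps / pr <= n%:R ->
  ((grid_size b (expR (- (2 * b)))).+1 ^ K.+1)%:R * expR (- (eps / 8 * n%:R)) <= pr.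
Proof.
move=> n0 pr0 eps0 b0 hb hn.
have y0 : 0 < n%:R :> R by rewrite ltr0n.
have g := grid_size_le b0.
have h1 : ((grid_size b (expR (- (2 * b)))).+1 ^ K.+1)%:R <= expR (eps / 16 * n%:R).
  rewrite natrX; apply: (@le_trans _ _ (expR (4 * b) ^+ K.+1)).
    by rewrite ler_pXn2r ?nnegrE ?expR_ge0.
  by rewrite -expRM_natl ler_expR mulrC.
have h2 := ler_wpM2r (expR_ge0 (- (eps / 8 * n%:R))) h1.
apply: (le_trans h2); rewrite -expRD.
have -> : eps / 16 * n%:R + - (eps / 8 * n%:R) = - (eps / 16 * n%:R) by field.
have e0 : 0 < eps / 16 * n%:R by rewrite mulr_gt0 // divr_gt0.
apply: (le_trans (expRN_le_inv e0)).
rewrite -[leRHS]invrK lef_pV2 ?posrE ?invr_gt0 //.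
have -> : pr^-1 = 16 / eps / pr * (eps / 16) by field; rewrite !gt_eqF.
by rewrite [leRHS]mulrC ler_wpM2r // divr_ge0 // ltW.
Qed.

End rates.

Section elbo.
Context {R : realType}.

(** [y] is [n]. The exponent [3] of [tau] comes from the Lipschitz term: [K], [n], [k^2], the
    squared bound [sqrt n] on the parameters and [1 / s] contribute at most
    [y^(1 + 1 + 2 + 1 + 1) = y^6], which [tau^2] cancels exactly. Adding [1 / y] to [D] in [s]
    serves for [1 / s <= y] and adds only one to [y s]. *)
Lemma elbo_rate (p k K : nat) (y D s tau M S eta zeta sigma0 rho0 C V S1 S2 : R) :
  0 < eta -> 0 < zeta -> 0 < sigma0 -> 1 <= y -> 0 <= C -> K%:R <= C * y -> k.+1%:R <= 3 * y ->
  0 <= D -> s = D + y^-1 -> tau = (y ^+ 3)^-1 -> 0 <= M ->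
  0 <= S1 -> S1 <= M * y -> 0 <= S2 -> S2 <= M * (y * s) ->
  ln (S + 2) + (K%:R * ln (zeta / tau) + ln (eta / tau) + V / zeta ^+ 2 + rho0 ^+ 2 / eta ^+ 2) +
    Num.sqrt 2 * (4 * tau ^+ 2 / eta ^+ 2 + 2 * tau * y +
      8 * tau * expR (8 * tau ^+ 2) * (S1 / (2 * sigma0 ^+ 2)) +
      expR (4 * tau ^+ 2) * (S2 / sigma0 ^+ 2)) +
    K%:R * (Num.sqrt 2 * (4 * tau ^+ 2 / zeta ^+ 2)) +
    K%:R * (8 * tau ^+ 2 * expR (4 * tau ^+ 2) *
      (y * (2 * (k.+1%:R * (1 + p.+1%:R * Num.sqrt y)) ^+ 2) / (s * sigma0 ^+ 2))) <=
  (ln (S + 2) + `|ln eta| + rho0 ^+ 2 / eta ^+ 2 +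
   Num.sqrt 2 * (4 / eta ^+ 2 + 2 + 8 * expR 8 * (M / (2 * sigma0 ^+ 2)) + expR 4 * (M / sigma0 ^+ 2)) +
   C * (144 * expR 4 * p.+2%:R ^+ 2 / sigma0 ^+ 2)) +
  K%:R * (`|ln zeta| + Num.sqrt 2 * (4 / zeta ^+ 2) + 3 * ln y) + 3 * ln y + V / zeta ^+ 2 +
  Num.sqrt 2 * (expR 4 * (M / sigma0 ^+ 2)) * (y * D).
Proof.
move=> eta0 zeta0 sig0 y1 C0 hK hk D0 sE tauE M0 S10 S1M S20 S2M.
have y0 : 0 < y by lra.
have y30 : 0 < y ^+ 3 by rewrite exprn_gt0.
have tau0 : 0 < tau by rewrite tauE invr_gt0.
have ty : tau * y <= 1.
  rewrite tauE mulrC ler_pdivrMr // mul1r -[leLHS]expr1; exact: ler_weXn2l.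
have t1 : tau <= 1 by rewrite (le_trans _ ty) // ler_peMr // ltW.
have t20 : 0 <= tau ^+ 2 by exact: sqr_ge0.
have t21 : tau ^+ 2 <= 1 by rewrite expr_le1 // ltW.
have e2 : 0 < eta ^+ 2 by rewrite exprn_gt0.
have z2 : 0 < zeta ^+ 2 by rewrite exprn_gt0.
have s2 : 0 < sigma0 ^+ 2 by rewrite exprn_gt0.
have q0 : 0 <= Num.sqrt 2 :> R by exact: sqrtr_ge0.
have lt x : 0 < x -> ln (x / tau) = ln x + 3 * ln y.
  by move=> x0; rewrite ln_div ?posrE // tauE lnV ?posrE // lnXn // opprK mulr_natl.
rewrite (lt _ eta0) (lt _ zeta0).
have ly : 0 <= ln y by exact: ln_ge0.
have K0 : 0 <= K%:R :> R by exact: ler0n.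
have f1 : 4 * tau ^+ 2 / eta ^+ 2 <= 4 / eta ^+ 2 by rewrite ler_pM2r ?invr_gt0 //; lra.
have f2 : 2 * tau * y <= 2 by lra.
have eb c : 0 <= c -> expR (c * tau ^+ 2) <= expR c by move=> c0; rewrite ler_expR ler_piMr.
have f3 : 8 * tau * expR (8 * tau ^+ 2) * (S1 / (2 * sigma0 ^+ 2)) <= 8 * expR 8 * (M / (2 * sigma0 ^+ 2)).
  have -> : 8 * tau * expR (8 * tau ^+ 2) * (S1 / (2 * sigma0 ^+ 2)) =
     8 * expR (8 * tau ^+ 2) * (tau * S1) / (2 * sigma0 ^+ 2) by ring.
  rewrite [leRHS]mulrA ler_pM2r ?invr_gt0 ?mulr_gt0 //.
  apply: ler_pM; rewrite ?mulr_ge0 ?expR_ge0 ?(ltW tau0) //; first by rewrite ler_pM2l ?eb.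
  apply: (@le_trans _ _ (tau * (M * y))); first by rewrite ler_pM2l.
  by rewrite mulrCA -[leRHS]mulr1 ler_wpM2l.
have ys : y * s = y * D + 1 by rewrite sE mulrDr mulfV // gt_eqF.
have f4 : expR (4 * tau ^+ 2) * (S2 / sigma0 ^+ 2) <= expR 4 * (M / sigma0 ^+ 2) * (y * D + 1).
  have -> : expR 4 * (M / sigma0 ^+ 2) * (y * D + 1) = expR 4 * (M * (y * s) / sigma0 ^+ 2).
    by rewrite ys; ring.
  apply: ler_pM; rewrite ?expR_ge0 ?eb // ?divr_ge0 ?(ltW s2) //.
  by rewrite ler_pM2r ?invr_gt0.
have f34 := ler_wpM2l q0 (lerD (lerD (lerD f1 f2) f3) f4).
have f5 : K%:R * (Num.sqrt 2 * (4 * tau ^+ 2 / zeta ^+ 2)) <= K%:R * (Num.sqrt 2 * (4 / zeta ^+ 2)).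
  by rewrite ler_wpM2l // ler_wpM2l // ler_pM2r ?invr_gt0 //; lra.
have f6 : K%:R * (8 * tau ^+ 2 * expR (4 * tau ^+ 2) *
      (y * (2 * (k.+1%:R * (1 + p.+1%:R * Num.sqrt y)) ^+ 2) / (s * sigma0 ^+ 2))) <=
   C * (144 * expR 4 * p.+2%:R ^+ 2 / sigma0 ^+ 2).
  have sy1 : 1 <= Num.sqrt y by rewrite -[leLHS]sqrtr1 ler_wsqrtr.
  have g1 : 1 + p.+1%:R * Num.sqrt y <= p.+2%:R * Num.sqrt y.
    by rewrite -[p.+2%:R]natr1 mulrDl mul1r addrC lerD2l.
  have g0 : 0 <= 1 + p.+1%:R * Num.sqrt y by rewrite addr_ge0 // mulr_ge0 ?sqrtr_ge0.
  have g2 : (k.+1%:R * (1 + p.+1%:R * Num.sqrt y)) ^+ 2 <= 9 * p.+2%:R ^+ 2 * y ^+ 3.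
    apply: (@le_trans _ _ ((3 * y * (p.+2%:R * Num.sqrt y)) ^+ 2)).
      rewrite ler_pXn2r ?nnegrE ?mulr_ge0 ?sqrtr_ge0 ?(ltW y0) //.
      by apply: ler_pM.
    have -> : (3 * y * (p.+2%:R * Num.sqrt y)) ^+ 2 = 9 * p.+2%:R ^+ 2 * y ^+ 2 * Num.sqrt y ^+ 2 by ring.
    by rewrite sqr_sqrtr ?(ltW y0) // -[leLHS]mulrA -exprSr.
  have s0 : 0 < s by rewrite sE ltr_wpDl // invr_gt0.
  have si : s^-1 <= y by rewrite -[leRHS]invrK lef_pV2 ?posrE ?invr_gt0 // sE lerDr.
  have g3 : y * (2 * (k.+1%:R * (1 + p.+1%:R * Num.sqrt y)) ^+ 2) / (s * sigma0 ^+ 2) <=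
     18 * p.+2%:R ^+ 2 * y ^+ 5 / sigma0 ^+ 2.
    rewrite invfM mulrA ler_pM2r ?invr_gt0 //.
    have -> : 18 * p.+2%:R ^+ 2 * y ^+ 5 = y * (2 * (9 * p.+2%:R ^+ 2 * y ^+ 3)) * y by ring.
    apply: ler_pM => //; rewrite ?invr_ge0 ?(ltW s0) //.
      by rewrite mulr_ge0 ?(ltW y0) // mulr_ge0 // sqr_ge0.
    by rewrite ler_pM2l // ler_pM2l.
  have g4 : 8 * tau ^+ 2 * expR (4 * tau ^+ 2) <= 8 * tau ^+ 2 * expR 4.
    by apply: ler_wpM2l; [exact: mulr_ge0|exact: eb].
  apply: (@le_trans _ _ (C * y * (8 * tau ^+ 2 * expR 4 * (18 * p.+2%:R ^+ 2 * y ^+ 5 / sigma0 ^+ 2)))).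
    have u1 : 0 <= 8 * tau ^+ 2 * expR (4 * tau ^+ 2) by rewrite mulr_ge0 ?expR_ge0 // mulr_ge0.
    have u2 : 0 <= y * (2 * (k.+1%:R * (1 + p.+1%:R * Num.sqrt y)) ^+ 2) / (s * sigma0 ^+ 2).
      apply: divr_ge0; last by rewrite mulr_ge0 // ltW.
      by apply: mulr_ge0; [exact: ltW|rewrite mulr_ge0 // sqr_ge0].
    apply: ler_pM => //; first exact: mulr_ge0.
    exact: ler_pM.
  rewrite tauE le_eqVlt; apply/orP; left; apply/eqP; field.
  by rewrite !gt_eqF.
have l1 := ler_norm (ln eta).
have l2 := ler_wpM2l K0 (ler_norm (ln zeta)).
move: f34 f5 f6; set Q := Num.sqrt 2.
move: (4 * tau ^+ 2 / eta ^+ 2 + _ + _ + _) (K%:R * (8 * _ * _ * _)) (K%:R * (Q * (4 * _ / _))).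
move=> W1 W2 W3.
set E8 := 8 * expR 8 * _; set E4 := expR 4 * (M / _).
lra.
Qed.

(** To be read with [u = n^a], [v = n^g], [w = n^(1 - delta)], [z = n^delta] and [l = ln n]. Each of
    four groups gets a quarter of [c1 w]. In the group of [K ln n], one factor [v] bounds the
    logarithm and the second, still free in [w = u v v], absorbs the constants. *)
Lemma rate_sum (C0 C C5 c6 g c1 u v w z y K l V D : R) :
  1 <= u -> 1 <= v -> w = u * v * v -> z * w = y -> 0 < g -> 0 <= K -> K <= C * u ->
  0 <= c6 -> 0 <= l -> l <= v / g -> C0 <= c1 / 4 * w -> C * (c6 + 3 / g) + 3 / g <= c1 / 4 * v ->
  V <= c1 / 4 * w -> C5 * (z * D) <= c1 / 4 ->
  C0 + K * (c6 + 3 * l) + 3 * l + V + C5 * (y * D) <= c1 * w.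
Proof.
move=> u1 v1 wE zw g0 K0 hK c60 l0 hl h1 h2 h3 h4.
have u0 : 0 < u by lra.
have v0 : 0 < v by lra.
have w0 : 0 < w by rewrite wE !mulr_gt0.
have h4' : C5 * (y * D) <= c1 / 4 * w.
  have := ler_wpM2r (ltW w0) h4; rewrite -zw; lra.
have uv0 : 0 <= u * v by rewrite mulr_ge0 ?ltW.
have h2' := ler_wpM2l uv0 h2.
have hc : c6 + 3 * l <= v * (c6 + 3 / g).
  have : c6 <= v * c6 by rewrite ler_peMl.
  have -> : v * (c6 + 3 / g) = v * c6 + 3 * (v / g) by ring.
  lra.
have a1 : K * (c6 + 3 * l) <= C * u * (v * (c6 + 3 / g)).
  by apply: ler_pM => //; rewrite addr_ge0 // mulr_ge0.
have a2 : 3 * l <= u * (3 * (v / g)).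
  apply: (@le_trans _ _ (3 * (v / g))); first lra.
  by rewrite ler_peMl // mulr_ge0 // divr_ge0 ?ltW.
have -> : c1 * w = c1 / 4 * w + u * v * (c1 / 4 * v) + c1 / 4 * w + c1 / 4 * w by rewrite wE; field.
have : u * v * (C * (c6 + 3 / g) + 3 / g) = C * u * (v * (c6 + 3 / g)) + u * (3 * (v / g)) by ring.
lra.
Qed.

End elbo.

(** * Choice of the constants and conclusion *)

Lemma natr_Kdim (R : realType) (k p : nat) : (Kdim k p)%:R = k%:R * p.+2%:R + 1 :> R.
Proof. by rewrite /Kdim -natr1 natrM addn2. Qed.

Unset Implicit Arguments.

Theorem theorem4
  (R : realType) (d : measure_display) (Omega : measurableType d)
  (P : probability Omega R)
  (p : nat) (f0 : ('I_p -> R) -> R) (sigma0 eta zeta : R)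
  (X : nat -> Omega -> 'I_p -> R) (xi : nat -> Omega -> R)
  (k : nat -> nat) (a delta : R)
  (theta0 : forall n : nat, 'I_(Kdim (k n) p) -> R)
  (qstar : forall n : nat, ('I_n -> 'I_p -> R) -> ('I_n -> R) -> vpar R (Kdim (k n) p)) :
  (* noise scale and prior hyperparameters *)
  0 < sigma0 -> 0 < eta -> 0 < zeta ->
  (* f0 is square integrable on [0,1]^p *)
  (forall B : set R, measurable B -> Rp_measurable p (f0 @^-1` B)) ->
  (iint (fun x => (\1_(cube p) x * f0 x ^+ 2)%:E) < +oo)%E ->
  (* data: x_i ~ Uniform[0,1]^p, xi_i ~ N(0, sigma0^2), all independent *)
  (forall i h, measurable_fun [set: Omega] (fun w => X i w h)) ->
  (forall i, measurable_fun [set: Omega] (xi i)) ->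
  mutually_independent P
    (fun ih : nat * option 'I_p =>
       match ih.2 with Some h => fun w => X ih.1 w h | None => xi ih.1 end) ->
  (forall i h (B : set R), measurable B ->
     P ((fun w => X i w h) @^-1` B) = lebesgue_measure (B `&` `[0%R, 1%R])) ->
  (forall i (B : set R), measurable B -> P (xi i @^-1` B) = normal_prob 0 sigma0 B) ->
  (* k_n ~ n^a, a in (0, 1/2) *)
  0 < a < 1 / 2 ->
  (fun n : nat => (k n)%:R / n%:R `^ a) @ \oo --> (1 : R) ->
  0 <= delta < 1 - a ->
  (* (A1) *)
  (fun n : nat => n%:R `^ delta * l2dist (fnet (theta0 n)) f0) @ \oo --> (0 : R) ->
  (* (A2) *)
  (fun n : nat => (\sum_(i < Kdim (k n) p) theta0 n i ^+ 2) / n%:R `^ (1 - delta))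
     @ \oo --> (0 : R) ->
  (* qstar selects the KL-minimiser pi^* over the mean-field Gaussian family *)
  (forall n xs ys,
     vfamily (qstar n xs ys) /\
     forall v : vpar R (Kdim (k n) p), vfamily v ->
       (KL (vdens (qstar n xs ys)) (posterior (k n) eta zeta xs ys)
        <= KL (vdens v) (posterior (k n) eta zeta xs ys))%E) ->
  forall eps : R, 0 < eps ->
    small_o_P P
      (fun n w => fine (vmass_out f0 sigma0
         (vdens (qstar n (fun i : 'I_n => X i w)
                         (fun i : 'I_n => f0 (X i w) + xi i w))) eps))
      (fun n => n%:R `^ (- delta)).
Proof.
move=> sigma0_gt0 eta0 zeta0 mf0 sqf0 mX mxi indZ lawX lawxi /andP[a0 a12] hk /andP[d0 da]
  hA1 hA2 hq eps eps0 c pr c0 pr0.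
have indZ' : mutually_independent P (coords X xi) := indZ.
have [rho0 hrho0] := softplus_surj sigma0_gt0.
pose kp := (4 * (eta ^+ 2 + zeta ^+ 2))^-1.
have e20 : 0 < eta ^+ 2 by rewrite exprn_gt0.
have z20 : 0 < zeta ^+ 2 by rewrite exprn_gt0.
have ez0 : 0 < 4 * (eta ^+ 2 + zeta ^+ 2) by rewrite mulr_gt0 // addr_gt0.
have kp0 : 0 < kp by rewrite invr_gt0.
have he : kp * (4 * eta ^+ 2) <= 1 by rewrite /kp mulrC ler_pdivrMr // mul1r ler_pM2l // lerDl ltW.
have hz : kp * (4 * zeta ^+ 2) <= 1 by rewrite /kp mulrC ler_pdivrMr // mul1r ler_pM2l // lerDr ltW.
(* [M1] is the factor in the half-width [M1 sqrt n] of the box: the prior tail must beat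
   [exp(n eps / 4)] and still leave [exp(- n)]. With [r] the quotient, [(1 + r)^2 >= r]. *)
have [M1 [M11 hM]] : exists M1, 1 <= M1 /\ eps / 4 + 1 <= kp * M1 ^+ 2.
  have e0 : 0 <= (eps / 4 + 1) / kp by apply: divr_ge0; [lra|exact: ltW].
  exists (1 + (eps / 4 + 1) / kp); split; first by rewrite lerDl.
  set r := _ / kp in e0 *; have -> : eps / 4 + 1 = kp * r by rewrite /r; field; rewrite gt_eqF.
  apply: ler_wpM2l; first exact: ltW.
  have := sqr_ge0 r; lra.
have [kap kapE] : exists r, r = ln (1 + (eps / 4) ^+ 2) / 3 by eexists.
have kap0 : 0 < kap by rewrite kapE divr_gt0 // ln_gt0 // ltrDl exprn_gt0 // divr_gt0.
(* [S] and [M] are chosen so that the level of the evidence and the noise event cost [pr / 8] each;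
   with the prior tail and the covering the total is [pr / 2]. *)
have [S SE] : exists r, r = 8 / pr by eexists.
have S0 : 0 < S by rewrite SE divr_gt0.
have [CN CNE] : exists r, r = 12 * sigma0 ^+ 2 * Num.sqrt 2 + 2 by eexists.
have CN0 : 0 < CN by rewrite CNE ltr_wpDl // mulr_ge0 ?sqrtr_ge0 // mulr_ge0 // sqr_ge0.
have [M ME] : exists r, r = CN * 8 / pr by eexists.
have M0 : 0 < M by rewrite ME divr_gt0 // mulr_gt0.
have [C CE] : exists r : R, r = 2 * p.+2%:R + 2 by eexists.
have C2 : 2 <= C by rewrite CE lerDr mulr_ge0.
have C00 : 0 <= C := le_trans (ler0n _ 2) C2.
(* Half of the gap between [a] and [1 - delta], so that [n^(1 - delta) = n^a n^g n^g]. *)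
have [g gE] : exists r, r = (1 - delta - a) / 2 by eexists.
have g0 : 0 < g by rewrite gE; clear -da; lra.
(* With [t = n eps / 4], the bound [t m <= c1 n^(1 - delta)] amounts to [m n^delta <= c]. *)
have [c1 c1E] : exists r, r = c * eps / 4 by eexists.
have c10 : 0 < c1 by rewrite c1E divr_gt0 // mulr_gt0.
pose C0 := ln (S + 2) + `|ln eta| + rho0 ^+ 2 / eta ^+ 2 +
   Num.sqrt 2 * (4 / eta ^+ 2 + 2 + 8 * expR 8 * (M / (2 * sigma0 ^+ 2)) + expR 4 * (M / sigma0 ^+ 2)) +
   C * (144 * expR 4 * p.+2%:R ^+ 2 / sigma0 ^+ 2).
pose c6 := `|ln zeta| + Num.sqrt 2 * (4 / zeta ^+ 2).
have c60 : 0 <= c6 by rewrite addr_ge0 // mulr_ge0 ?sqrtr_ge0 // divr_ge0 // ltW.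
pose C5 := Num.sqrt 2 * (expR 4 * (M / sigma0 ^+ 2)).
have C50 : 0 <= C5.
  by rewrite mulr_ge0 ?sqrtr_ge0 // mulr_ge0 ?expR_ge0 // divr_ge0 ?(ltW M0) // sqr_ge0.
have C51 : 0 < C5 + 1 by exact: ltr_wpDl.
(* The bound [1 / 2] keeps [s = D + 1 / n] at most one as soon as [n >= 2]; the other one fits the
   approximation term into its quarter. *)
have [kD [kD0 kD1 kD2]] : exists r, [/\ 0 < r, r <= 1 / 2 & r <= c1 / 4 / (C5 + 1)].
  exists (Num.min (1 / 2) (c1 / 4 / (C5 + 1))); split; last 2 first.
  - by rewrite ge_min lexx.
  - by rewrite ge_min lexx orbT.
  by rewrite lt_min; apply/andP; split; [exact: divr_gt0|exact: divr_gt0 (divr_gt0 c10 _) C51].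
have [kV [kV0 kV1 kV2]] : exists r, [/\ 0 < r, r <= 1 & r <= c1 / 4 * zeta ^+ 2].
  exists (Num.min 1 (c1 / 4 * zeta ^+ 2)); split; last 2 first.
  - by rewrite ge_min lexx.
  - by rewrite ge_min lexx orbT.
  by rewrite lt_min ltr01 mulr_gt0 // divr_gt0.
have g12 : 0 < 1 / 2 - a by rewrite subr_gt0.
have d1 : 0 < 1 - delta by clear -a0 da; lra.
have h12 : 0 < 1 / 2 :> R by exact: divr_gt0.
have nk : \forall n \near \oo, (k n)%:R / n%:R `^ a <= 2 :> R.
  by move/cvgr_le : hk; apply; rewrite ltr1n.
have nD : \forall n \near \oo, n%:R `^ delta * l2dist (fnet (theta0 n)) f0 <= kD.
  by move/cvgr_le : hA1; exact.
have nV : \forall n \near \oo,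
    (\sum_(i < Kdim (k n) p) theta0 n i ^+ 2) / n%:R `^ (1 - delta) <= kV.
  by move/cvgr_le : hA2; exact.
near=> n.
have n2 : 2 <= n%:R :> R by near: n; exact: nbhs_infty_ger.
have fk : (k n)%:R / n%:R `^ a <= 2 :> R by near: n.
have fD : n%:R `^ delta * l2dist (fnet (theta0 n)) f0 <= kD by near: n.
have fV : (\sum_(i < Kdim (k n) p) theta0 n i ^+ 2) / n%:R `^ (1 - delta) <= kV by near: n.
have f1 : 2 / kap <= n%:R `^ (1 / 2) by near: n; exact: powR_near_ge.
have f2 : 9 * p.+2%:R ^+ 2 * 6 ^+ 6 * expR 2 / softplus 0 ^+ 2 / (2 * kap) / kap <= n%:R `^ (1 / 2).
  by near: n; exact: powR_near_ge.
have f3 : 4 * C * Num.sqrt 2 / (pr / 8) <= n%:R by near: n; exact: nbhs_infty_ger.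
have f4 : 16 / eps / (pr / 8) <= n%:R by near: n; exact: nbhs_infty_ger.
have f5 : 4 * M1 * C * 16 / eps <= n%:R `^ (1 / 2 - a) by near: n; exact: powR_near_ge.
have f6 : C0 / (c1 / 4) <= n%:R `^ (1 - delta) by near: n; exact: powR_near_ge.
have f7 : (C * (c6 + 3 / g) + 3 / g) / (c1 / 4) <= n%:R `^ g by near: n; exact: powR_near_ge.
have n1 : 1 <= n%:R :> R by clear -n2; lra.
have y0 : 0 < n%:R :> R by clear -n2; lra.
have n0 : (0 < n)%N by rewrite -(ltr0n R).
set y : R := n%:R in n2 n1 y0.
have yne : y != 0 by rewrite gt_eqF.
pose u := y `^ a; pose v := y `^ g; pose z := y `^ delta; pose w := y `^ (1 - delta).
have pge1 r : 0 <= r -> 1 <= y `^ r.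
  by move=> r0; rewrite -(powRr0 y); apply: ler_powR.
have u1 : 1 <= u by apply: pge1; exact: ltW.
have v1 : 1 <= v by apply: pge1; exact: ltW.
have z1 : 1 <= z by apply: pge1.
have w1 : 1 <= w by apply: pge1; exact: ltW.
have padd r t : y `^ (r + t) = y `^ r * y `^ t by apply: powRD; rewrite yne implybT.
have wE : w = u * v * v by rewrite /u /v -!padd; congr (_ `^ _); rewrite gE; field.
have zw : z * w = y by rewrite -padd addrC subrK powRr1 // ltW.
have wy : w <= y by rewrite -zw ler_peMl // (le_trans _ w1).
have uy : u <= y.
  by rewrite -[leRHS](powRr1 (ltW y0)); apply: ler_powR => //; clear -a12; lra.
have ku : (k n)%:R <= 2 * u.
  rewrite -ler_pdivrMr; last by rewrite /u powR_gt0.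
  exact: fk.
set D := l2dist (fnet (theta0 n)) f0.
have D0 : 0 <= D by exact: sqrtr_ge0.
have zD : z * D <= kD := fD.
have hV : \sum_(i < Kdim (k n) p) theta0 n i ^+ 2 <= kV * w.
  rewrite -ler_pdivrMr; last by rewrite /w powR_gt0.
  exact: fV.
set V := \sum_(i < _) _ in hV.
have D12 : D <= 1 / 2.
  by apply: (@le_trans _ _ (z * D)); [rewrite ler_peMl|exact: le_trans zD kD1].
pose s := D + y^-1.
have s0 : 0 < s by rewrite ltr_wpDl // invr_gt0.
have s1 : s <= 1.
  have : y^-1 <= 1 / 2 by rewrite div1r lef_pV2 ?posrE.
  by rewrite /s; clear -D12; lra.
pose b := M1 * Num.sqrt y.
have sy1 : 1 <= Num.sqrt y by rewrite -[leLHS]sqrtr1 ler_wsqrtr.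
have b_sqrt : Num.sqrt y <= b by rewrite /b ler_peMl // sqrtr_ge0.
have b1 : 1 <= b by exact: le_trans b_sqrt.
have bb : b ^+ 2 = M1 ^+ 2 * y by rewrite /b exprMn sqr_sqrtr // ltW.
have yb : y <= b ^+ 2 by rewrite bb ler_peMl ?(ltW y0) // exprn_ege1.
have large Cc : Cc <= Num.sqrt y -> Cc <= b by move=> h; exact: le_trans b_sqrt.
have hk3 : (k n).+1%:R <= 3 * y by rewrite -natr1; clear -ku uy n1; lra.
have sqrtE : y `^ (1 / 2) = Num.sqrt y by rewrite div1r powR12_sqrt // ltW.
have hU := bracket_const_le (p := p) (k := k n) (b := b) eps0 kapE b1.
have {}hU := hU (le_trans hk3 (ler_wpM2l (ler0n _ 3) yb)).
have L1 : 2 / kap <= b.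
  by apply: large; rewrite -sqrtE; exact: f1.
have L2 : 9 * p.+2%:R ^+ 2 * 6 ^+ 6 * expR 2 / softplus 0 ^+ 2 / (2 * kap) / kap <= b.
  by apply: large; rewrite -sqrtE; exact: f2.
have {}hU := hU L1 L2.
have KE := natr_Kdim R (k n) p.
have KC : (Kdim (k n) p).+1%:R <= C * u.
  rewrite -natr1 KE CE.
  have : (k n)%:R * p.+2%:R <= 2 * u * p.+2%:R by rewrite ler_wpM2r.
  rewrite !mulrDl; clear -u1; lra.
have KCy : (Kdim (k n) p).+1%:R <= C * y := le_trans KC (ler_wpM2l C00 uy).
have KK1 : (Kdim (k n) p)%:R <= (Kdim (k n) p).+1%:R :> R by rewrite ler_nat.
have K0C : (Kdim (k n) p)%:R <= C * u := le_trans KK1 KC.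
have K0Cy : (Kdim (k n) p)%:R <= C * y := le_trans KK1 KCy.
have hb : (eps / 4 + 1) * y <= kp * b ^+ 2.
  by rewrite bb [leRHS]mulrA; exact: (ler_wpM2r (ltW y0) hM).
have pr8 : 0 < pr / 8 by rewrite divr_gt0.
have tail := @prior_mass_rate R (Kdim (k n) p) n eps kp b C (pr / 8) n0 pr8 hb KCy.
have {}tail : expR (eps / 4 * n%:R) * ((Kdim (k n) p).+1%:R * (expR (- (kp * b ^+ 2)) * Num.sqrt 2)) <= pr / 8.
  exact: tail f3.
have cov : 4 * b * (Kdim (k n) p).+1%:R <= eps / 16 * y.
  have b40 : 0 <= 4 * b by rewrite mulr_ge0 // (le_trans ler01).
  apply: (le_trans (ler_wpM2l b40 KC)).
  (* The first two factors are the orders of [b] and of the number of parameters; the third is the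
     room left by [a < 1 / 2]. *)
  have yE : y = Num.sqrt y * u * y `^ (1 / 2 - a).
    by rewrite -sqrtE -!padd -[LHS](powRr1 (ltW y0)); congr (_ `^ _); field.
  have h : 4 * M1 * C * 16 / eps <= y `^ (1 / 2 - a) := f5.
  have su0 : 0 <= Num.sqrt y * u by apply: mulr_ge0; [exact: sqrtr_ge0|exact: le_trans u1].
  rewrite ler_pdivrMr // in h.
  have := ler_wpM2l su0 h; rewrite [X in eps / 16 * X]yE /b.
  move: (Num.sqrt y) (y `^ (1 / 2 - a)) => sy t; clear; lra.
have cover := @covering_rate R (Kdim (k n) p) n eps b (pr / 8) n0 pr8 eps0 (le_trans ler01 b1) cov.
have {}cover : ((grid_size b (expR (- (2 * b)))).+1 ^ (Kdim (k n) p).+1)%:R * expR (- (eps / 8 * n%:R)) <= pr / 8.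
  exact: cover f4.
have hC0 : C0 <= c1 / 4 * w.
  rewrite mulrC -ler_pdivrMr; [exact: f6|exact: divr_gt0].
have hC7 : C * (c6 + 3 / g) + 3 / g <= c1 / 4 * v.
  rewrite [leRHS]mulrC -ler_pdivrMr; [exact: f7|exact: divr_gt0].
have w0 : 0 < w by exact: lt_le_trans w1.
have hVz : V / zeta ^+ 2 <= c1 / 4 * w.
  rewrite ler_pdivrMr // mulrAC; apply: (le_trans hV); exact: (ler_wpM2r (ltW w0) kV2).
have hVy : V <= y.
  apply: (le_trans hV); apply: le_trans wy.
  by have := ler_wpM2r (ltW w0) kV1; rewrite mul1r.
have hD5 : C5 * (z * D) <= c1 / 4.
  have zD' := le_trans zD kD2.
  rewrite ler_pdivlMr // in zD'.
  have zD0 : 0 <= z * D by apply: mulr_ge0 => //; exact: le_trans z1.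
  clear -zD' zD0; lra.
(* (A2) gives a sum of squares below [n], hence the bound [sqrt n] on each parameter that the
   Lipschitz estimate uses. *)
have hB i : `|theta0 n i| <= Num.sqrt y.
  rewrite -sqrtr_sqr ler_wsqrtr // (le_trans _ hVy) // /V (bigD1 i) //= lerDl.
  by apply: sumr_ge0 => *; exact: sqr_ge0.
have [A1 [mA1 PA1 hev]] := evidence_bound sigma0_gt0 mf0 mX mxi indZ' lawX lawxi n eta0 zeta0 eps0
  (le_trans ler01 b1) kap0 (expR_gt0 (- (2 * b))) S0 he hz hU.
have Ds : D <= s by rewrite lerDl invr_ge0 ltW.
have [A2 [mA2 PA2 hnoise]] := noise_event sigma0_gt0 mf0 sqf0 mX mxi indZ' lawX lawxi n0 s0 Ds M0.
have [A3 [mA3 PA3 hcube]] := cube_event mX mxi indZ' lawX n.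
(* A measurable event that does not involve [qstar]; it contains the set of outcomes where the
   scaled mass exceeds [c]. *)
exists (A1 `|` A2 `|` A3); split; first by apply: measurableU => //; exact: measurableU.
split; last first.
  have PA3' : (P A3 <= 0%:E)%E by rewrite PA3.
  have := measureU_le (measurableU _ _ mA1 mA2) mA3 (measureU_le mA1 mA2 PA1 PA2) PA3'.
  move=> /le_lt_trans; apply; rewrite lte_fin -CNE addr0.
  have -> : S^-1 = pr / 8 by rewrite SE; field; rewrite gt_eqF.
  have -> : CN / M = pr / 8 by rewrite ME; field; rewrite !gt_eqF.
  clear -tail cover pr0; lra.
move=> om /= hom; apply: contrapT => /not_orP[/not_orP[nA1 nA2] nA3].
have [hS1 hS2] := hnoise om nA2.
have [vq opt] := hq n (fun i : 'I_n => X i om) (fun i : 'I_n => f0 (X i om) + xi i om).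
pose tau := (y ^+ 3)^-1.
have tau0 : 0 < tau by rewrite invr_gt0 exprn_gt0.
have VM := @vmass_le _ _ _ p f0 sigma0 X xi sigma0_gt0 mf0 mX mxi n (k n) eta zeta eps tau s S
  (Num.sqrt y) rho0 (theta0 n) _ om eta0 zeta0 eps0 tau0 s0 s1 (ltW S0) (sqrtr_ge0 y) hrho0 hB
  (hcube om nA3) vq opt (hev om nA1).
have S10 : 0 <= \sum_(i < n) xi i om ^+ 2 by apply: sumr_ge0 => i _; exact: sqr_ge0.
have S20 : 0 <= \sum_(i < n) (s * xi i om ^+ 2 / 2 + 2 * (fnet (theta0 n) (X i om) - f0 (X i om)) ^+ 2 / s).
  apply: sumr_ge0 => i _; apply: addr_ge0; apply: divr_ge0; rewrite ?(ltW s0) //;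
    by apply: mulr_ge0; rewrite ?sqr_ge0 ?(ltW s0).
have ER := elbo_rate p S rho0 V eta0 zeta0 sigma0_gt0 n1 C00 K0Cy hk3 D0 (erefl s) (erefl tau)
  (ltW M0) S10 hS1 S20 hS2.
have ly0 : 0 <= ln y by exact: ln_ge0.
have RS := rate_sum u1 v1 wE zw g0 (ler0n _ _) K0C c60 ly0 (ln_le_powR g0 y0) hC0 hC7 hVz hD5.
have := le_trans VM (le_trans ER RS).
move: hom; set m := fine _.
have m0 : 0 <= m.
  by apply: fine_ge0; apply: pint_ge0 => th rho; rewrite lee_fin mulr_ge0 // ltW // vdens_gt0.
rewrite powRN invrK -/y -/z ger0_norm; last by apply: mulr_ge0 => //; exact: le_trans z1.
move=> hm hle.
have e40 : 0 < eps / 4 by rewrite divr_gt0.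
have : eps / 4 * (c * w) < eps / 4 * (m * z * w) by rewrite ltr_pM2l // ltr_pM2r.
move: hle; rewrite -zw c1E; clear; lra.
Unshelve. all: by end_near. Qed.
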